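(* Let $(S_n^{(1)},S_n^{(2)})_{n\ge0}$ be a two-elephant walking model with memory parameters $p_1,p_2\in[0,1]$ such that $\alpha_1\alpha_2>0$, where $\alpha_i=2p_i-1$. If $\alpha_1=\alpha_2=1$ assume $X_1^{(1)}\neq X_1^{(2)}$, and if $\alpha_1=\alpha_2=-1$ assume $X_1^{(1)}=X_1^{(2)}$. Let $\lambda_\alpha:=\operatorname{sgn}(\alpha_2)\sqrt{\alpha_1\alpha_2}$. Then there is a constant $C(\alpha)\in(0,\infty)$ depending only on $\alpha_1,\alpha_2$ such that: (i) If $|\lambda_\alpha|<1/2$, then almost surely $\limsup_{n\to\infty}\frac{|S_n^{(1)}|}{\sqrt{n\log\log n}}\le C(\alpha)$, and $$\frac{S_n^{(1)}}{\sqrt n}\xrightarrow{D}\mathcal N\Big(0,\frac{1+2\alpha_1^2-2\alpha_1\alpha_2}{1-4\alpha_1\alpha_2}\Big).$$ (ii) If $|\lambda_\alpha|=1/2$, then almost surely $\limsup_{n\to\infty}\frac{|S_n^{(1)}|}{\sqrt{n\log n\,\log\log\log n}}\le C(\alpha)$, and $$\frac{S_n^{(1)}}{\sqrt{n\log n}}\xrightarrow{D}\mathcal N\Big(0,\frac{\alpha_1+\alpha_2}{4\alpha_2}\Big).$$ (iii) If $|\lambda_\alpha|>1/2$, then the limits below exist almost surely and $$\lim_{n\to\infty}\frac{S_n^{(1)}}{n^{|\lambda_\alpha|}}=\operatorname{sgn}(\alpha_2)\sqrt{\frac{\alpha_1}{\alpha_2}}\,\lim_{n\to\infty}\frac{S_n^{(2)}}{n^{|\lambda_\alpha|}}=W\quad\text{a.s.},$$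 where $W$ is a non-degenerate (not almost surely constant) random variable.
   Context: Two-elephant walking model: fix $p_1,p_2\in[0,1]$. Let $(\xi_n^{(1)})_{n\ge2}$ be i.i.d. Bernoulli($p_1$), $(\xi_n^{(2)})_{n\ge2}$ i.i.d. Bernoulli($p_2$), and $(u_n^{(1)})_{n\ge1}$, $(u_n^{(2)})_{n\ge1}$ independent with each $u_n^{(i)}$ uniform on $\{1,\dots,n\}$; all families mutually independent. Set $S_0^{(1)}=S_0^{(2)}=0$, let the initial steps $X_1^{(1)},X_1^{(2)}\in\{-1,1\}$ be given, and for $n\ge1$ $$X_{n+1}^{(1)}:=\xi^{(1)}_{n+1}X^{(2)}_{u_n^{(2)}}-(1-\xi^{(1)}_{n+1})X^{(2)}_{u_n^{(2)}},\qquad X_{n+1}^{(2)}:=\xi^{(2)}_{n+1}X^{(1)}_{u_n^{(1)}}-(1-\xi^{(2)}_{n+1})X^{(1)}_{u_n^{(1)}},$$ with $S_n^{(i)}:=\sum_{k=1}^nX_k^{(i)}$. $\xrightarrow{D}$ denotes convergence in distribution. *)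

(* Defs.v *)
From HB Require Import structures.
From mathcomp Require Import all_boot all_order all_algebra.
From mathcomp Require Import all_classical all_reals all_analysis.
From Stdlib Require List.
Set Implicit Arguments. Unset Strict Implicit. Unset Printing Implicit Defensive.
Import Order.TTheory GRing.Theory Num.Theory.
Import numFieldNormedType.Exports.
Local Open Scope classical_set_scope.
Local Open Scope ring_scope.

(* sign of a Bernoulli variable: xi X - (1 - xi) X = (2 xi - 1) X *)
Definition bsign {R : realType} (b : bool) : R := if b then 1 else -1.

(* The list [:: (X_1^(1), X_1^(2)); ...; (X_n^(1), X_n^(2))] of the first n
   pairs of steps, given realisations of xi^(1), xi^(2), u^(1), u^(2) and
   the initial steps x1, x2.  X_{n+1}^(1) = (2 xi^(1)_{n+1} - 1) X^(2)_{u^(2)_n}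
   and symmetrically; since u_n is uniform on {1..n}, the (a.s. unreachable)
   out-of-range case uses an arbitrary default. *)
Fixpoint elephant_steps {R : realType} (xi1 xi2 : nat -> bool)
    (u1 u2 : nat -> nat) (x1 x2 : R) (n : nat) : seq (R * R)%type :=
  match n with
  | 0 => [::]
  | 1 => [:: (x1, x2)]
  | (m.+1 as k).+1 =>
      let s := elephant_steps xi1 xi2 u1 u2 x1 x2 k in
      rcons s (bsign (xi1 k.+1) * nth 0 (unzip2 s) (u2 k - 1)%N,
               bsign (xi2 k.+1) * nth 0 (unzip1 s) (u1 k - 1)%N)
  end.

Definition S1 {R : realType} {T : Type} (xi1 xi2 : nat -> T -> bool)
    (u1 u2 : nat -> T -> nat) (x1 x2 : R) (n : nat) (w : T) : R :=
  \sum_(z <- elephant_steps (xi1^~ w) (xi2^~ w) (u1^~ w) (u2^~ w) x1 x2 n) z.1.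
Definition S2 {R : realType} {T : Type} (xi1 xi2 : nat -> T -> bool)
    (u1 u2 : nat -> T -> nat) (x1 x2 : R) (n : nat) (w : T) : R :=
  \sum_(z <- elephant_steps (xi1^~ w) (xi2^~ w) (u1^~ w) (u2^~ w) x1 x2 n) z.2.

Inductive src := SXi1 | SXi2 | SU1 | SU2.

Definition valid_index (j : (src * nat)%type) : Prop :=
  match j.1 with SXi1 | SXi2 => (2 <= j.2)%N | SU1 | SU2 => (1 <= j.2)%N end.

Definition model_independent {d} {T : measurableType d} {R : realType}
    (P : probability T R) (xi1 xi2 : nat -> T -> bool) (u1 u2 : nat -> T -> nat) :=
  forall (J : seq (src * nat)%type) (B1 B2 : nat -> set bool) (C1 C2 : nat -> set nat),
    List.NoDup J -> (forall j, List.In j J -> valid_index j) ->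
    let ev (j : (src * nat)%type) : set T :=
      match j.1 with
      | SXi1 => xi1 j.2 @^-1` B1 j.2
      | SXi2 => xi2 j.2 @^-1` B2 j.2
      | SU1 => u1 j.2 @^-1` C1 j.2
      | SU2 => u2 j.2 @^-1` C2 j.2
      end in
    P (\bigcap_(j in [set j | List.In j J]) ev j) = (\prod_(j <- J) P (ev j))%E.

Definition two_elephant_model {d} {T : measurableType d} {R : realType}
    (P : probability T R) (p1 p2 : R)
    (xi1 xi2 : nat -> T -> bool) (u1 u2 : nat -> T -> nat) : Prop :=
  [/\ (forall n, measurable_fun setT (xi1 n)),
      (forall n, measurable_fun setT (xi2 n)),
      (forall n, measurable_fun setT (u1 n)),
      (forall n, measurable_fun setT (u2 n)) &
  [/\ (forall n, (2 <= n)%N -> P (xi1 n @^-1` [set true]) = p1%:E),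
      (forall n, (2 <= n)%N -> P (xi2 n @^-1` [set true]) = p2%:E),
      (forall n k, (1 <= k <= n)%N -> P (u1 n @^-1` [set k]) = (n%:R^-1)%:E),
      (forall n k, (1 <= k <= n)%N -> P (u2 n @^-1` [set k]) = (n%:R^-1)%:E) &
      model_independent P xi1 xi2 u1 u2]].

Definition conv_in_distribution {d} {T : measurableType d} {R : realType}
    (P : probability T R) (Y : nat -> T -> R) (mu : probability (measurableTypeR R) R) : Prop :=
  forall f : R -> R, continuous f -> (exists M : R, forall x, `|f x| <= M) ->
    (fun n => (\int[P]_w (f (Y n w))%:E)%E) @ \oo --> (\int[mu]_x (f x)%:E)%E.

(* Main.v *)
(** Put [r = sqrt (a1 a2)] and [theta = r / a2]. Both [S1 + theta S2] and
    [S1 - theta S2] are, after division by the growth factors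
    [prod_(2 <= k < n) (1 + r / k)] and [prod_(2 <= k < n) (1 - r / k)],
    martingales with bounded steps, and [S1] is half the sum of the two linear
    combinations.
    The bounds on the limsup follow from an exponential maximal inequality and
    Borel-Cantelli along the times [2 ^ j] when [r < 1/2], and [2 ^ (2 ^ j)] when
    [r = 1/2]. When [r > 1/2] the quadratic variation is summable, so the first
    martingale converges while the second linear combination is negligible; a
    constant limit would make all the conditional variances vanish.
    For the central limit theorem, the heat kernel evaluated along the martingale
    that ends at the rescaled [S1] is almost constant in mean (Lindeberg's
    argument), so the Gaussian-smoothed laws have densities that converge
    pointwise; Scheffe's lemma and a small smoothing parameter then give
    convergence in distribution. *)
Require Import Defs.
From HB Require Import structures.
From mathcomp Require Import all_boot all_order all_algebra.
From mathcomp Require Import all_classical all_reals all_analysis.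
From mathcomp Require Import measurable_realfun.
From mathcomp Require Import ring lra zify.
Set Implicit Arguments.
Unset Strict Implicit.
Unset Printing Implicit Defensive.
Import Order.TTheory GRing.Theory Num.Theory.
Import numFieldNormedType.Exports.
Local Open Scope classical_set_scope.
Local Open Scope ring_scope.

(** * The law of the walk as a finite recursion *)

(** The conditional means are the matrix with rows [(0, a1)] and [(a2, 0)] applied to the two
    running averages. Its left eigenvectors are [(1, theta)] and [(1, - theta)], with eigenvalues
    [r] and [- r]; hence most sections fix an abstract pair with [a1 = rho * theta] and
    [theta * a2 = rho], and are instantiated once per sign. Conditional expectations are replaced by
    [Ex], a finite recursion on lists of steps in which the tower property holds by definition; the
    probability space enters through the laws of finite prefixes. The two martingales have different
    normalisations, so no single rescaling makes [S1] a martingale. For the central limit theorem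
    the horizon [n] is fixed and both are recombined with weights frozen at [n]. This gives a
    martingale with deterministic coefficients, whose conditional variances are random only through
    the squared conditional means, and these vanish in mean when [r <= 1/2]. The constant of the
    limsup bounds is built from [r] and [theta] before any probability space is introduced, so it
    depends on the parameters alone. *)

Lemma eq_ler {R : numDomainType} (x y : R) : x = y -> x <= y.
Proof. by move->. Qed.

Section expectation.
Context {R : realType}.
Variables (a1 a2 x1 x2 : R).
Implicit Types (s : seq (R * R)) (F G : seq (R * R) -> R).

Definition sum1 s : R := \sum_(z <- s) z.1.
Definition sum2 s : R := \sum_(z <- s) z.2.

Definition mean1 s : R := a1 * sum2 s / (size s)%:R.
Definition mean2 s : R := a2 * sum1 s / (size s)%:R.

(* Given the past [s], the two next steps are independent signs with means
   [mean1 s] and [mean2 s]: averaging over [xi] and [u] leaves only these. *)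
Definition step F s : R :=
  (1 + mean1 s) / 2 * ((1 + mean2 s) / 2) * F (rcons s (1, 1)) +
  (1 + mean1 s) / 2 * ((1 - mean2 s) / 2) * F (rcons s (1, -1)) +
  (1 - mean1 s) / 2 * ((1 + mean2 s) / 2) * F (rcons s (-1, 1)) +
  (1 - mean1 s) / 2 * ((1 - mean2 s) / 2) * F (rcons s (-1, -1)).

(* [Ex n F] is the expectation of [F] at the first [n.+1] pairs of steps. *)
Fixpoint Ex n F : R :=
  if n is m.+1 then Ex m (step F) else F [:: (x1, x2)].

Definition signs s := all (fun z => (`|z.1| == 1) && (`|z.2| == 1)) s.
(** The weights in [step] are guaranteed to be nonnegative only along lists of signs, so every order
    statement about [Ex] is relativised to [path_of]. The index is one less than the length, as in
    [Ex]. *)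
Definition path_of n s := (size s == n.+1) && signs s.

Lemma stepD F G s : step (fun s => F s + G s) s = step F s + step G s.
Proof. rewrite /step; ring. Qed.

Lemma stepZ c F s : step (fun s => c * F s) s = c * step F s.
Proof. rewrite /step; ring. Qed.

Lemma step_cst c s : step (fun=> c) s = c.
Proof. by rewrite /step; field. Qed.

Lemma eq_Ex n F G : F =1 G -> Ex n F = Ex n G.
Proof.
elim: n F G => /= [|n IH] F G FG; first exact: FG.
by apply: IH => s; rewrite /step !FG.
Qed.

Lemma ExD n F G : Ex n (fun s => F s + G s) = Ex n F + Ex n G.
Proof.
elim: n F G => //= n IH F G; rewrite -IH; apply: eq_Ex => s; exact: stepD.
Qed.

Lemma ExZ n c F : Ex n (fun s => c * F s) = c * Ex n F.
Proof.
elim: n F => //= n IH F; rewrite -IH; apply: eq_Ex => s; exact: stepZ.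
Qed.

Lemma ExN n F : Ex n (fun s => - F s) = - Ex n F.
Proof.
by rewrite -mulN1r -ExZ; apply: eq_Ex => s; rewrite mulN1r.
Qed.

Lemma ExB n F G : Ex n (fun s => F s - G s) = Ex n F - Ex n G.
Proof. by rewrite ExD ExN. Qed.

Lemma Ex_cst n c : Ex n (fun=> c) = c.
Proof.
by elim: n => //= n IH; rewrite -[RHS]IH; apply: eq_Ex => s; rewrite step_cst.
Qed.

Lemma Ex_sum n (I : Type) (r : seq I) (P : pred I) (F : I -> seq (R * R) -> R) :
  Ex n (fun s => \sum_(i <- r | P i) F i s) = \sum_(i <- r | P i) Ex n (F i).
Proof.
elim: r => [|i r IH].
  by rewrite big_nil; apply: (etrans _ (Ex_cst n 0)); apply: eq_Ex => s; rewrite big_nil.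
rewrite big_cons; case: ifP => Pi.
  rewrite -IH -ExD; apply: eq_Ex => s; by rewrite big_cons Pi.
by rewrite -IH; apply: eq_Ex => s; rewrite big_cons Pi.
Qed.

Lemma path_rcons n s (e1 e2 : R) : path_of n s -> `|e1| = 1 -> `|e2| = 1 ->
  path_of n.+1 (rcons s (e1, e2)).
Proof.
move=> /andP[/eqP sn ss] e1E e2E.
by rewrite /path_of size_rcons sn eqxx /signs all_rcons /= e1E e2E eqxx.
Qed.

Lemma path_size n s : path_of n s -> size s = n.+1.
Proof. by case/andP => /eqP. Qed.

Lemma sum1_rcons s z : sum1 (rcons s z) = sum1 s + z.1.
Proof. by rewrite /sum1 -cats1 big_cat big_seq1. Qed.

Lemma sum2_rcons s z : sum2 (rcons s z) = sum2 s + z.2.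
Proof. by rewrite /sum2 -cats1 big_cat big_seq1. Qed.

Lemma signs_sum s : signs s -> `|sum1 s| <= (size s)%:R /\ `|sum2 s| <= (size s)%:R.
Proof.
elim/last_ind: s => [|s z IH]; first by rewrite /sum1 /sum2 !big_nil normr0.
rewrite /signs all_rcons => /andP[/andP[/eqP z1 /eqP z2]] /IH[h1 h2].
rewrite sum1_rcons sum2_rcons size_rcons -natr1; split.
  by rewrite (le_trans (ler_normD _ _))// z1 lerD2r.
by rewrite (le_trans (ler_normD _ _))// z2 lerD2r.
Qed.

Hypotheses (a1_le1 : `|a1| <= 1) (a2_le1 : `|a2| <= 1).

Lemma mean_bound n s : path_of n s -> `|mean1 s| <= 1 /\ `|mean2 s| <= 1.
Proof.
move=> /andP[/eqP sn /signs_sum[h1 h2]]; rewrite /mean1 /mean2 !normrM.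
have s0 : 0 < (size s)%:R :> R by rewrite sn ltr0n.
rewrite normfV (gtr0_norm s0) !ler_pdivrMr// !mul1r; split.
  by rewrite (le_trans _ h2)// ler_piMl.
by rewrite (le_trans _ h1)// ler_piMl.
Qed.

Lemma le_step n F G s : path_of n s ->
  (forall t, path_of n.+1 t -> F t <= G t) -> step F s <= step G s.
Proof.
move=> ps FG; have [] := mean_bound ps; rewrite !ler_norml /step.
have n1 : `|1 : R| = 1 by rewrite normr1.
have n1' : `|-1 : R| = 1 by rewrite normrN normr1.
move=> /andP[h1 h2] /andP[h3 h4].
by rewrite !lerD// ler_wpM2l ?FG ?path_rcons// mulr_ge0//; lra.
Qed.

Hypotheses (nx1 : `|x1| = 1) (nx2 : `|x2| = 1).

Lemma le_Ex n F G : (forall s, path_of n s -> F s <= G s) -> Ex n F <= Ex n G.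
Proof.
elim: n F G => /= [|n IH] F G FG.
  by apply: FG; rewrite /path_of /signs /= nx1 nx2 !eqxx.
by apply: IH => s ps; apply: le_step FG.
Qed.

Lemma eq_Ex_path n F G : (forall s, path_of n s -> F s = G s) -> Ex n F = Ex n G.
Proof. by move=> FG; apply/eqP; rewrite eq_le !le_Ex// => s /FG->. Qed.

Lemma Ex_ge0 n F : (forall s, path_of n s -> 0 <= F s) -> 0 <= Ex n F.
Proof. by move=> F0; rewrite -[leLHS](Ex_cst n 0); exact: le_Ex. Qed.

Lemma ler_norm_Ex n F : `|Ex n F| <= Ex n (fun s => `|F s|).
Proof.
rewrite ler_norml; apply/andP; split; last by apply: le_Ex => s _; exact: ler_norm.
by rewrite -ExN; apply: le_Ex => s _; rewrite lerNl -normrN ler_norm.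
Qed.

End expectation.

(** * One step of the walk as an average over the Bernoulli and uniform variables *)

Section averaging.
Context {R : realType}.

Definition bern (p : R) (b : bool) : R := if b then p else 1 - p.

(** The indices cross over: [k2] reads the past of the second elephant to move the first one, and
    [k1] conversely. Both are zero-based. *)
Definition next_steps (b1 b2 : bool) (k1 k2 : nat) (s : seq (R * R)) :=
  rcons s (bsign b1 * nth 0 (unzip2 s) k2, bsign b2 * nth 0 (unzip1 s) k1).

Lemma bern_ge0 (p : R) b : 0 <= p <= 1 -> 0 <= bern p b.
Proof. by case: b => /= /andP[p0 p1]; rewrite ?subr_ge0. Qed.

(** On signs every function is affine, with constant part [(phi 1 + phi (-1)) / 2] and slope
    [(phi 1 - phi (-1)) / 2]. Averaging therefore only sees the mean of the sign, which is
    [2 * p - 1] times the average of [xs]. *)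
Lemma average_sign (p : R) n (xs : seq R) (phi : R -> R) :
  size xs = n.+1 -> all (fun x => `|x| == 1) xs ->
  let m := (2 * p - 1) * (\sum_(x <- xs) x) / n.+1%:R in
  \sum_(c : bool * 'I_n.+1) bern p c.1 / n.+1%:R * phi (bsign c.1 * nth 0 xs c.2)
  = (1 + m) / 2 * phi 1 + (1 - m) / 2 * phi (-1).
Proof.
move=> sx axs m.
rewrite -(pair_bigA _ (fun b (k : 'I_n.+1) => bern p b / n.+1%:R * phi (bsign b * nth 0 xs k))) /=.
rewrite exchange_big /=.
have n0 : n.+1%:R != 0 :> R by rewrite pnatr_eq0.
have E (k : 'I_n.+1) : \sum_(b : bool) bern p b / n.+1%:R * phi (bsign b * nth 0 xs k)
    = (2 * n.+1%:R)^-1 * (phi 1 + phi (-1)) +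
      (2 * p - 1) / (2 * n.+1%:R) * (phi 1 - phi (-1)) * nth 0 xs k.
  rewrite big_bool /bsign /= mul1r.
  have /(all_nthP 0) /(_ k) := axs; rewrite sx ltn_ord => /(_ isT).
  by rewrite eqr_norml ler01 andbT => /orP[] /eqP->; rewrite ?mulr1 ?mulN1r ?opprK; field; rewrite nat1r n0 ?andbT.
rewrite (eq_bigr _ (fun k _ => E k)) big_split /= -!mulr_sumr sumr_const card_ord.
have -> : \sum_(i < n.+1) nth 0 xs i = \sum_(x <- xs) x.
  by rewrite [RHS](big_nth 0) sx big_mkord.
by rewrite /m -mulr_natr; field; rewrite nat1r n0 ?andbT.
Qed.

(** The components of [c] are grouped by the elephant they move, [(xi1, u2)] and [(xi2, u1)], so
    that [average_sign] applies first to the inner sum and then to the outer one. *)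
Lemma step_average (p1 p2 : R) n s F : path_of n s ->
  \sum_(c : (bool * 'I_n.+1) * (bool * 'I_n.+1))
     (bern p1 c.1.1 / n.+1%:R) * (bern p2 c.2.1 / n.+1%:R) *
     F (next_steps c.1.1 c.2.1 c.2.2 c.1.2 s) =
  step (2 * p1 - 1) (2 * p2 - 1) F s.
Proof.
move=> /andP[/eqP sn /allP as_].
have A1 : all (fun x : R => `|x| == 1) (unzip1 s).
  by apply/allP => x /mapP[z /as_ /andP[z1 _] ->].
have A2 : all (fun x : R => `|x| == 1) (unzip2 s).
  by apply/allP => x /mapP[z /as_ /andP[_ z1] ->].
have Z1 : size (unzip1 s) = n.+1 by rewrite size_map.
have Z2 : size (unzip2 s) = n.+1 by rewrite size_map.
rewrite -(pair_bigA _ (fun (c d : bool * 'I_n.+1) => bern p1 c.1 / n.+1%:R *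
  (bern p2 d.1 / n.+1%:R) * F (next_steps c.1 d.1 d.2 c.2 s))) /=.
rewrite /next_steps.
under eq_bigr => c _.
  under eq_bigr do rewrite -mulrA.
  rewrite -mulr_sumr.
  rewrite (average_sign p2 (fun y => F (rcons s (bsign c.1 * nth 0 (unzip2 s) c.2, y))) Z1 A1).
  over.
rewrite /= (average_sign p1 (fun x => (1 + (2 * p2 - 1) * (\sum_(y <- unzip1 s) y) / n.+1%:R) / 2 *
   F (rcons s (x, 1)) + (1 - (2 * p2 - 1) * (\sum_(y <- unzip1 s) y) / n.+1%:R) / 2 *
   F (rcons s (x, -1))) Z2 A2).
rewrite /step /mean1 /mean2 /sum1 /sum2 sn !big_map; ring.
Qed.

End averaging.

(** * The law of the walk on the probability space *)

Section model.
Context {R : realType} {d : measure_display} {T : measurableType d}.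
Variables (P : probability T R) (p1 p2 : R).
Variables (xi1 xi2 : nat -> T -> bool) (u1 u2 : nat -> T -> nat) (x1 x2 : R).
Hypothesis (model : two_elephant_model P p1 p2 xi1 xi2 u1 u2).
Hypotheses (p1_01 : 0 <= p1 <= 1) (p2_01 : 0 <= p2 <= 1).
Hypotheses (nx1 : `|x1| = 1) (nx2 : `|x2| = 1).

Definition steps n (w : T) : seq (R * R) :=
  elephant_steps (xi1^~ w) (xi2^~ w) (u1^~ w) (u2^~ w) x1 x2 n.

Lemma steps_next n w : steps n.+2 w =
  next_steps (xi1 n.+2 w) (xi2 n.+2 w) (u1 n.+1 w - 1) (u2 n.+1 w - 1) (steps n.+1 w).
Proof. by []. Qed.

Let mxi1 n (B : set bool) : measurable (xi1 n @^-1` B).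
Proof. by case: model => m _ _ _ _; rewrite -[X in measurable X]setTI; exact: m. Qed.
Let mxi2 n (B : set bool) : measurable (xi2 n @^-1` B).
Proof. by case: model => _ m _ _ _; rewrite -[X in measurable X]setTI; exact: m. Qed.
Let mu1 n (B : set nat) : measurable (u1 n @^-1` B).
Proof. by case: model => _ _ m _ _; rewrite -[X in measurable X]setTI; exact: m. Qed.
Let mu2 n (B : set nat) : measurable (u2 n @^-1` B).
Proof. by case: model => _ _ _ m _; rewrite -[X in measurable X]setTI; exact: m. Qed.

(** Any set of lists is allowed, because the list of steps is a function of countably many possible
    values of the sources: the preimage is a countable union over the last four of them. *)
Lemma measurable_steps n (A : set (seq (R * R))) : measurable (steps n.+1 @^-1` A).
Proof.
elim: n A => [|n IH] A.
  have [Ax|nAx] := pselect (A [:: (x1, x2)]).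
    rewrite (_ : _ @^-1` _ = setT) //.
    by apply/seteqP; split.
  by rewrite (_ : _ @^-1` _ = set0)//; apply/seteqP; split.
pose D (c : (bool * nat) * (bool * nat)) : set T :=
  (xi1 n.+2 @^-1` [set c.1.1] `&` u2 n.+1 @^-1` [set c.1.2]) `&`
  (xi2 n.+2 @^-1` [set c.2.1] `&` u1 n.+1 @^-1` [set c.2.2]) `&`
  steps n.+1 @^-1` [set s | A (next_steps c.1.1 c.2.1 (c.2.2 - 1) (c.1.2 - 1) s)].
rewrite (_ : _ @^-1` _ = \bigcup_c D c).
  apply: countable_bigcupT_measurable; first exact: countableP.
  move=> c; apply: measurableI; last exact: IH.
  by apply: measurableI; apply: measurableI.
apply/seteqP; split => w.
  move=> Aw; exists ((xi1 n.+2 w, u2 n.+1 w), (xi2 n.+2 w, u1 n.+1 w)) => //.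
move=> [c _] [[[e1 e2] [e3 e4]]]; rewrite /D /preimage /= in e1 e2 e3 e4 *.
by rewrite steps_next e1 e2 e3 e4.
Qed.

Section events.
Variables (B1 B2 : nat -> set bool) (C1 C2 : nat -> set nat).

Definition event (j : src * nat) : set T :=
  match j.1 with
  | SXi1 => xi1 j.2 @^-1` B1 j.2
  | SXi2 => xi2 j.2 @^-1` B2 j.2
  | SU1 => u1 j.2 @^-1` C1 j.2
  | SU2 => u2 j.2 @^-1` C2 j.2
  end.

Definition events (J : seq (src * nat)) : set T := \bigcap_(j in [set j | List.In j J]) event j.

Lemma events_cons j J : events (j :: J) = event j `&` events J.
Proof.
apply/seteqP; split=> [w h|w [h1 h2] i [<-//|]].
  by split; [apply: h; left|move=> i ij; apply: h; right].
exact: h2.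
Qed.

Lemma measurable_event j : measurable (event j).
Proof.
by case: j => -[] k; rewrite /event /=; [exact: mxi1|exact: mxi2|exact: mu1|exact: mu2].
Qed.

Lemma measurable_events J : measurable (events J).
Proof.
elim: J => [|j J IH].
  rewrite /events (_ : [set j | _] = set0); first by rewrite bigcap_set0; exact: measurableT.
  by rewrite -subset0 => j [].
by rewrite events_cons; apply: measurableI => //; exact: measurable_event.
Qed.

End events.

Lemma events_indep B1 B2 C1 C2 J : List.NoDup J -> (forall j, List.In j J -> valid_index j) ->
  P (events B1 B2 C1 C2 J) = (\prod_(j <- J) P (event B1 B2 C1 C2 j))%E.
Proof. by case: model => _ _ _ _ [_ _ _ _ h] ND V; exact: h. Qed.

Let pxi1 n b : P (xi1 n.+2 @^-1` [set b]) = (bern p1 b)%:E.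
Proof.
case: model => _ _ _ _ [h _ _ _ _]; case: b; first by rewrite h.
rewrite (_ : _ @^-1` _ = ~` (xi1 n.+2 @^-1` [set true])).
  by rewrite probability_setC// h.
by apply/seteqP; split => w /=; case: xi1.
Qed.

Let pxi2 n b : P (xi2 n.+2 @^-1` [set b]) = (bern p2 b)%:E.
Proof.
case: model => _ _ _ _ [_ h _ _ _]; case: b; first by rewrite h.
rewrite (_ : _ @^-1` _ = ~` (xi2 n.+2 @^-1` [set true])).
  by rewrite probability_setC// h.
by apply/seteqP; split => w /=; case: xi2.
Qed.

(** The model prescribes only the masses of the points [1..n.+1]. They already add up to one, so the
    remaining values form a null event. *)
Let uniform_range (u : T -> nat) n : (forall B, measurable (u @^-1` B)) ->
  (forall k, (1 <= k <= n.+1)%N -> P (u @^-1` [set k]) = (n.+1%:R^-1)%:E) ->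
  P (~` \big[setU/set0]_(k < n.+1) (u @^-1` [set k.+1])) = 0%E.
Proof.
move=> mu h; have mU : measurable (\big[setU/set0]_(k < n.+1) (u @^-1` [set k.+1])).
  by apply: bigsetU_measurable.
rewrite probability_setC// (@measure_bigsetU _ _ _ P (fun k : nat => u @^-1` [set k.+1]))//; last first.
  by apply/trivIsetP => i j _ _ ij; rewrite -subset0 => w [/= -> [ji]]; rewrite ji eqxx in ij.
rewrite (eq_bigr (fun=> (n.+1%:R^-1)%:E)); last by move=> k _; rewrite /= h // ltn_ord.
by rewrite sumEFin sumr_const card_ord -(mulr_natr _^-1) mulVf ?pnatr_eq0//= subee.
Qed.

Let upd {V : Type} k0 (v : V) (B : nat -> set V) k := if k == k0 then [set v] else B k.

Let updE {V : Type} k (v : V) B : upd k v B k = [set v].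
Proof. by rewrite /upd eqxx. Qed.

(** These are the sources that do not influence the first [n.+1] pairs: step [n.+1] is produced by
    [xi n.+1] and [u n], hence the different thresholds. *)
Definition late n (j : src * nat) : Prop :=
  match j.1 with SXi1 | SXi2 => (n.+1 < j.2)%N | SU1 | SU2 => (n.+1 <= j.2)%N end.

Let late_valid n j : late n j -> valid_index j.
Proof. by case: j => -[] k; rewrite /late /valid_index /= => h; apply: leq_trans h. Qed.

Lemma measurable_fun_steps n (G : seq (R * R) -> R) :
  measurable_fun setT (fun w => G (steps n.+1 w)).
Proof. by move=> _ B mB; rewrite setTI; exact: (measurable_steps n (G @^-1` B)). Qed.

Let events_ext B1 B2 C1 C2 B1' B2' C1' C2' J :
  (forall j, List.In j J -> event B1 B2 C1 C2 j = event B1' B2' C1' C2' j) ->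
  events B1 B2 C1 C2 J = events B1' B2' C1' C2' J.
Proof. by move=> h; apply: eq_bigcapr => j jJ; exact: h. Qed.

Local Notation a1 := (2 * p1 - 1).
Local Notation a2 := (2 * p2 - 1).

Let na1 : `|a1| <= 1.
Proof. by case/andP: p1_01 => h1 h2; rewrite ler_norml; apply/andP; split; lra. Qed.
Let na2 : `|a2| <= 1.
Proof. by case/andP: p2_01 => h1 h2; rewrite ler_norml; apply/andP; split; lra. Qed.

(** Carrying an arbitrary finite family of later events is what makes the induction close: peeling
    off the last step fixes four sources, and these become four more later events for the shorter
    walk. *)
Lemma integral_steps_events n (G : seq (R * R) -> R) B1 B2 C1 C2 J :
  (forall s, 0 <= G s) -> List.NoDup J -> (forall j, List.In j J -> late n j) ->
  (\int[P]_(w in events B1 B2 C1 C2 J) (G (steps n.+1 w))%:E =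
   (Ex a1 a2 x1 x2 n G)%:E * \prod_(j <- J) P (event B1 B2 C1 C2 j))%E.
Proof.
elim: n G B1 B2 C1 C2 J => [|n IH] G B1 B2 C1 C2 J G0 ND L.
  have <- := @events_indep B1 B2 C1 C2 J ND (fun j jJ => late_valid (L j jJ)).
  exact: (integral_cst P (measurable_events B1 B2 C1 C2 J) (G [:: (x1, x2)])%:E).
(* The four sources of the last step are late for [n] but not for [n.+1]. So the induction
   hypothesis applies to [J'], its entries are distinct, and pinning them with [upd] does not alter
   the events indexed by [J]. *)
pose J' := [:: (SXi1, n.+2), (SU2, n.+1), (SXi2, n.+2), (SU1, n.+1) & J].
pose B1' (c : (bool * 'I_n.+1) * (bool * 'I_n.+1)) := upd n.+2 c.1.1 B1.
pose B2' (c : (bool * 'I_n.+1) * (bool * 'I_n.+1)) := upd n.+2 c.2.1 B2.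
pose C1' (c : (bool * 'I_n.+1) * (bool * 'I_n.+1)) := upd n.+1 (c.2.2.+1) C1.
pose C2' (c : (bool * 'I_n.+1) * (bool * 'I_n.+1)) := upd n.+1 (c.1.2.+1) C2.
pose E c := events (B1' c) (B2' c) (C1' c) (C2' c) J'.
have evJ c j : List.In j J ->
    event (B1' c) (B2' c) (C1' c) (C2' c) j = event B1 B2 C1 C2 j.
  move=> /L; case: j => -[] k; rewrite /late /event /= => kn;
    rewrite /B1' /B2' /C1' /C2' /upd; (case: eqP => [kE|//]; lia).
have EE c : E c = (xi1 n.+2 @^-1` [set c.1.1] `&` (u2 n.+1 @^-1` [set c.1.2.+1 : nat] `&`
     (xi2 n.+2 @^-1` [set c.2.1] `&` (u1 n.+1 @^-1` [set c.2.2.+1 : nat] `&`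
      events B1 B2 C1 C2 J)))).
  rewrite /E !events_cons (events_ext (evJ c)).
  by rewrite /event /= /B1' /B2' /C1' /C2' !updE.
have prodE c : (\prod_(j <- J') P (event (B1' c) (B2' c) (C1' c) (C2' c) j) =
    (bern p1 c.1.1 / n.+1%:R * (bern p2 c.2.1 / n.+1%:R))%:E *
    \prod_(j <- J) P (event B1 B2 C1 C2 j))%E.
  rewrite !big_cons.
  have -> : (\prod_(j <- J) P (event (B1' c) (B2' c) (C1' c) (C2' c) j) =
      \prod_(j <- J) P (event B1 B2 C1 C2 j))%E.
    elim: (J) (evJ c) => [|j K IHJ] h; first by rewrite !big_nil.
    by rewrite !big_cons h; [rewrite IHJ// => i iJ; apply: h; right|left].
  rewrite {1 2 3 4}/event /= /B1' /B2' /C1' /C2' !updE pxi1 pxi2.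
  case: model => _ _ _ _ [_ _ h1 h2 _].
  rewrite h1 ?ltn_ord// h2 ?ltn_ord// !muleA -!EFinM.
  by congr (_%:E * _)%E; ring.
have mE c : measurable (E c) by exact: measurable_events.
(* Outside a null event both memory indices lie in [1..n.+1], and the integral splits over finitely
   many disjoint events [E c]. *)
pose U1 := \big[setU/set0]_(k < n.+1) (u1 n.+1 @^-1` [set k.+1]).
pose U2 := \big[setU/set0]_(k < n.+1) (u2 n.+1 @^-1` [set k.+1]).
have U1E : U1 = \bigcup_(k in `I_n.+1) (u1 n.+1 @^-1` [set k.+1]).
  by rewrite (bigcup_mkord n.+1 (fun k : nat => u1 n.+1 @^-1` [set k.+1])).
have U2E : U2 = \bigcup_(k in `I_n.+1) (u2 n.+1 @^-1` [set k.+1]).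
  by rewrite (bigcup_mkord n.+1 (fun k : nat => u2 n.+1 @^-1` [set k.+1])).
have mU1 : measurable U1 by apply: bigsetU_measurable => k _; exact: mu1.
have mU2 : measurable U2 by apply: bigsetU_measurable => k _; exact: mu2.
have PU1 : P (~` U1) = 0%E.
  by apply: uniform_range => [B|k kn]; [exact: mu1|case: model => _ _ _ _ [_ _ h _ _]; rewrite h].
have PU2 : P (~` U2) = 0%E.
  by apply: uniform_range => [B|k kn]; [exact: mu2|case: model => _ _ _ _ [_ _ _ h _]; rewrite h].
have mN : measurable (~` U1 `|` ~` U2) by apply: measurableU; exact: measurableC.
have PN : P (~` U1 `|` ~` U2) = 0%E.
  apply/eqP; rewrite eq_le measure_ge0 andbT -[leRHS]adde0 -{1}PU1 -PU2.
  by apply: measureU2; exact: measurableC.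
have mG m : measurable_fun setT (EFin \o (fun w => G (steps m.+1 w))).
  by apply/measurable_EFinP; exact: measurable_fun_steps.
rewrite (ge0_negligible_integral mN)//; [|exact: measurable_events|
  by apply: measurable_funTS; exact: mG|by move=> w _; rewrite lee_fin].
have -> : events B1 B2 C1 C2 J `\` (~` U1 `|` ~` U2) =
    \big[setU/set0]_(c <- index_enum _) E c.
  rewrite setDE setCU !setCK -bigcup_seq; apply/seteqP; split=> w.
    rewrite U1E U2E => -[evw [[k1 /= k1n u1w] [k2 /= k2n u2w]]].
    exists ((xi1 n.+2 w, Ordinal k2n), (xi2 n.+2 w, Ordinal k1n)).
      by rewrite /= mem_index_enum.
    by rewrite EE /=; do !split.
  move=> [c _]; rewrite EE => -[/= xi1w [u2w [xi2w [u1w evw]]]].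
  split=> //; rewrite U1E U2E; split.
    by exists c.2.2 => //=.
  by exists c.1.2 => //=.
rewrite ge0_integral_bigsetU//; first last.
- by move=> w _; rewrite lee_fin.
- by apply: measurable_funTS; exact: mG.
- apply/trivIsetP => -[[b1 k2] [b2 k1]] [[b1' k2'] [b2' k1']] _ _ /eqP ne.
  rewrite -subset0 !EE => w [[/= e1 [e2 [e3 [e4 _]]]] [e1' [e2' [e3' [e4' _]]]]].
  apply: ne; rewrite -e1 -e1' -e3 -e3'; move: e2 e4; rewrite e2' e4' => -[e2] [e4].
  by rewrite (val_inj e2) (val_inj e4).
- exact: index_enum_uniq.
pose Gc (c : (bool * 'I_n.+1) * (bool * 'I_n.+1)) s :=
  G (next_steps c.1.1 c.2.1 c.2.2 c.1.2 s).
have intE c : (\int[P]_(w in E c) (G (steps n.+2 w))%:E =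
    (Ex a1 a2 x1 x2 n (fun s => bern p1 c.1.1 / n.+1%:R * (bern p2 c.2.1 / n.+1%:R) * Gc c s))%:E *
    \prod_(j <- J) P (event B1 B2 C1 C2 j))%E.
  rewrite ExZ mulrC EFinM -muleA -prodE -(IH (Gc c)); first last.
  - case=> k l /= [[<- <-]|[[<- <-]|[[<- <-]|[[<- <-]|/L]]]]; rewrite /late //=.
    by case: k; lia.
  - have notin k l : ~ late n.+1 (k, l) -> ~ List.In (k, l) J by move=> h /L.
    repeat (apply: List.NoDup_cons);
      [move=> /= [//|[//|[//|]]]|move=> /= [//|[//|]]|move=> /= [//|]|rewrite /=|exact: ND];
      by apply: notin; rewrite /late /=; lia.
  - by move=> s; exact: G0.
  apply: eq_integral => w; rewrite inE EE => -[/= e1 [e2 [e3 [e4 _]]]].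
  by rewrite /Gc steps_next e1 e2 e3 e4 !subn1.
rewrite (eq_bigr _ (fun c _ => intE c)).
rewrite -ge0_sume_distrl; last first.
  move=> c _; rewrite lee_fin; apply: Ex_ge0 => // s _.
  by rewrite !mulr_ge0 ?bern_ge0 ?invr_ge0 ?G0.
rewrite sumEFin -Ex_sum; congr (_%:E * _)%E => /=.
by apply: eq_Ex_path => // s ps; rewrite -(step_average p1 p2 G ps).
Qed.

Lemma integral_steps n (G : seq (R * R) -> R) : (forall s, 0 <= G s) ->
  (\int[P]_w (G (steps n.+1 w))%:E = (Ex a1 a2 x1 x2 n G)%:E)%E.
Proof.
move=> G0; have := @integral_steps_events n G (fun=> setT) (fun=> setT) (fun=> setT)
  (fun=> setT) [::] G0 (List.NoDup_nil _) (fun j => False_ind _).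
rewrite big_nil mule1 => <-; congr (integral _ _ _).
by apply/seteqP; split => // w _ j [].
Qed.

Lemma prob_steps n (A : set (seq (R * R))) :
  P (steps n.+1 @^-1` A) = (Ex a1 a2 x1 x2 n \1_A)%:E.
Proof.
rewrite -integral_steps; last by move=> s; rewrite indicE.
rewrite -[in LHS](setIT (steps n.+1 @^-1` A)) -integral_indic//; exact: measurable_steps.
Qed.

End model.

(** * Exponential maximal inequality *)

Section maximal_inequality.
Context {R : realType}.
Implicit Types (s t : seq (R * R)) (x y rho : R).

(** This replaces Hoeffding's lemma: the linear term disappears when [y] is centered. For [y <= 1/2]
    it follows from [expR y <= (1 - y)^-1], and for larger [y] from [y <= 2 * y ^+ 2]. *)
Lemma expR_le_id_gauss y : expR y <= y + expR (2 * y ^+ 2).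
Proof.
have [y2|y2] := leP y 2^-1.
  have h0 : 0 < 1 - y by lra.
  have h1 : expR y <= (1 - y)^-1.
    by rewrite -[y in leLHS]opprK expRN lef_pV2 ?posrE ?expR_gt0// expR_ge1Dx.
  apply: (le_trans h1); apply: (@le_trans _ _ (y + (1 + 2 * y ^+ 2))).
    rewrite -[leLHS]mul1r ler_pdivrMr//.
    have : 0 <= y ^+ 2 * (1 - 2 * y) by (rewrite mulr_ge0 ?sqr_ge0// subr_ge0; lra).
    by move=> h; rewrite -subr_ge0; apply: (le_trans h); apply/eq_ler; ring.
  by rewrite lerD2l expR_ge1Dx.
apply: (@le_trans _ _ (expR (2 * y ^+ 2))); last first.
  by rewrite lerDr (le_trans _ (ltW y2)) ?invr_ge0.
rewrite ler_expR; have : 0 <= (2 * y - 1) * y by (rewrite mulr_ge0//; lra).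
lra.
Qed.

(** The product starts at [2] because the factor at [1] is zero when [rho = -1]; accordingly all
    martingales below start at the second pair of steps. *)
Definition growth (rho : R) N : R := \prod_(2 <= k < N) (1 + rho / k%:R).

(** The move from size [k] to size [k.+1] is divided by the growth at the new size, hence the
    shifted index. *)
Definition qvar (rho : R) N : R := \sum_(2 <= k < N) (growth rho k.+1) ^- 2.

Lemma growthS rho N : (2 <= N)%N -> growth rho N.+1 = growth rho N * (1 + rho / N%:R).
Proof. by move=> N2; rewrite /growth big_nat_recr. Qed.

Lemma qvarS rho N : (2 <= N)%N -> qvar rho N.+1 = qvar rho N + (growth rho N.+1) ^- 2.
Proof. by move=> N2; rewrite /qvar big_nat_recr. Qed.

Lemma growth_factor_gt0 rho N : `|rho| <= 1 -> (2 <= N)%N -> 0 < 1 + rho / N%:R.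
Proof.
rewrite ler_norml => /andP[r1 r2] N2.
have N0 : (2 : R) <= N%:R by rewrite ler_nat.
suff : -1 < rho / N%:R by lra.
rewrite ltr_pdivlMr; lra.
Qed.

Lemma growth_gt0 rho N : `|rho| <= 1 -> 0 < growth rho N.
Proof.
by move=> r1; rewrite /growth big_nat_cond; apply: prodr_gt0 => k /andP[/andP[k2 _] _]; exact: growth_factor_gt0.
Qed.

Lemma le_qvar rho m n : (m <= n)%N -> qvar rho m <= qvar rho n.
Proof.
have h k : qvar rho k <= qvar rho k.+1.
  have [k2|k2] := ltnP 1 k; first by rewrite qvarS// lerDl invr_ge0 sqr_ge0.
  by rewrite /qvar !big_geq// (leq_trans k2).
by move: m n; apply/nondecreasing_seqP.
Qed.

Variables (a1 a2 x1 x2 rho theta : R).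
Hypotheses (na1 : `|a1| <= 1) (na2 : `|a2| <= 1) (nx1 : `|x1| = 1) (nx2 : `|x2| = 1).
Hypotheses (nrho : `|rho| <= 1) (rho1 : a1 = rho * theta) (rho2 : theta * a2 = rho).
Local Notation Ex := (Ex a1 a2 x1 x2).
Local Notation stp := (step a1 a2).

Lemma Ex_supermartingale (Q : seq (R * R) -> R) m n : (m <= n)%N ->
  (forall j s, (m <= j < n)%N -> path_of j s -> stp Q s <= Q s) -> Ex n Q <= Ex m Q.
Proof.
elim: n => [|n IH]; first by rewrite leqn0 => /eqP->.
rewrite leq_eqVlt => /predU1P[->//|mn] h; apply: (@le_trans _ _ (Ex n Q)).
  by rewrite /=; apply: le_Ex => // s ps; apply: h ps; rewrite ltnSn andbT -ltnS.
by apply: IH => // j s /andP[mj jn]; apply: h; rewrite mj (leq_trans jn).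
Qed.

Lemma Ex_martingale (Q : seq (R * R) -> R) m n : (m <= n)%N ->
  (forall j s, (m <= j < n)%N -> path_of j s -> stp Q s = Q s) -> Ex n Q = Ex m Q.
Proof.
move=> mn h; apply/eqP; rewrite eq_le; apply/andP; split.
  by apply: Ex_supermartingale => // j s jn ps; rewrite (h j s jn ps).
rewrite -lerN2 -!ExN; apply: Ex_supermartingale => // j s jn ps.
by have := h j s jn ps; rewrite /step => <-; apply/eq_ler; ring.
Qed.

Definition lin s : R := sum1 s + theta * sum2 s.
(** From a list of size [N], the conditional mean of the next [lin] is [(1 + rho / N) * lin s];
    dividing by [growth] cancels exactly this factor. *)
Definition mart s : R := lin s / growth rho (size s).

Definition drift s (e1 e2 : R) : R := e1 - mean1 a1 s + theta * (e2 - mean2 a2 s).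

Lemma mart_rcons n s e1 e2 : (1 <= n)%N -> path_of n s ->
  mart (rcons s (e1, e2)) = mart s + drift s e1 e2 / growth rho n.+2.
Proof.
move=> n1 ps; have sn := path_size ps.
rewrite /mart size_rcons sn growthS// /drift /lin sum1_rcons sum2_rcons /= /mean1 /mean2 sn.
have f0 : 1 + rho / n.+1%:R != 0 by rewrite gt_eqF// growth_factor_gt0.
have g0 : growth rho n.+1 != 0 by rewrite gt_eqF// growth_gt0.
have N0 : n.+1%:R != 0 :> R by rewrite pnatr_eq0.
move: (n.+1%:R : R) N0 f0 => N N0 f0.
have f0' : N + rho != 0.
  by apply: contraNneq f0 => h; rewrite -[1](divff N0) -mulrDl h mul0r.
rewrite rho1 -rho2 in f0' f0 g0 *; field.
by rewrite N0 f0' g0.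
Qed.

(** Both centered signs [u], [v] are at most [2] in absolute value, and [(u + theta * v) ^+ 2 <= 2 *
    (u ^+ 2 + theta ^+ 2 * v ^+ 2)]. *)
Lemma drift_bound n s e1 e2 : path_of n s -> `|e1| = 1 -> `|e2| = 1 ->
  (drift s e1 e2) ^+ 2 <= 8 * (1 + theta ^+ 2).
Proof.
move=> ps h1 h2; have [m1 m2] := mean_bound na1 na2 ps.
have b1 : `|e1 - mean1 a1 s| <= 2 by (rewrite (le_trans (ler_normB _ _))// h1; lra).
have b2 : `|e2 - mean2 a2 s| <= 2 by (rewrite (le_trans (ler_normB _ _))// h2; lra).
have sq y : `|y| <= 2 -> y ^+ 2 <= 4.
  by move=> y2; rewrite -real_normK ?num_real// (_ : 4 = 2 ^+ 2 :> R) ?lerXn2r ?nnegrE//; ring.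
rewrite /drift; move: (sq _ b1) (sq _ b2).
move: (e1 - _) (e2 - _) => u v u4 v4.
have h := sqr_ge0 (u - theta * v).
have h' : theta ^+ 2 * v ^+ 2 <= theta ^+ 2 * 4 by rewrite ler_wpM2l ?sqr_ge0.
nra.
Qed.

Lemma step_drift s : stp (fun t => drift s (last (0, 0) t).1 (last (0, 0) t).2) s = 0.
Proof. by rewrite /step !last_rcons /drift /=; field. Qed.

(** Twice the bound of [drift_bound]; the factor comes from the exponent [2 * y ^+ 2] in
    [expR_le_id_gauss]. *)
Definition Kvar : R := 16 * (1 + theta ^+ 2).

Lemma Kvar_gt0 : 0 < Kvar.
Proof. by have := sqr_ge0 theta; rewrite /Kvar; lra. Qed.

Lemma step_expR_drift n s x : path_of n s ->
  stp (fun t => expR (x * drift s (last (0, 0) t).1 (last (0, 0) t).2)) s <=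
  expR (x ^+ 2 * Kvar).
Proof.
move=> ps; pose F t := x * drift s (last (0, 0) t).1 (last (0, 0) t).2 + expR (x ^+ 2 * Kvar).
apply: (@le_trans _ _ (stp F s)); last first.
  by rewrite /F stepD stepZ step_drift step_cst mulr0 add0r.
have [m1 m2] := mean_bound na1 na2 ps; move: m1 m2; rewrite !ler_norml => /andP[? ?] /andP[? ?].
have n1 : `|1 : R| = 1 by rewrite normr1.
have n1' : `|-1 : R| = 1 by rewrite normrN normr1.
have h e1 e2 : `|e1| = 1 -> `|e2| = 1 -> expR (x * drift s e1 e2) <= F (rcons s (e1, e2)).
  move=> h1 h2; rewrite /F last_rcons /=.
  apply: (le_trans (expR_le_id_gauss _)); rewrite lerD2l ler_expR /Kvar exprMn.
  have := drift_bound ps h1 h2; have := sqr_ge0 x; nra.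
by rewrite /step !last_rcons /= !lerD// ler_wpM2l ?h// mulr_ge0//; lra.
Qed.

Definition incr m k s : R := mart (take k s) - mart (take m s).

(** A list remembers its prefixes, so having crossed a level at some earlier time is a function of
    the current list, and a maximum over times needs no stopping time. *)
Definition hits (sg a : R) m s := has (fun k => a <= sg * incr m k s) (index_iota m (size s).+1).

Lemma incr_rcons m k s z : (m <= size s)%N -> (k <= size s)%N ->
  incr m k (rcons s z) = incr m k s.
Proof. by move=> ms ks; rewrite /incr -!cats1 !takel_cat. Qed.

Lemma hits_rcons sg a m s z : (m <= size s)%N ->
  hits sg a m (rcons s z) =
  hits sg a m s || (a <= sg * incr m (size s).+1 (rcons s z)).
Proof.
move=> ms; rewrite /hits size_rcons.
rewrite [index_iota m (size s).+2](_ : _ = rcons (index_iota m (size s).+1) (size s).+1); last first.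
  by rewrite /index_iota subSn ?leqW// -addn1 iotaD subnKC ?leqW// cats1.
rewrite has_rcons orbC; congr (_ || _); apply: eq_in_has => k; rewrite mem_index_iota => /andP[_ ks].
by rewrite incr_rcons.
Qed.

(** The exponential of the increment, compensated by its variance and frozen at the first crossing,
    is a supermartingale starting from [1]; Markov's inequality then bounds the probability of a
    crossing. *)
Lemma maximal_one_sided sg m n a D : sg ^+ 2 = 1 -> (2 <= m <= n.+1)%N -> 0 < a -> 0 < D ->
  qvar rho n.+1 - qvar rho m <= D ->
  Ex n (fun s => (hits sg a m s)%:R) <= expR (- (a ^+ 2 / (4 * Kvar * D))).
Proof.
move=> sg2 /andP[m2 mn] a0 D0 VD; have K0 := Kvar_gt0.
(* The minimiser of [x ^+ 2 * Kvar * D - x * a], whose minimum is the exponent of the claim. *)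
pose x := a / (2 * Kvar * D).
have x0 : 0 < x by apply: divr_gt0 => //; apply: mulr_gt0 => //; apply: mulr_gt0.
have xE : x = a / (2 * Kvar * D) by [].
clearbody x.
pose V s := x ^+ 2 * Kvar * (qvar rho (size s) - qvar rho m).
pose W := x ^+ 2 * Kvar * (qvar rho n.+1 - qvar rho m).
pose c := expR (x * a - W).
(* Optional stopping as a case split: after a crossing the value is the constant [c], a lower bound
   for the compensated exponential at any crossing because [V] stays below [W]. *)
pose Q s := if hits sg a m s then c else expR (x * sg * incr m (size s) s - V s).
have Q_ge0 s : 0 <= Q s by rewrite /Q; case: ifP => _; exact: expR_ge0.
have base : Ex m.-1 Q = 1.
  rewrite -[RHS](Ex_cst a1 a2 x1 x2 m.-1 1); apply: eq_Ex_path => // s /path_size sn.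
  have sm : size s = m by rewrite sn prednK// (leq_trans _ m2).
  rewrite /Q /hits sm /index_iota subSnn /= orbF /V sm /incr !subrr !mulr0 subrr expR0.
  by rewrite leNgt a0.
have super : Ex n Q <= 1.
  rewrite -base; apply: Ex_supermartingale; first by rewrite -ltnS prednK// (leq_trans _ m2).
  move=> j s /andP[mj jn] ps; have sn := path_size ps.
  have ms : (m <= size s)%N by rewrite sn -[m]prednK ?ltnS// (leq_trans _ m2).
  have j1 : (1 <= j)%N by move: ms; rewrite sn => /(leq_trans m2); rewrite ltnS.
  have [hs|hs] := boolP (hits sg a m s).
    by rewrite /step /Q !hits_rcons// hs /=; apply/eq_ler; field.
  pose E := expR (x * sg * incr m (size s) s - V s).
  pose y := x * sg / growth rho j.+2.
  pose F t := E * expR (- (x ^+ 2 * Kvar * (growth rho j.+2) ^- 2)) * expR (y * drift s (last (0, 0) t).1 (last (0, 0) t).2).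
  have QE : Q s = E by rewrite /Q (negbTE hs).
  apply: (@le_trans _ _ (stp F s)); last first.
    rewrite stepZ QE -mulrA ler_piMr ?expR_ge0//.
    rewrite -(expRxMexpNx_1 (x ^+ 2 * Kvar * growth rho j.+2 ^- 2)) [leLHS]mulrC ler_wpM2r ?expR_ge0//.
    apply: (le_trans (step_expR_drift y ps)); rewrite ler_expR /y.
    by rewrite !exprMn sg2 mulr1 exprVn mulrAC.
  have h e1 e2 : `|e1| = 1 -> `|e2| = 1 -> Q (rcons s (e1, e2)) <= F (rcons s (e1, e2)).
    move=> h1 h2; rewrite /F last_rcons /= -!expRD /Q.
    have E1 : x * sg * incr m (size s).+1 (rcons s (e1, e2)) =
        x * sg * incr m (size s) s + y * drift s e1 e2.
      rewrite /incr -cats1 (takel_cat _ ms) cats1 take_size -(size_rcons s (e1, e2)) take_size.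
      by rewrite (mart_rcons _ _ j1 ps) /y; ring.
    have E2 : V (rcons s (e1, e2)) = V s + x ^+ 2 * Kvar * growth rho j.+2 ^- 2.
      by rewrite /V size_rcons sn qvarS//; ring.
    have E3 : x * sg * incr m (size s) s - V s - x ^+ 2 * Kvar * growth rho j.+2 ^- 2 + y * drift s e1 e2 =
        x * sg * incr m (size (rcons s (e1, e2))) (rcons s (e1, e2)) - V (rcons s (e1, e2)).
      by rewrite size_rcons E1 E2; ring.
    rewrite E3 hits_rcons// (negbTE hs) /=; case: ifP => // ha.
    rewrite ler_expR size_rcons lerB//.
      by rewrite -mulrA ler_wpM2l// ltW.
    apply: ler_wpM2l; first by rewrite mulr_ge0 ?sqr_ge0 ?(ltW K0).
    by rewrite lerD2r le_qvar// size_rcons sn.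
  have [m1 m2'] := mean_bound na1 na2 ps; move: m1 m2'; rewrite !ler_norml => /andP[? ?] /andP[? ?].
  have n1 : `|1 : R| = 1 by rewrite normr1.
  have n1' : `|-1 : R| = 1 by rewrite normrN normr1.
  by rewrite /step !lerD// ler_wpM2l ?h// mulr_ge0//; lra.
have c1 : Ex n (fun s => (hits sg a m s)%:R) <= c^-1.
  rewrite -[leRHS]mul1r ler_pdivlMr ?expR_gt0// mulrC -ExZ.
  apply: le_trans super; apply: le_Ex => // s _; rewrite /Q; case: ifP => _; rewrite ?mulr1// mulr0.
  exact: expR_ge0.
apply: (le_trans c1); rewrite /c -expRN ler_expR opprB.
have hW : W <= x ^+ 2 * Kvar * D by rewrite /W ler_wpM2l// mulr_ge0 ?sqr_ge0// ltW.
apply: (@le_trans _ _ (x ^+ 2 * Kvar * D - x * a)); first by rewrite lerB.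
by apply/eq_ler; rewrite xE; field; rewrite !gt_eqF.
Qed.

Definition hits_abs a m s := has (fun k => a <= `|incr m k s|) (index_iota m (size s).+1).

Theorem maximal_inequality m n a D : (2 <= m <= n.+1)%N -> 0 < a -> 0 < D ->
  qvar rho n.+1 - qvar rho m <= D ->
  Ex n (fun s => (hits_abs a m s)%:R) <= 2 * expR (- (a ^+ 2 / (4 * Kvar * D))).
Proof.
move=> mn a0 D0 VD.
apply: (@le_trans _ _ (Ex n (fun s => (hits 1 a m s)%:R + (hits (-1) a m s)%:R))).
  apply: le_Ex => // s _.
  suff : hits_abs a m s ==> hits 1 a m s || hits (-1) a m s.
    by do 3 case: hits => //=; case: hits_abs => //=; rewrite ?addr0 ?add0r // -?natrD ler_nat.
  apply/implyP => /hasP[k km]; rewrite ler_normr => /orP[] h; apply/orP; [left|right];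
    apply/hasP; exists k => //; by rewrite ?mul1r ?mulN1r.
rewrite ExD mulrDl mul1r lerD//; apply: maximal_one_sided => //; by rewrite ?sqrrN expr1n.
Qed.

End maximal_inequality.

(** * Asymptotics of the growth factors *)

Section asymptotics.
Context {R : realType}.
Implicit Types (A B c eta : nat -> R) (rho l e x y : R).

(** The Stolz-Cesaro theorem, with the ratio of increments given as a factor [c n] so that no
    increment of [B] has to be inverted. *)
Lemma stolz_cesaro A B c l N0 :
  (forall n, (N0 <= n)%N -> B n <= B n.+1) -> B n @[n --> \oo] --> +oo ->
  (forall n, (N0 <= n)%N -> A n.+1 - A n = c n * (B n.+1 - B n)) ->
  c n @[n --> \oo] --> l -> A n / B n @[n --> \oo] --> l.
Proof.
move=> ndB Boo dA cl; apply/cvgrPdist_le => e e0.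
have e2 : 0 < e / 2 by rewrite divr_gt0.
have /cvgrPdist_le/(_ _ e2)[M1 _ hM1] := cl.
have /cvgryPge/(_ 1)[M2 _ hM2] := Boo.
pose M := maxn N0 (maxn M1 M2).
have MN0 : (N0 <= M)%N by rewrite leq_maxl.
have MM1 : (M1 <= M)%N by rewrite leq_max leq_maxl orbT.
have MM2 : (M2 <= M)%N by rewrite leq_max (leq_maxr M1) orbT.
have BM : 1 <= B M by exact: hM2.
have key n : (M <= n)%N ->
    `|A n - A M - l * (B n - B M)| <= e / 2 * (B n - B M) /\ B M <= B n.
  elim: n => [|n IH]; first by rewrite leqn0 => /eqP <-; rewrite !subrr mulr0 subr0 normr0 mulr0.
  rewrite leq_eqVlt => /predU1P[<-|]; first by rewrite !subrr mulr0 subr0 normr0 mulr0.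
  rewrite ltnS => Mn; have [IH1 IH2] := IH Mn.
  have hB := ndB n (leq_trans MN0 Mn); split; last exact: le_trans hB.
  have -> : A n.+1 - A M - l * (B n.+1 - B M) =
      (A n - A M - l * (B n - B M)) + (c n - l) * (B n.+1 - B n).
    have := dA n (leq_trans MN0 Mn) => h.
    by rewrite (_ : A n.+1 = A n + c n * (B n.+1 - B n)); [ring|rewrite -h; ring].
  apply: (le_trans (ler_normD _ _)).
  have -> : e / 2 * (B n.+1 - B M) = e / 2 * (B n - B M) + e / 2 * (B n.+1 - B n) by ring.
  rewrite lerD// normrM (ger0_norm (_ : 0 <= B n.+1 - B n)) ?subr_ge0//.
  by rewrite ler_wpM2r ?subr_ge0// distrC hM1//= (leq_trans MM1).
pose D := `|A M - l * B M|.
have /cvgryPge/(_ (2 * D / e + 1))[M3 _ hM3] := Boo.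
exists (maxn M M3) => // n /=; rewrite geq_max => /andP[Mn M3n].
have [k1 k2] := key n Mn.
have Bn : 0 < B n by rewrite (lt_le_trans _ k2)// (lt_le_trans _ BM).
have -> : l - A n / B n = - ((A n - A M - l * (B n - B M)) + (A M - l * B M)) / B n.
  by field; rewrite gt_eqF.
rewrite normrM normfV (gtr0_norm Bn) ler_pdivrMr// normrN.
apply: (le_trans (ler_normD _ _)); apply: (le_trans (lerD k1 (lexx _))).
have h3 : 2 * D / e <= B n by rewrite (le_trans _ (hM3 _ M3n))// lerDl.
have h4 : D <= e / 2 * B n.
  rewrite mulrC -ler_pdivrMr// (le_trans _ h3)//; apply/eq_ler; field; rewrite gt_eqF//.
rewrite -/D; have : 0 <= e / 2 * B M by rewrite mulr_ge0 ?(ltW e2)// (le_trans _ BM).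
lra.
Qed.

Lemma ln1D_bounds y : - 2^-1 <= y -> y - 2 * y ^+ 2 <= ln (1 + y) <= y.
Proof.
move=> y2; have y1 : 0 < 1 + y by lra.
apply/andP; split; last by apply: le_ln1Dx; lra.
have h : ln (1 + y)^-1 <= - y / (1 + y).
  rewrite [X in ln X](_ : _ = 1 + (- y / (1 + y))); last by field; rewrite gt_eqF.
  apply: le_ln1Dx; rewrite ltr_pdivlMr//; lra.
rewrite lnV ?posrE// in h; rewrite -lerN2 (le_trans h)// ler_pdivrMr//.
have : 0 <= y ^+ 2 * (1 + 2 * y) by (rewrite mulr_ge0 ?sqr_ge0//; lra).
by move=> h'; rewrite -subr_ge0 (le_trans h')//; apply/eq_ler; ring.
Qed.

(** The first-order terms [rho / N] of the two logarithms cancel, and [ln1D_bounds] controls each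
    second-order remainder by [2 / N ^+ 2]. *)
Lemma ln_growth rho N : `|rho| <= 1 -> (2 <= N)%N ->
  `|(ln (growth rho N.+1) - rho * ln N.+1%:R) - (ln (growth rho N) - rho * ln N%:R)|
    <= 4 / (N%:R * N%:R).
Proof.
move=> r1 N2; have N2' : (2 : R) <= N%:R by rewrite ler_nat.
have N0 : (0 : R) < N%:R by lra.
have f0 := growth_factor_gt0 r1 N2.
rewrite growthS// lnM ?posrE ?growth_gt0//.
have -> : N.+1%:R = N%:R * (1 + N%:R^-1) :> R.
  by rewrite mulrDr mulr1 mulfV ?gt_eqF// natr1.
have i0 : (0 : R) < N%:R^-1 by rewrite invr_gt0.
have i2 : (N%:R^-1 : R) <= 2^-1 by rewrite lef_pV2 ?posrE.
rewrite lnM; [|by rewrite posrE|by rewrite posrE addr_gt0].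
have [rl ru] : -1 <= rho /\ rho <= 1 by apply/andP; rewrite -ler_norml.
have /andP[h1 h2] := @ln1D_bounds N%:R^-1 ltac:(lra).
have /andP[h3 h4] : rho / N%:R - 2 * (rho / N%:R) ^+ 2 <= ln (1 + rho / N%:R) <= rho / N%:R.
  apply: ln1D_bounds; nra.
have -> : 4 / (N%:R * N%:R) = 4 * N%:R^-1 ^+ 2 :> R by field; rewrite gt_eqF.
move: (N%:R^-1 : R) i0 i2 h1 h2 h3 h4 => i i0 i2 h1 h2 h3 h4.
have -> : ln (growth rho N) + ln (1 + rho * i) - rho * (ln N%:R + ln (1 + i)) -
    (ln (growth rho N) - rho * ln N%:R) = (ln (1 + rho * i) - rho * i) - rho * (ln (1 + i) - i) by ring.
apply: (le_trans (ler_normB _ _)).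
have k1 : `|ln (1 + rho * i) - rho * i| <= 2 * i ^+ 2.
  rewrite ler_norml; apply/andP; split; last by have := sqr_ge0 i; lra.
  have : (rho * i) ^+ 2 <= i ^+ 2 by rewrite exprMn ler_piMl ?sqr_ge0//; nra.
  lra.
have k2 : `|ln (1 + i) - i| <= 2 * i ^+ 2.
  by rewrite ler_norml; apply/andP; split; have := sqr_ge0 i; lra.
have k3 : `|rho * (ln (1 + i) - i)| <= 2 * i ^+ 2.
  by rewrite normrM (le_trans _ k2)// ler_piMl.
lra.
Qed.

(** With [b] the logarithm of the ratio, the increments of [b] are bounded by the telescoping
    [4 / N.+1%:R - 4 / N.+2%:R]. Adding [4 / N.+1%:R] to [b] makes it nonincreasing and subtracting
    it makes it nondecreasing, so [b] converges. *)
Lemma growth_cvg rho : `|rho| <= 1 ->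
  exists2 kappa : R, 0 < kappa & growth rho N / N%:R `^ rho @[N --> \oo] --> kappa.
Proof.
move=> r1.
pose b N := ln (growth rho N.+2) - rho * ln N.+2%:R.
have db N : `|b N.+1 - b N| <= 4 / N.+1%:R - 4 / N.+2%:R.
  apply: (le_trans (ln_growth r1 _)) => //.
  have -> : 4 / N.+1%:R - 4 / N.+2%:R = 4 / (N.+1%:R * N.+2%:R) :> R.
    rewrite -[N.+2%:R](natr1 N.+1).
    have n0 : N.+1%:R != 0 :> R by rewrite pnatr_eq0.
    have n1 : N.+1%:R + 1 != 0 :> R by rewrite natr1 pnatr_eq0.
    by move: (N.+1%:R : R) n0 n1 => x x0 x1; field; rewrite x0 x1.
  by rewrite ler_pM2l// lef_pV2 ?posrE ?mulr_gt0 ?ltr0n// ler_pM2r ?ltr0n// ler_nat.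
pose dn N := b N + 4 / N.+1%:R.
have dn_ni : nonincreasing_seq dn.
  apply/nonincreasing_seqP => N; have := db N; rewrite /dn ler_norml => /andP[_] h.
  move: h; set i := _ / N.+1%:R; set j := 4 / _; lra.
have en_nd : nondecreasing_seq (fun N => b N - 4 / N.+1%:R).
  apply/nondecreasing_seqP => N; have := db N; rewrite /dn ler_norml => /andP[] h _.
  move: h; set i := _ / N.+1%:R; set j := 4 / _; lra.
have lb : has_lbound (range dn).
  exists (b 0%N - 4 / 1%:R) => _ [N _ <-]; apply: (le_trans (en_nd 0%N N (leq0n _))).
  by rewrite /dn lerD2l; apply: (@le_trans _ _ 0); rewrite ?oppr_le0 divr_ge0.
have cd := nonincreasing_cvgn dn_ni lb.
have c4 : (4 / N.+1%:R : R) @[N --> \oo] --> (0 : R).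
  rewrite -(mulr0 4); apply: cvgM; first exact: cvg_cst.
  exact: cvg_harmonic.
have cb : b N @[N --> \oo] --> inf (range dn).
  have -> : b = (fun N => dn N - 4 / N.+1%:R) by apply/funext => N; rewrite /dn addrK.
  rewrite -[X in _ --> X]subr0; exact: cvgB.
exists (expR (inf (range dn))); first exact: expR_gt0.
rewrite -(cvg_shiftn 2) /=.
have -> : (fun N => growth rho (N + 2) / (N + 2)%:R `^ rho) = expR \o b.
  apply/funext => N; rewrite /b /= addn2 expRB lnK ?posrE ?growth_gt0//.
  by rewrite /powR pnatr_eq0.
by apply: cvg_comp cb _; exact: continuous_expR.
Qed.

End asymptotics.

(** * Asymptotics of weighted sums of squared growth ratios *)

Section weighted_sums.
Context {R : realType}.
Implicit Types (eta : nat -> R) (rho a e x y : R).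

Lemma cvgn_bounded (u : nat -> R) (l : R) : u n @[n --> \oo] --> l ->
  exists2 C : R, 0 < C & forall n, `|u n| <= C.
Proof.
move=> ul; have /cvg_seq_bounded/pinfty_ex_gt0[M M_gt0 /= uM] : cvgn u by apply/cvg_ex; exists l.
by exists M => // n; exact: uM.
Qed.

Lemma cvgny_pMl (c : R) (u : nat -> R) : 0 < c ->
  u n @[n --> \oo] --> +oo -> c * u n @[n --> \oo] --> +oo.
Proof.
move=> c0 /cvgryPge h; apply/cvgryPge => A; apply: filterS (h (A / c)) => n.
by rewrite ler_pdivrMr// mulrC.
Qed.

Lemma powRn_cvgy a : 0 < a -> (n%:R : R) `^ a @[n --> \oo] --> +oo.
Proof.
move=> a0; apply/cvgryPge => M.
pose K := Num.max M 1 `^ a^-1.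
have M0 : 0 <= Num.max M 1 by rewrite le_max ler01 orbT.
near=> n; have Kn : K <= n%:R by near: n; exact: nbhs_infty_ger.
apply: (@le_trans _ _ (K `^ a)).
  by rewrite /K -powRrM mulVf ?gt_eqF// powRr1// le_max lexx.
by rewrite ge0_ler_powR ?nnegrE// ?ltW// powR_gt0// lt_max ltr01 orbT.
Unshelve. all: by end_near. Qed.

Lemma powRn_cvg0 a : 0 < a -> (n%:R : R) `^ (- a) @[n --> \oo] --> 0.
Proof.
move=> a0; have := powRn_cvgy a0 => h.
under eq_fun do rewrite powRN.
by apply/gtr0_cvgV0 => //; near=> n; rewrite powR_gt0// ltr0n; near: n; exists 1%N.
Unshelve. all: by end_near. Qed.

Lemma lnn_cvgy : ln (n%:R : R) @[n --> \oo] --> +oo.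
Proof.
apply/cvgryPge => M; near=> n.
have Mn : expR M <= n%:R by near: n; exact: nbhs_infty_ger.
by rewrite -(expRK M) ler_ln// posrE ?expR_gt0// (lt_le_trans _ Mn)// expR_gt0.
Unshelve. all: by end_near. Qed.

Lemma ln_le_powR a x : 0 < a -> 0 < x -> ln x <= a^-1 * x `^ a.
Proof.
move=> a0 x0; rewrite -(ler_pM2l a0) mulrA mulfV ?gt_eqF// mul1r -ln_powR.
by apply/ltW/ln_sublinear; rewrite powR_gt0.
Qed.

Lemma ln_powR_cvg0 a : 0 < a -> ln (n%:R : R) / n%:R `^ a @[n --> \oo] --> 0.
Proof.
move=> a0; have a2 : 0 < a / 2 by rewrite divr_gt0.
apply: (@squeeze_cvgr _ _ _ _ (fun=> 0) (fun n => (a / 2)^-1 * n%:R `^ (- (a / 2)))); first last.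
- by rewrite -[X in _ --> X](mulr0 (a / 2)^-1); apply: cvgMr; exact: powRn_cvg0.
- exact: cvg_cst.
near=> n; have n1 : (1 : R) <= n%:R by rewrite ler1n; near: n; exists 1%N.
have n0 : (0 : R) < n%:R by rewrite (lt_le_trans ltr01).
rewrite divr_ge0 ?ln_ge0 ?powR_ge0//= ler_pdivrMr ?powR_gt0// -mulrA -powRD; last by rewrite (gt_eqF n0) implybT.
by rewrite (_ : - (a / 2) + a = a / 2); [exact: ln_le_powR|field].
Unshelve. all: by end_near. Qed.

Lemma growth_bounds rho : `|rho| <= 1 -> exists c C : R, [/\ 0 < c, 0 < C &
  forall N, (1 <= N)%N -> c * N%:R `^ rho <= growth rho N <= C * N%:R `^ rho].
Proof.
move=> r1; have [k k0 hk] := growth_cvg r1.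
have hk' : N%:R `^ rho / growth rho N @[N --> \oo] --> k^-1.
  by under eq_fun do rewrite -invf_div; apply: cvgV => //; rewrite gt_eqF.
have [C C0 hC] := cvgn_bounded hk; have [D D0 hD] := cvgn_bounded hk'.
exists D^-1, C; split; rewrite ?invr_gt0// => N N1.
have g0 := growth_gt0 N r1.
have p0 : 0 < (N%:R : R) `^ rho by rewrite powR_gt0// ltr0n.
rewrite -[X in X && _]ler_pdivlMl ?invr_gt0// invrK -[X in _ && X]ler_pdivrMr//.
by rewrite -ler_pdivrMr// (le_trans (ler_norm _) (hC N)) (le_trans (ler_norm _) (hD N)).
Qed.

(** The noise of step [k] reaches time [N] multiplied by a growth ratio. These are the sums of
    products of such ratios: variances when [rho = rho'], and the covariance of the two martingales
    when the signs are opposite. *)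
Definition wsum rho rho' eta N :=
  \sum_(2 <= k < N) eta k * (growth rho N / growth rho k.+1 * (growth rho' N / growth rho' k.+1)).

Section fixed.
Variables (rho rho' : R).
Hypotheses (nrho : `|rho| <= 1) (nrho' : `|rho'| <= 1).

Let q N := growth rho N * growth rho' N.
Let q_gt0 N : 0 < q N. Proof. by rewrite mulr_gt0// growth_gt0. Qed.

Let q_neq0 N : q N != 0. Proof. by rewrite gt_eqF. Qed.

(** This exact recursion computes the increments of the comparison sequences [N / q N] and
    [N * ln N / q N] used with Stolz-Cesaro. *)
Let qS N : (2 <= N)%N ->
  N%:R * q N.+1 = (N%:R + (rho + rho') + rho * rho' / N%:R) * q N.
Proof.
move=> N2; rewrite /q !growthS//.
have n0 : N%:R != 0 :> R by rewrite pnatr_eq0 -lt0n ltnW.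
by move: (N%:R : R) n0 => x x0; field.
Qed.

Let wsumE eta N : wsum rho rho' eta N = q N * \sum_(2 <= k < N) eta k / q k.+1.
Proof.
rewrite /wsum mulr_sumr; apply: eq_bigr => k _.
rewrite /q; field; by rewrite !gt_eqF ?growth_gt0.
Qed.

Let partialS eta N : (2 <= N)%N ->
  \sum_(2 <= k < N.+1) eta k / q k.+1 - \sum_(2 <= k < N) eta k / q k.+1 = eta N / q N.+1.
Proof. by move=> N2; rewrite big_nat_recr//= addrAC subrr add0r. Qed.

Let natdiv_growth_ge : exists2 c : R, 0 < c &
  forall N, (1 <= N)%N -> c * N%:R `^ (1 - (rho + rho')) <= N%:R / q N.
Proof.
have [c [C [c0 C0 h]]] := growth_bounds nrho.
have [c' [C' [c0' C0' h']]] := growth_bounds nrho'.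
exists (C * C')^-1; first by rewrite invr_gt0 mulr_gt0.
move=> N N1; have N0 : (0 : R) < N%:R by rewrite ltr0n.
have /andP[_ h1] := h N N1; have /andP[_ h2] := h' N N1.
rewrite ler_pdivlMr ?q_gt0//.
apply: (@le_trans _ _ ((C * C')^-1 * N%:R `^ (1 - (rho + rho')) * ((C * N%:R `^ rho) * (C' * N%:R `^ rho')))).
  apply: ler_wpM2l; first by rewrite mulr_ge0 ?powR_ge0// invr_ge0 mulr_ge0// ltW.
  by rewrite /q ler_pM// ltW// growth_gt0.
have -> : (C * C')^-1 * N%:R `^ (1 - (rho + rho')) * (C * N%:R `^ rho * (C' * N%:R `^ rho')) =
   N%:R `^ (1 - (rho + rho')) * (N%:R `^ rho * N%:R `^ rho').
  by field; rewrite !gt_eqF.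
by rewrite -!powRD ?(gt_eqF N0) ?implybT// subrK powRr1// ltW.
Qed.

(** Divided by [N], the sum is [A N / B N], where [A] has increments [eta N / q N.+1] and [B] has
    increments [D N / q N.+1] with [D] tending to [1 - (rho + rho')]. Stolz-Cesaro gives the limit
    of [eta / D]. *)
Lemma wsum_sub eta e : rho + rho' < 1 -> eta n @[n --> \oo] --> e ->
  wsum rho rho' eta N / N%:R @[N --> \oo] --> e / (1 - (rho + rho')).
Proof.
move=> s1 he.
pose A N := \sum_(2 <= k < N) eta k / q k.+1.
pose B N := N%:R / q N.
pose D N := 1 - (rho + rho') - rho * rho' / N%:R.
have cD : D N @[N --> \oo] --> 1 - (rho + rho').
  rewrite -[X in _ --> X]subr0; apply: cvgB; first exact: cvg_cst.
  rewrite -(mulr0 (rho * rho')); apply: cvgMr.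
  apply/gtr0_cvgV0; last exact: cvgr_idn.
  by near=> n; rewrite ltr0n; near: n; exists 1%N.
have D0 : \forall N \near \oo, 0 < D N.
  by apply: (cvgr_gt _ cD); lra.
case: D0 => N0 _ D0.
have dB N : (maxn N0 2 <= N)%N -> B N.+1 - B N = D N / q N.+1.
  rewrite geq_max => /andP[_ N2].
  have n0 : N%:R != 0 :> R by rewrite pnatr_eq0 -lt0n ltnW.
  rewrite /B -[in RHS](mulKf n0 (D N)) /D.
  have -> : N%:R / q N = (N%:R + (rho + rho') + rho * rho' / N%:R) / q N.+1.
    apply/eqP; rewrite eqr_div ?q_neq0//.
    by rewrite qS.
  rewrite -natr1 -mulrBl; congr (_ / _).
  by move: (N%:R : R) n0 => x x0; field.
rewrite (_ : (fun N => wsum rho rho' eta N / N%:R) = (fun N => A N / B N)); last first.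
  by apply/funext => N; rewrite wsumE /A /B invf_div mulrAC mulrC mulrA.
apply: (@stolz_cesaro _ A B (fun N => eta N / D N) _ (maxn N0 2)).
- move=> N hN; rewrite -subr_ge0 dB// divr_ge0 ?(ltW (q_gt0 _))// ltW// D0//=.
  by rewrite (leq_trans _ hN)// leq_maxl.
- have [c c0 hc] := natdiv_growth_ge.
  apply: (@ger_cvgy _ _ _ _ (fun n : nat => c * n%:R `^ (1 - (rho + rho')))); last first.
    apply: (cvgny_pMl c0); apply: powRn_cvgy; lra.
  by near=> N; apply: hc; near: N; exists 1%N.
- move=> N hN; rewrite dB// /A partialS; last by rewrite (leq_trans _ hN)// leq_maxr.
  by rewrite mulrA divfK// gt_eqF// D0//= (leq_trans _ hN)// leq_maxl.
- by apply: cvgM => //; apply: cvgV => //; lra.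
Unshelve. all: by end_near. Qed.

(** At [rho + rho' = 1] the previous denominator degenerates, and [N * ln N / q N] takes over. The
    factor [D] tends to [1] because [N.+1 * (ln N.+1 - ln N)] lies between [1] and [1 + 1 / N]. *)
Lemma wsum_crit eta e : rho + rho' = 1 -> eta n @[n --> \oo] --> e ->
  wsum rho rho' eta N / (N%:R * ln N%:R) @[N --> \oo] --> e.
Proof.
move=> s1 he.
pose A N := \sum_(2 <= k < N) eta k / q k.+1.
pose B N := N%:R * ln N%:R / q N.
pose D N := N.+1%:R * (ln N.+1%:R - ln N%:R) - rho * rho' * (ln N%:R / N%:R `^ 1).
have cD : D N @[N --> \oo] --> (1 : R).
  rewrite -[X in _ --> X]subr0; apply: cvgB; last first.
    by rewrite -(mulr0 (rho * rho')); apply: cvgMr; exact: ln_powR_cvg0.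
  apply: (@squeeze_cvgr _ _ _ _ (fun=> 1) (fun n => 1 + (n%:R)^-1)); first last.
  - rewrite -[X in _ --> X]addr0; apply: cvgD; first exact: cvg_cst.
    apply/gtr0_cvgV0; last exact: cvgr_idn.
    by near=> n; rewrite ltr0n; near: n; exists 1%N.
  - exact: cvg_cst.
  near=> N; have N1 : (1 <= N)%N by near: N; exists 1%N.
  have N0 : (0 : R) < N%:R by rewrite ltr0n.
  have N0' : (0 : R) < N.+1%:R by rewrite ltr0n.
  have E : ln N.+1%:R - ln N%:R = ln (1 + N%:R^-1) :> R.
    rewrite -ln_div ?posrE// -natr1 mulrDl mulfV ?gt_eqF// mul1r//.
  have E' : ln N.+1%:R - ln N%:R = - ln (1 + - (N.+1%:R)^-1) :> R.
    rewrite -[LHS]opprK opprB -ln_div ?posrE// -[in N%:R](addrK 1 N%:R) natr1 mulrBl mulfV ?gt_eqF// mul1r//.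
  apply/andP; split.
    rewrite E' -ler_pdivrMl// mulr1 lerNr; apply: le_ln1Dx.
    by rewrite ltrN2 invf_lt1// ltr1n.
  rewrite E -ler_pdivlMl//.
  have -> : N.+1%:R^-1 * (1 + N%:R^-1) = N%:R^-1 :> R.
    rewrite -natr1; field; by rewrite natr1 !gt_eqF.
  by apply: le_ln1Dx; rewrite (lt_le_trans (ltrN10 _))// invr_ge0 ltW.
have D0 : \forall N \near \oo, 0 < D N.
  by apply: (cvgr_gt _ cD); lra.
case: D0 => N0 _ D0.
have dB N : (maxn N0 2 <= N)%N -> B N.+1 - B N = D N / q N.+1.
  rewrite geq_max => /andP[_ N2].
  have n0 : N%:R != 0 :> R by rewrite pnatr_eq0 -lt0n ltnW.
  rewrite /B /D powRr1//.
  have -> : N%:R * ln N%:R / q N = (N%:R + (rho + rho') + rho * rho' / N%:R) * ln N%:R / q N.+1.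
    by apply/eqP; rewrite eqr_div ?q_neq0// [X in X == _]mulrAC qS//; apply/eqP; ring.
  rewrite -mulrBl; congr (_ / _); rewrite s1 -natr1.
  move: (ln _) (ln _) => l1 l2.
  by move: (N%:R : R) n0 => x x0; field.
rewrite (_ : (fun N => wsum rho rho' eta N / (N%:R * ln N%:R)) = (fun N => A N / B N)); last first.
  by apply/funext => N; rewrite wsumE /A /B invf_div mulrAC mulrC mulrA.
apply: (@stolz_cesaro _ A B (fun N => eta N / D N) _ (maxn N0 2)).
- move=> N hN; rewrite -subr_ge0 dB// divr_ge0 ?(ltW (q_gt0 _))// ltW// D0//=.
  by rewrite (leq_trans _ hN)// leq_maxl.
- have [c c0 hc] := natdiv_growth_ge.
  apply: (@ger_cvgy _ _ _ _ (fun n : nat => c * ln n%:R)); last first.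
    by apply: (cvgny_pMl c0); exact: lnn_cvgy.
  near=> N; have N1 : (1 <= N)%N by near: N; exists 1%N.
  have := hc N N1; rewrite s1 subrr powRr0 mulr1 => h.
  by rewrite /B mulrAC ler_wpM2r// ln_ge0// ler1n.
- move=> N hN; rewrite dB// /A partialS; last by rewrite (leq_trans _ hN)// leq_maxr.
  by rewrite mulrA divfK// gt_eqF// D0//= (leq_trans _ hN)// leq_maxl.
- by rewrite -[X in _ --> X]divr1; apply: cvgM => //; apply: cvgV => //; lra.
Unshelve. all: by end_near. Qed.

End fixed.
End weighted_sums.

(** * Size of the quadratic variation in the three regimes *)

Section qvar_bounds.
Context {R : realType}.
Variable rho : R.
Hypothesis nrho : `|rho| <= 1.

Let wsum1 N : wsum rho rho (fun=> 1) N = growth rho N ^+ 2 * qvar rho N.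
Proof.
rewrite /wsum /qvar mulr_sumr; apply: eq_bigr => k _.
by field; rewrite gt_eqF// growth_gt0.
Qed.

Lemma qvar_subcritical : rho < 2^-1 -> exists2 C : R, 0 < C &
  forall N, (1 <= N)%N -> growth rho N ^+ 2 * qvar rho N <= C * N%:R.
Proof.
move=> r2; have /cvgn_bounded[C C0 hC] :
    wsum rho rho (fun=> 1) N / N%:R @[N --> \oo] --> 1 / (1 - (rho + rho)).
  by apply: wsum_sub => //; [lra|exact: cvg_cst].
exists C => // N N1; rewrite -wsum1 -ler_pdivrMr ?ltr0n//.
exact: le_trans (ler_norm _) (hC N).
Qed.

Lemma qvar_critical : rho = 2^-1 -> exists2 C : R, 0 < C &
  forall N, (2 <= N)%N -> growth rho N ^+ 2 * qvar rho N <= C * (N%:R * ln N%:R).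
Proof.
move=> r2; have /cvgn_bounded[C C0 hC] :
    wsum rho rho (fun=> 1) N / (N%:R * ln N%:R) @[N --> \oo] --> (1 : R).
  by apply: wsum_crit => //; [lra|exact: cvg_cst].
exists C => // N N1; rewrite -wsum1 -ler_pdivrMr.
  exact: le_trans (ler_norm _) (hC N).
by rewrite mulr_gt0 ?ltr0n ?ln_gt0// ?ltr1n// ltnW.
Qed.

(** Up to the factor [2 * rho - 1], each summand is at most the decrease of
    [B N = N / growth rho N ^+ 2]; the defect is the explicit nonnegative term with [rho ^+ 2 / N].
    Telescoping bounds the tail by [B m]. *)
Lemma qvar_supercritical : 2^-1 < rho -> exists2 C : R, 0 < C &
  forall m n, (2 <= m <= n)%N -> qvar rho n - qvar rho m <= C * m%:R `^ (1 - 2 * rho).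
Proof.
move=> r2; pose B N := N%:R / growth rho N ^+ 2.
have B0 N : 0 <= B N by rewrite divr_ge0 ?sqr_ge0.
have dB N : (2 <= N)%N -> (2 * rho - 1) * (qvar rho N.+1 - qvar rho N) <= B N - B N.+1.
  move=> N2; rewrite qvarS// addrAC subrr add0r /B growthS//.
  have N0 : (0 : R) < N%:R by rewrite ltr0n ltnW.
  have g0 := growth_gt0 N nrho; have f0 := growth_factor_gt0 nrho N2.
  rewrite -subr_ge0 -natr1.
  have -> : N%:R / growth rho N ^+ 2 - (N%:R + 1) / (growth rho N * (1 + rho / N%:R)) ^+ 2 -
      (2 * rho - 1) / (growth rho N * (1 + rho / N%:R)) ^+ 2 =
      rho ^+ 2 / N%:R / (growth rho N * (1 + rho / N%:R)) ^+ 2.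
    have f1 : N%:R + rho != 0.
      apply: contraTneq f0 => h; rewrite (_ : 1 + rho / N%:R = (N%:R + rho) / N%:R).
        by rewrite h mul0r ltxx.
      by field; rewrite gt_eqF.
    have n0 := gt_eqF N0; have n1 := gt_eqF g0.
    by move: (N%:R : R) n0 f1 => x /negbT n0 f1; field; rewrite n0 f1 n1.
  by rewrite !divr_ge0 ?sqr_ge0 // ltW.
have tel m n : (2 <= m)%N -> (m <= n)%N ->
    (2 * rho - 1) * (qvar rho n - qvar rho m) <= B m - B n.
  move=> m2; elim: n => [|n IH]; first by rewrite leqn0 => /eqP <-; rewrite !subrr mulr0.
  rewrite leq_eqVlt => /predU1P[<-|]; first by rewrite !subrr mulr0.
  rewrite ltnS => mn; have h1 := dB n (leq_trans m2 mn); have h2 := IH mn.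
  have -> : (2 * rho - 1) * (qvar rho n.+1 - qvar rho m) =
    (2 * rho - 1) * (qvar rho n.+1 - qvar rho n) + (2 * rho - 1) * (qvar rho n - qvar rho m) by ring.
  lra.
have [c [C [c0 C0 h]]] := growth_bounds nrho.
have r0 : 0 < 2 * rho - 1 by lra.
exists ((2 * rho - 1)^-1 * c ^- 2); first by rewrite mulr_gt0 ?invr_gt0// exprn_gt0.
move=> m n /andP[m2 mn]; rewrite -mulrA -ler_pdivrMl ?invr_gt0// invrK.
apply: (le_trans (tel _ _ m2 mn)); apply: (@le_trans _ _ (B m)); first by rewrite gerBl.
have /andP[h1 _] := h m (ltnW m2).
have m0 : (0 : R) < m%:R by rewrite ltr0n ltnW.
have p0 : 0 < (m%:R : R) `^ rho by rewrite powR_gt0.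
have -> : m%:R `^ (1 - 2 * rho) = m%:R / (m%:R `^ rho) ^+ 2 :> R.
  rewrite powRD ?(gt_eqF m0) ?implybT// powRr1 ?ltW// powRN; congr (_ / _).
  by rewrite mulrC powRrM powR_mulrn ?powR_ge0.
rewrite /B mulrCA; apply: ler_wpM2l; first exact: ltW.
rewrite -invfM lef_pV2 ?posrE ?mulr_gt0 ?exprn_gt0 ?growth_gt0//.
by rewrite -exprMn lerXn2r ?nnegrE ?mulr_ge0 ?(ltW c0) ?(ltW p0)// ltW// growth_gt0.
Qed.

End qvar_bounds.

(** * Almost sure bounds *)

Section almost_sure.
Context {R : realType} {d : measure_display} {T : measurableType d}.
Variables (P : probability T R) (p1 p2 : R).
Variables (xi1 xi2 : nat -> T -> bool) (u1 u2 : nat -> T -> nat) (x1 x2 : R).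
Hypothesis (model : two_elephant_model P p1 p2 xi1 xi2 u1 u2).
Hypotheses (p1_01 : 0 <= p1 <= 1) (p2_01 : 0 <= p2 <= 1).
Hypotheses (nx1 : `|x1| = 1) (nx2 : `|x2| = 1).
Variables (rho theta : R).
Local Notation a1 := (2 * p1 - 1).
Local Notation a2 := (2 * p2 - 1).
Local Notation Ex := (Ex a1 a2 x1 x2).
Local Notation steps := (steps xi1 xi2 u1 u2 x1 x2).
Hypotheses (nrho : `|rho| <= 1) (rho1 : a1 = rho * theta) (rho2 : theta * a2 = rho).

Let na1 : `|a1| <= 1.
Proof. by case/andP: p1_01 => h1 h2; rewrite ler_norml; apply/andP; split; lra. Qed.
Let na2 : `|a2| <= 1.
Proof. by case/andP: p2_01 => h1 h2; rewrite ler_norml; apply/andP; split; lra. Qed.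

Lemma size_steps n w : size (steps n w) = n.
Proof. by case: n => // n; elim: n => // n IH; rewrite steps_next size_rcons IH. Qed.

Lemma take_steps k n w : (k <= n)%N -> take k (steps n w) = steps k w.
Proof.
elim: n => [|n IH]; first by rewrite leqn0 => /eqP->.
rewrite leq_eqVlt => /predU1P[->|]; first by rewrite take_oversize// size_steps.
rewrite ltnS => kn; case: n IH kn => [|n] IH kn.
  by move: kn; rewrite leqn0 => /eqP->; rewrite take0.
by rewrite steps_next /next_steps -cats1 takel_cat ?IH// size_steps.
Qed.

Lemma path_of_steps n : {ae P, forall w, path_of n (steps n.+1 w)}.
Proof.
exists (steps n.+1 @^-1` [set s | ~~ path_of n s]); split.
- exact: measurable_steps model _ _.
- rewrite (prob_steps model)//; congr EFin.
  rewrite -[RHS](Ex_cst a1 a2 x1 x2 n 0); apply: eq_Ex_path => // s ps.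
  by rewrite indicE memNset//= ps.
- by move=> w /= /negP.
Qed.

Lemma nneseries_inv_sqr_fin : (\sum_(j <oo) (2 / j.+2%:R ^+ 2 : R)%:E < +oo)%E.
Proof.
apply: (@le_lt_trans _ _ 2%:E); last exact: ltry.
apply: lime_le.
  by apply: is_cvg_nneseries => j _ _; rewrite lee_fin divr_ge0 ?sqr_ge0.
apply: nearW => n; rewrite sumEFin lee_fin.
suff : \sum_(0 <= j < n) (2 / j.+2%:R ^+ 2 : R) <= 2 - 2 / n.+1%:R.
  by move=> h; apply: (le_trans h); rewrite gerBl divr_ge0.
elim: n => [|n IH]; first by rewrite big_geq// divr1 subrr.
rewrite big_nat_recr//=; apply: (le_trans (lerD IH (lexx _))).
have n0 : (0 : R) < n.+1%:R by rewrite ltr0n.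
rewrite -[n.+2%:R](natr1 n.+1); move: (n.+1%:R : R) n0 => x x0.
rewrite -subr_ge0.
have -> : 2 - 2 / (x + 1) - (2 - 2 / x + 2 / (x + 1) ^+ 2) = 2 / (x * (x + 1) ^+ 2).
  by field; rewrite !gt_eqF// addr_gt0.
by rewrite divr_ge0// mulr_ge0 ?sqr_ge0 ?ltW.
Qed.

Let mEx n (A : set (seq (R * R))) (b : pred (seq (R * R))) : A = [set s | b s] ->
  P (steps n.+1 @^-1` A) = (Ex n (fun s => (b s)%:R))%:E.
Proof.
move=> ->; rewrite (prob_steps model)//; congr EFin; apply: eq_Ex => s.
rewrite indicE (_ : (s \in _) = b s)//; apply/idP/idP; first by move/set_mem.
by move=> bs; apply/mem_set.
Qed.

Lemma eventually_below (nd : nat -> nat) (D : nat -> R) :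
  (forall j, (2 <= nd j)%N) -> (forall j, 0 < D j) ->
  (forall j, qvar rho (nd j) <= D j) ->
  {ae P, forall w, exists J, forall j k, (J <= j)%N -> (2 <= k <= nd j)%N ->
    `|lin theta (steps k w)| <= growth rho k *
      (2 * (1 + `|theta|) + Num.sqrt (8 * Kvar theta * D j * ln j.+2%:R))}.
Proof.
move=> nd2 D0 qD; have K0 := Kvar_gt0 theta.
(* Chosen so that [a j ^+ 2 / (4 * Kvar * D j)] equals [2 * ln j.+2]: the probability of a crossing
   is then at most [2 / j.+2 ^+ 2], which is summable. *)
pose a j := Num.sqrt (8 * Kvar theta * D j * ln j.+2%:R).
have ln0 j : 0 < ln (j.+2%:R : R) by rewrite ln_gt0// ltr1n.
have a0 j : 0 < a j by rewrite sqrtr_gt0; do 3! (apply: mulr_gt0 => //).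
pose A j := steps (nd j) @^-1` [set s | hits_abs rho theta (a j) 2 s].
have ndS j : nd j = (nd j).-1.+1 by rewrite prednK// ltnW.
have mA j : measurable (A j) by rewrite /A ndS; exact: measurable_steps model _ _.
have PA j : (P (A j) <= (2 / j.+2%:R ^+ 2)%:E)%E.
  rewrite /A ndS (mEx _ (b := hits_abs rho theta (a j) 2))// lee_fin.
  have h := @maximal_inequality _ _ _ _ _ _ _ na1 na2 nx1 nx2 nrho rho1 rho2 2 (nd j).-1 (a j) (D j).
  apply: (le_trans (h _ _ _ _)) => //; first by rewrite -ndS nd2.
    rewrite -ndS [X in _ - X](_ : _ = 0) ?subr0//.
    by rewrite /qvar big_geq.
  rewrite ler_pM2l// /a sqr_sqrtr; last by apply/ltW; do 3! (apply: mulr_gt0 => //).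
  rewrite [_ / _](_ : _ = ln j.+2%:R * 2%:R); last by field; rewrite !gt_eqF.
  by rewrite expRN expRM_natr lnK// posrE ltr0n.
have : P (lim_sup_set A) = 0%E.
  apply: lim_sup_set_cvg0 => //; apply: le_lt_trans nneseries_inv_sqr_fin.
  by apply: lee_nneseries => // j _; exact: PA.
move=> PA0.
have ae1 : {ae P, forall w, ~ lim_sup_set A w}.
  exists (lim_sup_set A); split => //.
    by apply: bigcapT_measurable => n; apply: bigcup_measurable.
  by move=> w /=; rewrite not_notE.
have ae2 := path_of_steps 1.
move: ae1 ae2; apply: filterS2 => w nA pw.
have : exists J, forall j, (J <= j)%N -> ~ A j w.
  apply: contrapT => h; apply: nA => n _; apply: contrapT => h'; apply: h.
  by exists n => j nj Aj; apply: h'; exists j.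
move=> [J hJ]; exists J => j k Jj /andP[k2 kj].
have /negP := hJ j Jj; rewrite /hits_abs size_steps => /hasPn /(_ k).
rewrite mem_index_iota k2 ltnS kj => /(_ isT); rewrite -ltNge /incr !take_steps//.
move=> hk; have g0 := growth_gt0 k nrho.
have E1 : mart rho theta (steps k w) = lin theta (steps k w) / growth rho k.
  by rewrite /mart size_steps.
have E2 : mart rho theta (steps 2 w) = lin theta (steps 2 w).
  by rewrite /mart size_steps /growth big_geq// divr1.
have -> : lin theta (steps k w) = growth rho k * mart rho theta (steps k w).
  by rewrite E1 mulrCA mulfV ?mulr1// gt_eqF.
rewrite normrM (gtr0_norm g0) ler_pM2l//.
have -> : mart rho theta (steps k w) = mart rho theta (steps 2 w) +
   (mart rho theta (steps k w) - mart rho theta (steps 2 w)) by ring.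
apply: (le_trans (ler_normD _ _)); apply: lerD; last exact: ltW.
rewrite E2 /lin; have /andP[/eqP s2 /signs_sum[b1 b2]] := pw; rewrite s2 in b1 b2.
apply: (le_trans (ler_normD _ _)); rewrite mulrDr mulr1 lerD// normrM mulrC.
by rewrite ler_wpM2r.
Qed.

End almost_sure.

(** * Deterministic envelopes for the iterated logarithm bounds *)

Section envelopes.
Context {R : realType}.
Variables (rho theta : R).
Hypothesis nrho : `|rho| <= 1.

(* [f] eventually dominates, up to the factor [C], the block bounds obtained from
   the maximal inequality on the time intervals ending at [nd j]. *)
Definition envelope (f : nat -> R) (C : R) := exists (nd : nat -> nat) (D : nat -> R),
  [/\ forall j, (2 <= nd j)%N, forall j, 0 < D j, forall j, qvar rho (nd j) <= D j &
    forall J, exists N, forall n, (N <= n)%N -> exists j, [/\ (J <= j)%N, (2 <= n <= nd j)%N &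
      growth rho n * (2 * (1 + `|theta|) + Num.sqrt (8 * Kvar theta * D j * ln j.+2%:R))
      <= C * f n]].

Lemma ln2_bounds : 2^-1 <= ln (2 : R) <= 1.
Proof.
apply/andP; split; last by have := @le_ln1Dx R 1; apply; lra.
have h : ln (1 + - 2^-1 : R) <= - 2^-1 by apply: le_ln1Dx; lra.
rewrite (_ : 1 + - 2^-1 = 2^-1 :> R) in h; last by field.
by rewrite lnV ?posrE// in h; lra.
Qed.

Lemma growth_le_sqrt : rho <= 2^-1 -> exists2 C : R, 0 < C &
  forall n, (1 <= n)%N -> growth rho n <= C * Num.sqrt n%:R.
Proof.
move=> r2; have [c [C [c0 C0 h]]] := growth_bounds nrho.
exists C => // n n1; have /andP[_ hn] := h n n1; apply: (le_trans hn).
by rewrite ler_pM2l// -powR12_sqrt// ler_powR// ler1n.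
Qed.

(** With [D j] of the form [C * X / growth ^+ 2], the growth at the end of the block is pulled out
    of the root and exchanged for the growth at [n]. *)
Let sqrt_scale (q K C X L : R) m n : 0 <= q -> growth rho n <= q * growth rho m ->
  growth rho n * Num.sqrt (K * (C * X / growth rho m ^+ 2) * L) <= q * Num.sqrt (K * C * X * L).
Proof.
move=> q0 h; have gm := growth_gt0 m nrho; have gn := growth_gt0 n nrho.
have -> : K * (C * X / growth rho m ^+ 2) * L = ((growth rho m)^-1) ^+ 2 * (K * C * X * L).
  by field; rewrite gt_eqF.
rewrite sqrtrM ?sqr_ge0// sqrtr_sqr gtr0_norm ?invr_gt0// mulrA ler_wpM2r ?sqrtr_ge0//.
by rewrite ler_pdivrMr.
Qed.

Lemma near_ln_ge (M : R) : exists N, forall n, (N <= n)%N -> M <= ln (n%:R : R).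
Proof. by have /cvgryPge/(_ M)[N _ hN] := @lnn_cvgy R; exists N => n; exact: hN. Qed.

Lemma ln_expn2 k : ln ((2 ^ k)%N%:R : R) = k%:R * ln 2.
Proof. by rewrite natrX lnXn// mulr_natl. Qed.

Lemma ler_ln_nat m n : (1 <= m)%N -> (m <= n)%N -> ln (m%:R : R) <= ln n%:R.
Proof. by move=> m1 mn; rewrite ler_ln ?ler_nat// posrE ltr0n// (leq_trans m1). Qed.

Let expR2_ge3 : 3 <= expR (2 : R).
Proof. by rewrite (le_trans _ (expR_ge1Dx _))//; lra. Qed.

Let K0 := Kvar_gt0 theta.

Let KC_ge0 (k C : R) : 0 <= k -> 0 < C -> 0 <= k * Kvar theta * C.
Proof. by move=> k0 C0; apply: mulr_ge0 (ltW C0); apply: mulr_ge0 (ltW K0). Qed.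

(** For [2 ^ j <= n < 2 ^ j.+1] both the variance and the growth change by bounded factors within a
    block, while [ln j] is of the order of [ln (ln n)]. *)
Lemma envelope_sub : rho < 2^-1 -> exists2 C : R, 0 < C & 
  envelope (fun n => Num.sqrt (n%:R * ln (ln n%:R))) C.
Proof.
move=> r2; have [C1 C10 h1] := qvar_subcritical nrho r2.
have [c [C [c0 C0 h]]] := growth_bounds nrho.
have [C2 C20 h2] := growth_le_sqrt (ltW r2).
(* The factor [2] covers negative [rho], where the growth decreases along the block but, since
   [-1 <= rho], by no more than a constant. *)
pose q := 2 * C / c; have q0 : 0 < q by rewrite divr_gt0// mulr_gt0.
pose c1 := 2 * (1 + `|theta|); have c10 : 0 <= c1 by rewrite mulr_ge0// addr_ge0.
(* The [32] is the [8] of the crossing level times [2] for [nd j <= 2 * n] and [2] for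
   [ln j.+2 <= 2 * ln (ln n)]. *)
exists (c1 * C2 + q * Num.sqrt (32 * Kvar theta * C1)).
  apply: ltr_wpDl; first by rewrite mulr_ge0// ltW.
  by rewrite mulr_gt0// sqrtr_gt0; do 2! (apply: mulr_gt0 => //).
exists (fun j => (2 ^ j.+1)%N), (fun j => C1 * (2 ^ j.+1)%N%:R / growth rho (2 ^ j.+1)%N ^+ 2).
have nd1 j : (1 <= 2 ^ j.+1)%N by rewrite expn_gt0.
split.
- by move=> j; rewrite expnS leq_pmulr// expn_gt0.
- by move=> j; rewrite divr_gt0 ?exprn_gt0 ?growth_gt0// mulr_gt0// ltr0n.
- move=> j; rewrite ler_pdivlMr ?exprn_gt0 ?growth_gt0// mulrC; exact: h1.
move=> J; have [N1 hN1] := near_ln_ge (expR 2).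
exists (maxn 2 (maxn N1 (2 ^ J))) => n; rewrite !geq_max => /andP[n2 /andP[/hN1 ln_n Jn]].
have n1 : (1 <= n)%N by exact: ltnW.
pose j := trunc_log 2 n; have jn : (2 ^ j <= n)%N by rewrite trunc_logP.
have nj : (n < 2 ^ j.+1)%N by rewrite trunc_log_ltn.
exists j; split; [by rewrite /j trunc_log_max|by rewrite n2 ltnW|].
have lnn0 : 0 < ln (n%:R : R) by rewrite (lt_le_trans _ ln_n)// expR_gt0.
have lln : 2 <= ln (ln (n%:R : R)) by rewrite -[X in X <= _]expRK ler_ln ?posrE ?expR_gt0.
have Lj : ln (j.+2%:R : R) <= 2 * ln (ln n%:R).
  have -> : 2 * ln (ln (n%:R : R)) = ln (ln n%:R ^+ 2) by rewrite lnXn// mulr_natl.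
  rewrite ler_ln ?posrE ?ltr0n ?exprn_gt0//.
  have h3 := ler_ln_nat (expn_gt0 2 j : (1 <= 2 ^ j)%N) jn; rewrite ln_expn2 in h3.
  have /andP[l2 _] := ln2_bounds.
  have j0 : 0 <= (j%:R : R) by [].
  have h4 : j%:R * 2^-1 <= ln (n%:R : R) by rewrite (le_trans _ h3)// ler_wpM2l.
  have h5 : 3 <= ln (n%:R : R) by rewrite (le_trans _ ln_n).
  rewrite -natr1 -(natr1 j); nra.
have Ln0 : 0 <= ln (j.+2%:R : R) by rewrite ln_ge0// ler1n.
have gq : growth rho n <= q * growth rho (2 ^ j.+1)%N.
  have /andP[_ g1] := h n n1; have /andP[g2 _] := h _ (nd1 j).
  apply: (le_trans g1); apply: (@le_trans _ _ (q * (c * (2 ^ j.+1)%N%:R `^ rho))); last by rewrite ler_pM2l.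
  rewrite (_ : q * (c * _) = C * (2 * (2 ^ j.+1)%N%:R `^ rho)); last by rewrite /q; field; rewrite gt_eqF.
  rewrite ler_pM2l//.
  have nd0 : (0 : R) <= (2 ^ j.+1)%N%:R by [].
  have [r0|r0] := leP 0 rho.
    apply: (@le_trans _ _ ((2 ^ j.+1)%N%:R `^ rho)); last by rewrite ler_peMl ?powR_ge0// ler1n.
    by rewrite ge0_ler_powR ?nnegrE// ler_nat ltnW.
  have hr : (2 ^ j.+1)%N%:R `^ (- rho) <= 2 * n%:R `^ (- rho) :> R.
    apply: (@le_trans _ _ ((2 * n%:R) `^ (- rho))).
      rewrite ge0_ler_powR ?nnegrE ?oppr_ge0 ?(ltW r0)// ?mulr_ge0//.
      by rewrite -natrM ler_nat expnS leq_mul2l jn orbT.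
    rewrite powRM// ler_wpM2r ?powR_ge0// -[leRHS]powRr1// ler_powR ?ler1n//.
    by move: nrho; rewrite ler_norml => /andP[]; lra.
  have np : (0 : R) < n%:R `^ rho by rewrite powR_gt0// ltr0n.
  have mp : (0 : R) < (2 ^ j.+1)%N%:R `^ rho by rewrite powR_gt0// ltr0n.
  move: hr; rewrite !powRN -ler_pdivrMr ?invr_gt0// invrK mulrC ler_pdivrMr//.
have sn0 : 0 <= (n%:R : R) by [].
rewrite -/c1 [leRHS]mulrDl [leLHS]mulrDr; apply: lerD.
  rewrite mulrC -[leRHS]mulrA ler_wpM2l//; apply: (le_trans (h2 n n1)); rewrite ler_pM2l//.
  by apply: ler_wsqrtr; rewrite ler_peMr//; lra.
apply: (le_trans (sqrt_scale _ _ _ _ (ltW q0) gq)).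
rewrite -[leRHS]mulrA ler_pM2l// -sqrtrM; last exact: KC_ge0.
apply: ler_wsqrtr.
have nd2 : (2 ^ j.+1)%N%:R <= 2 * n%:R :> R by rewrite -natrM ler_nat expnS leq_mul2l jn orbT.
rewrite (_ : 32 * Kvar theta * C1 * (n%:R * ln (ln n%:R)) =
  8 * Kvar theta * C1 * ((2 * n%:R) * (2 * ln (ln n%:R)))); last by ring.
rewrite -[leLHS]mulrA; apply: ler_wpM2l; first exact: KC_ge0.
exact: ler_pM.
Qed.

(** The normalised quadratic variation now grows like [ln N], so it takes doubly exponential times
    to double it; the number of blocks before [n] is of order [ln (ln n)], whence the third
    logarithm. *)
Lemma envelope_crit : rho = 2^-1 -> exists2 C : R, 0 < C &
  envelope (fun n => Num.sqrt (n%:R * ln n%:R * ln (ln (ln n%:R)))) C.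
Proof.
move=> r2; have [C1 C10 h1] := qvar_critical nrho r2.
have [c [C [c0 C0 h]]] := growth_bounds nrho.
have r2' : rho <= 2^-1 by rewrite r2.
have [C2 C20 h2] := growth_le_sqrt r2'.
pose q := C / c; have q0 : 0 < q by rewrite divr_gt0.
pose c1 := 2 * (1 + `|theta|); have c10 : 0 <= c1 by rewrite mulr_ge0// addr_ge0.
exists (c1 * C2 + q * Num.sqrt (32 * Kvar theta * C1)).
  apply: ltr_wpDl; first by rewrite mulr_ge0// ltW.
  by rewrite mulr_gt0// sqrtr_gt0; do 2! (apply: mulr_gt0 => //).
pose nd j := (2 ^ (2 ^ j.+1))%N.
have nd2 j : (2 <= nd j)%N by rewrite /nd -{1}(expn1 2) leq_exp2l// expn_gt0.
exists nd, (fun j => C1 * ((nd j)%:R * ln (nd j)%:R) / growth rho (nd j) ^+ 2).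
split.
- exact: nd2.
- move=> j; rewrite divr_gt0 ?exprn_gt0 ?growth_gt0// mulr_gt0// mulr_gt0 ?ltr0n ?(ltnW (nd2 j))//.
  by rewrite ln_gt0// ltr1n.
- move=> j; rewrite ler_pdivlMr ?exprn_gt0 ?growth_gt0// mulrC; exact: h1.
move=> J; have [N1 hN1] := near_ln_ge (expR (expR 2 + 1)).
exists (maxn 2 (maxn N1 (2 ^ (2 ^ J)))) => n; rewrite !geq_max => /andP[n2 /andP[/hN1 ln_n Jn]].
have n1 : (1 <= n)%N by exact: ltnW.
pose m := trunc_log 2 n; have mn : (2 ^ m <= n)%N by rewrite trunc_logP.
have nm : (n < 2 ^ m.+1)%N by rewrite trunc_log_ltn.
have Jm : (2 ^ J <= m)%N by rewrite /m trunc_log_max.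
have m1 : (1 <= m)%N by rewrite (leq_trans _ Jm)// expn_gt0.
pose j := trunc_log 2 m; have jm : (2 ^ j <= m)%N by rewrite trunc_logP.
have mj : (m < 2 ^ j.+1)%N by rewrite trunc_log_ltn.
have nj : (n <= nd j)%N by rewrite ltnW// (leq_trans nm)// /nd leq_exp2l.
have jn : (2 ^ (2 ^ j) <= n)%N by rewrite (leq_trans _ mn)// leq_exp2l.
exists j; split; [by rewrite /j trunc_log_max|by rewrite n2|].
have lnn0 : 0 < ln (n%:R : R) by rewrite (lt_le_trans _ ln_n)// expR_gt0.
have lln : expR 2 + 1 <= ln (ln (n%:R : R)) by rewrite -[X in X <= _]expRK ler_ln ?posrE ?expR_gt0.
have lln0 : 0 < ln (ln (n%:R : R)) by rewrite (lt_le_trans _ lln)// addr_gt0// expR_gt0.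
have llln : 2 <= ln (ln (ln (n%:R : R))).
  by rewrite -[X in X <= _]expRK ler_ln ?posrE ?expR_gt0// (le_trans _ lln)// lerDl.
have /andP[l2 l2'] := ln2_bounds.
have l20 : 0 < ln (2 : R) by lra.
have h3 : (2 ^ j)%N%:R * ln 2 <= ln (n%:R : R).
  by rewrite -ln_expn2 ler_ln_nat// expn_gt0.
have Lj : ln (j.+2%:R : R) <= 2 * ln (ln (ln n%:R)).
  have -> : 2 * ln (ln (ln (n%:R : R))) = ln (ln (ln n%:R) ^+ 2) by rewrite lnXn// mulr_natl.
  rewrite ler_ln ?posrE ?ltr0n ?exprn_gt0//.
  have h4 : j%:R * ln 2 + ln (ln 2) <= ln (ln (n%:R : R)).
    rewrite -ln_expn2 -lnM ?posrE ?ltr0n ?expn_gt0// ler_ln ?posrE// mulr_gt0// ltr0n expn_gt0//.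
  have h5 : - 1 <= ln (ln (2 : R)).
    apply: (@le_trans _ _ (ln (2^-1 : R))); first by rewrite lnV ?posrE// lerN2.
    by rewrite ler_ln ?posrE.
  have j0 : 0 <= (j%:R : R) by [].
  have h6 : j%:R * 2^-1 <= j%:R * ln (2 : R) by rewrite ler_wpM2l.
  have h7 : 4 <= ln (ln (n%:R : R)) by have := expR2_ge3; lra.
  rewrite -natr1 -(natr1 j); nra.
have Ln0 : 0 <= ln (j.+2%:R : R) by rewrite ln_ge0// ler1n.
(* Here [n] can be as small as the square root of [nd j], so the growth ratio cannot be bounded by a
   constant alone: the factor [sqrt (n / nd j)] is kept and cancels the [nd j] in [D j]. *)
pose q1 := q * (Num.sqrt n%:R / Num.sqrt (nd j)%:R).
have ndp : (0 : R) < (nd j)%:R by rewrite ltr0n ltnW.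
have snd : 0 < Num.sqrt ((nd j)%:R : R) by rewrite sqrtr_gt0.
have gq : growth rho n <= q1 * growth rho (nd j).
  have /andP[_ g1] := h n n1; have /andP[g2 _] := h _ (ltnW (nd2 j)).
  apply: (le_trans g1); apply: (@le_trans _ _ (q1 * (c * (nd j)%:R `^ rho))).
    rewrite r2 !powR12_sqrt// /q1 /q; apply/eq_ler; field; by rewrite !gt_eqF.
  by rewrite ler_wpM2l// /q1 !mulr_ge0 ?invr_ge0 ?sqrtr_ge0// ltW.
have q10 : 0 <= q1 by rewrite /q1 !mulr_ge0 ?invr_ge0 ?sqrtr_ge0// ltW.
have sn0 : 0 <= (n%:R : R) by [].
rewrite -/c1 [leRHS]mulrDl [leLHS]mulrDr; apply: lerD.
  rewrite mulrC -[leRHS]mulrA ler_wpM2l//; apply: (le_trans (h2 n n1)); rewrite ler_pM2l//.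
  apply: ler_wsqrtr; rewrite -mulrA ler_peMr//.
  have := expR2_ge3; have : 3 <= ln (n%:R : R).
    by rewrite (le_trans _ ln_n)// (le_trans _ (expR_ge1Dx _))//; have := expR2_ge3; lra.
  nra.
apply: (le_trans (sqrt_scale _ _ _ _ q10 gq)).
rewrite (_ : q1 * _ = q * (Num.sqrt n%:R / Num.sqrt (nd j)%:R *
  Num.sqrt (8 * Kvar theta * C1 * ((nd j)%:R * ln (nd j)%:R) * ln j.+2%:R))); last by rewrite /q1 -mulrA.
rewrite -[leRHS]mulrA ler_pM2l// -(sqrtrV (ltW ndp)) -(sqrtrM _ sn0).
rewrite -sqrtrM ?mulr_ge0 ?invr_ge0 ?(ltW ndp)// -sqrtrM; last exact: KC_ge0.
apply: ler_wsqrtr.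
have lnd : ln ((nd j)%:R : R) <= 2 * ln n%:R.
  rewrite /nd ln_expn2 expnS natrM -mulrA ler_pM2l//.
have -> : n%:R / (nd j)%:R * (8 * Kvar theta * C1 * ((nd j)%:R * ln (nd j)%:R) * ln j.+2%:R) =
  8 * Kvar theta * C1 * n%:R * (ln (nd j)%:R * ln j.+2%:R) :> R.
  by field; rewrite gt_eqF.
have -> : 32 * Kvar theta * C1 * (n%:R * ln n%:R * ln (ln (ln n%:R))) =
  8 * Kvar theta * C1 * n%:R * ((2 * ln n%:R) * (2 * ln (ln (ln n%:R)))) :> R by ring.
apply: ler_wpM2l; first by apply: mulr_ge0 => //; exact: KC_ge0.
by apply: ler_pM => //; rewrite ln_ge0// ler1n (ltnW (nd2 j)).
Qed.

(** One block per time costs [ln n] instead of [ln (ln n)]. This crude bound suffices for the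
    combination with eigenvalue [- r], which only has to be dominated in the critical and
    supercritical regimes. *)
Lemma envelope_log : rho < 2^-1 -> exists2 C : R, 0 < C &
  envelope (fun n => Num.sqrt (n%:R * ln n%:R)) C.
Proof.
move=> r2; have [C1 C10 h1] := qvar_subcritical nrho r2.
have [C2 C20 h2] := growth_le_sqrt (ltW r2).
pose c1 := 2 * (1 + `|theta|); have c10 : 0 <= c1 by rewrite mulr_ge0// addr_ge0.
exists (c1 * C2 + Num.sqrt (8 * Kvar theta * C1)).
  apply: ltr_wpDl; first by rewrite mulr_ge0// ltW.
  by rewrite sqrtr_gt0; do 2! (apply: mulr_gt0 => //).
exists (fun j => j.+2), (fun j => C1 * j.+2%:R / growth rho j.+2 ^+ 2).
split=> //.
- by move=> j; rewrite divr_gt0 ?exprn_gt0 ?growth_gt0// mulr_gt0// ltr0n.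
- move=> j; rewrite ler_pdivlMr ?exprn_gt0 ?growth_gt0// mulrC; exact: h1.
move=> J; have [N1 hN1] := near_ln_ge 1.
exists (maxn N1 J.+2) => n; rewrite geq_max => /andP[/hN1 ln_n Jn].
have n1 : (1 <= n)%N by rewrite (leq_trans _ Jn).
case: n Jn n1 ln_n => [//|[//|j]] Jn n1 ln_n; exists j; split => //; first by rewrite leqnn.
have sn0 : 0 <= (j.+2%:R : R) by [].
rewrite -/c1 [leRHS]mulrDl [leLHS]mulrDr; apply: lerD.
  rewrite mulrC -[leRHS]mulrA ler_wpM2l//; apply: (le_trans (h2 _ n1)); rewrite ler_pM2l//.
  by apply: ler_wsqrtr; rewrite ler_peMr.
have gq : growth rho j.+2 <= 1 * growth rho j.+2 by rewrite mul1r.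
apply: (le_trans (sqrt_scale _ _ _ _ ler01 gq)).
rewrite mul1r -sqrtrM; last exact: KC_ge0.
by rewrite !mulrA.
Qed.

End envelopes.

(** * Second moments and non-degeneracy of the martingale *)

Section second_moment.
Context {R : realType}.
Variables (a1 a2 x1 x2 rho theta : R).
Hypotheses (na1 : `|a1| <= 1) (na2 : `|a2| <= 1) (nx1 : `|x1| = 1) (nx2 : `|x2| = 1).
Hypotheses (nrho : `|rho| <= 1) (rho1 : a1 = rho * theta) (rho2 : theta * a2 = rho).
Implicit Types s : seq (R * R).
Local Notation Ex := (Ex a1 a2 x1 x2).
Local Notation stp := (step a1 a2).
Local Notation mart := (mart rho theta).

(** The conditional variance of the unnormalised increment: the two next signs are conditionally
    independent, and a sign of mean [m] has variance [1 - m ^+ 2]. *)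
Definition cvar s := (1 - mean1 a1 s ^+ 2) + theta ^+ 2 * (1 - mean2 a2 s ^+ 2).

Lemma cvar_bounds n s : path_of n s -> 0 <= cvar s <= 1 + theta ^+ 2.
Proof.
move=> ps; have [m1 m2] := mean_bound na1 na2 ps.
have sq (y : R) : `|y| <= 1 -> 0 <= 1 - y ^+ 2 <= 1.
  by move=> y1; rewrite subr_ge0 gerBl sqr_ge0 andbT -real_normK ?num_real// expr_le1.
have /andP[? ?] := sq _ m1; have /andP[? ?] := sq _ m2.
rewrite /cvar; apply/andP; split; first by rewrite addr_ge0// mulr_ge0// sqr_ge0.
by apply: lerD => //; rewrite ler_piMr ?sqr_ge0.
Qed.

Lemma step_mart_lin n s (b c : R) : (1 <= n)%N -> path_of n s ->
  stp (fun t => b * mart t + c) s = b * mart s + c.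
Proof.
move=> n1 ps; rewrite /step !(mart_rcons nrho rho1 rho2 _ _ n1 ps) /drift; field.
by rewrite gt_eqF// growth_gt0.
Qed.

Lemma step_mart_sqr n s (l : R) : (1 <= n)%N -> path_of n s ->
  stp (fun t => (mart t - l) ^+ 2) s = (mart s - l) ^+ 2 + cvar s / growth rho n.+2 ^+ 2.
Proof.
move=> n1 ps; rewrite /step !(mart_rcons nrho rho1 rho2 _ _ n1 ps) /drift /cvar; field.
by rewrite gt_eqF// growth_gt0.
Qed.

Lemma Ex_mart_sqrS n (l : R) : (1 <= n)%N ->
  Ex n.+1 (fun s => (mart s - l) ^+ 2) =
  Ex n (fun s => (mart s - l) ^+ 2) + Ex n cvar / growth rho n.+2 ^+ 2.
Proof.
move=> n1; rewrite [_ / _]mulrC -ExZ -ExD.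
rewrite -[LHS]/(Ex n (stp (fun s => (mart s - l) ^+ 2))); apply: eq_Ex_path => // s ps.
by rewrite (step_mart_sqr _ n1 ps) mulrC.
Qed.

Lemma Ex_mart_sqr_le n (l : R) : (1 <= n)%N ->
  Ex n (fun s => (mart s - l) ^+ 2) <=
  Ex 1 (fun s => (mart s - l) ^+ 2) + (1 + theta ^+ 2) * qvar rho n.+1.
Proof.
case: n => // n _; elim: n => [|n IH].
  by rewrite lerDl mulr_ge0 ?addr_ge0 ?sqr_ge0// /qvar big_geq.
rewrite Ex_mart_sqrS// qvarS// mulrDr addrA lerD// ler_wpM2r ?invr_ge0 ?sqr_ge0//.
rewrite -[leRHS](Ex_cst a1 a2 x1 x2 n.+1); apply: le_Ex => // s ps.
by have /andP[] := cvar_bounds ps.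
Qed.

Lemma mart_bound n s : path_of n s -> `|mart s| <= n.+1%:R * (1 + `|theta|) / growth rho n.+1.
Proof.
move=> ps; have /andP[/eqP sn /signs_sum[b1 b2]] := ps; rewrite sn in b1 b2.
rewrite /mart sn normrM normfV (gtr0_norm (growth_gt0 _ nrho)) ler_wpM2r ?invr_ge0 ?(ltW (growth_gt0 _ nrho))//.
by rewrite (le_trans (ler_normD _ _))// mulrDr mulr1 lerD// normrM mulrC ler_wpM2r.
Qed.

(* If the martingale tended to [l] in mean, orthogonality of increments would
   force its variance around [l] to vanish at every time. *)
Lemma mart_L1_cvg_degenerate (l : R) m : (1 <= m)%N ->
  Ex n (fun s => `|mart s - l|) @[n --> \oo] --> 0 ->
  Ex m (fun s => (mart s - l) ^+ 2) = 0.
Proof.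
move=> m1 h.
pose B := m.+1%:R * (1 + `|theta|) / growth rho m.+1 + `|l|.
have B0 : 0 <= B.
  by rewrite addr_ge0// divr_ge0 ?(ltW (growth_gt0 _ nrho))// mulr_ge0// addr_ge0.
have key n : (m <= n)%N -> Ex m (fun s => (mart s - l) ^+ 2) <= B * Ex n (fun s => `|mart s - l|).
  move=> mn; pose Q s := (mart s - l) * (mart (take m.+1 s) - l).
  have -> : Ex m (fun s => (mart s - l) ^+ 2) = Ex m Q.
    apply: eq_Ex_path => // s /path_size sm.
    by rewrite /Q take_oversize ?sm// expr2.
  rewrite -(@Ex_martingale _ _ _ _ _ na1 na2 nx1 nx2 Q m n mn); last first.
    move=> j s /andP[mj _] ps; pose b := mart (take m.+1 s) - l.
    rewrite [RHS](_ : _ = b * mart s + - b * l); last by rewrite /Q /b; ring.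
    rewrite -(step_mart_lin b (- b * l) (leq_trans m1 mj) ps) /step /Q.
    rewrite -!cats1 !takel_cat ?(path_size ps)// -/b; ring.
  rewrite -ExZ; apply: le_Ex => // s ps; apply: (le_trans (ler_norm _)).
  rewrite /Q normrM mulrC ler_wpM2r// (le_trans (ler_normB _ _))// /B lerD2r.
  apply: mart_bound; rewrite /path_of size_takel ?(path_size ps)// eqxx /=.
  have /andP[_] := ps; rewrite /signs -{1}(cat_take_drop m.+1 s) all_cat.
  by case/andP.
apply/eqP; rewrite eq_le Ex_ge0//; last by move=> s _; exact: sqr_ge0.
rewrite andbT; have hB : B * Ex n (fun s => `|mart s - l|) @[n --> \oo] --> 0.
  by rewrite -(mulr0 B); exact: cvgMr.
rewrite -(cvg_lim (@Rhausdorff R) hB); apply: limr_ge; first by apply/cvg_ex; exists 0.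
by exists m => // n /= mn; exact: key.
Qed.

(** If [a1] or [a2] is not extremal, [cvar] is bounded below by a positive constant. Otherwise both
    are [1] or both are [-1], and the assumption on the initial steps decides: it excludes the
    configurations in which the walk is deterministic. *)
Lemma Ex_cvar_gt0 : a1 != 0 -> a2 != 0 -> 0 < a1 * a2 ->
  (a1 = 1 -> a2 = 1 -> x1 != x2) -> (a1 = -1 -> a2 = -1 -> x1 = x2) ->
  0 < Ex 1 cvar.
Proof.
move=> a10 a20 a12 h1 h2.
have th0 : 0 < theta ^+ 2.
  rewrite exprn_even_gt0//=; apply: contraNneq a10 => t0.
  by rewrite rho1 t0 mulr0.
have b n s : path_of n s -> mean1 a1 s ^+ 2 <= a1 ^+ 2 /\ mean2 a2 s ^+ 2 <= a2 ^+ 2.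
  move=> ps; have /andP[/eqP sn /signs_sum[b1 b2]] := ps.
  have n0 : 0 < (size s)%:R :> R by rewrite sn ltr0n.
  have sq (y : R) : `|y| <= (size s)%:R -> (y / (size s)%:R) ^+ 2 <= 1.
    move=> hy; rewrite -real_normK ?num_real// normrM normfV (gtr0_norm n0) expr_le1//.
      by rewrite ler_pdivrMr// mul1r.
  by rewrite /mean1 /mean2 -!mulrA ![(_ * (_ / _)) ^+ 2]exprMn !ler_piMr ?sqr_ge0 ?sq.
have sqle (y : R) : `|y| <= 1 -> y ^+ 2 <= 1.
  by move=> y1; rewrite -real_normK ?num_real// expr_le1.
have [e1|n1] := eqVneq (a1 ^+ 2) 1; last first.
  apply: (@lt_le_trans _ _ (1 - a1 ^+ 2)); first by rewrite subr_gt0 lt_neqAle n1 sqle.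
  rewrite -[leLHS](Ex_cst a1 a2 x1 x2 1); apply: le_Ex => // s ps.
  have [u v] := b _ _ ps; have v' : 0 <= 1 - mean2 a2 s ^+ 2 by rewrite subr_ge0 (le_trans v)// sqle.
  rewrite /cvar; have := mulr_ge0 (sqr_ge0 theta) v'; lra.
have [e2|n2] := eqVneq (a2 ^+ 2) 1; last first.
  apply: (@lt_le_trans _ _ (theta ^+ 2 * (1 - a2 ^+ 2))); first by rewrite mulr_gt0// subr_gt0 lt_neqAle n2 sqle.
  rewrite -[leLHS](Ex_cst a1 a2 x1 x2 1); apply: le_Ex => // s ps.
  have [u v] := b _ _ ps; rewrite /cvar.
  have u' : 0 <= 1 - mean1 a1 s ^+ 2 by rewrite subr_ge0 (le_trans u)// sqle.
  have : theta ^+ 2 * (1 - a2 ^+ 2) <= theta ^+ 2 * (1 - mean2 a2 s ^+ 2) by rewrite ler_pM2l//; lra.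
  lra.
have pm (y : R) : y ^+ 2 = 1 -> y = 1 \/ y = -1.
  move=> /eqP; rewrite -[X in _ == X](expr1n _ 2) eqf_sqr => /orP[] /eqP ->; [by left|by right].
have pm' (y : R) : `|y| = 1 -> y = 1 \/ y = -1.
  by move=> y1; apply: pm; rewrite -real_normK ?num_real// y1 expr1n.
(* In the remaining extremal cases the second pair of steps is forced and both sums vanish at time
   [2], so the next signs are fair. *)
rewrite /= /step /cvar /mean1 /mean2 !sum1_rcons !sum2_rcons /sum1 /sum2 !big_seq1 /=.
have [e1' | e1'] := pm _ e1; have [e2'|e2'] := pm _ e2; rewrite e1' e2' in a12 h1 h2 *; last first.
- rewrite (h2 erefl erefl); have [->|->] := pm' _ nx2; nra.
- by exfalso; lra.
- by exfalso; lra.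
- have := h1 erefl erefl; have [->|->] := pm' _ nx1; have [->|->] := pm' _ nx2; rewrite ?eqxx//= => _; nra.
Qed.

End second_moment.

(** * Almost sure convergence *)

Section convergence.
Context {R : realType} {d : measure_display} {T : measurableType d}.
Variables (P : probability T R) (p1 p2 : R).
Variables (xi1 xi2 : nat -> T -> bool) (u1 u2 : nat -> T -> nat) (x1 x2 : R).
Hypothesis (model : two_elephant_model P p1 p2 xi1 xi2 u1 u2).
Hypotheses (p1_01 : 0 <= p1 <= 1) (p2_01 : 0 <= p2 <= 1).
Hypotheses (nx1 : `|x1| = 1) (nx2 : `|x2| = 1).
Variables (rho theta : R).
Local Notation a1 := (2 * p1 - 1).
Local Notation a2 := (2 * p2 - 1).
Local Notation Ex := (Ex a1 a2 x1 x2).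
Local Notation steps := (steps xi1 xi2 u1 u2 x1 x2).
Local Notation mart := (mart rho theta).
Hypotheses (nrho : `|rho| <= 1) (rho1 : a1 = rho * theta) (rho2 : theta * a2 = rho).

Let na1 : `|a1| <= 1.
Proof. by case/andP: p1_01 => h1 h2; rewrite ler_norml; apply/andP; split; lra. Qed.
Let na2 : `|a2| <= 1.
Proof. by case/andP: p2_01 => h1 h2; rewrite ler_norml; apply/andP; split; lra. Qed.

Lemma ae_envelope (f : nat -> R) C : envelope rho theta f C ->
  {ae P, forall w, exists N, forall n, (N <= n)%N -> `|lin theta (steps n w)| <= C * f n}.
Proof.
move=> [nd [D [h1 h2 h3 h4]]].
have := eventually_below model p1_01 p2_01 nx1 nx2 nrho rho1 rho2 h1 h2 h3.
apply: filterS => w [J hJ]; have [N hN] := h4 J; exists N => n Nn.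
have [j [Jj nj hj]] := hN n Nn.
by apply: le_trans hj; exact: hJ.
Qed.

Hypothesis rho_gt : 2^-1 < rho.

(** The tail of the quadratic variation is of order [m ^ (1 - 2 rho)], so the maximal inequality
    gives a bound uniform in [n] that vanishes as [m] grows. *)
Lemma prob_hits_after (eps : R) : 0 < eps -> exists2 c : R, 0 < c & forall m n, (2 <= m <= n)%N ->
  (P (steps n @^-1` [set s | hits_abs rho theta eps m s]) <=
   (2 * expR (- (c * m%:R `^ (2 * rho - 1))))%:E)%E.
Proof.
move=> e0; have [C C0 hC] := qvar_supercritical nrho rho_gt; have K0 := Kvar_gt0 theta.
exists (eps ^+ 2 / (4 * Kvar theta * C)).
  by rewrite divr_gt0 ?exprn_gt0//; do 2 (apply: mulr_gt0 => //).
move=> m n mn; have m2 : (2 <= m)%N by case/andP: mn.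
have n0 : (0 < n)%N by case/andP: mn => _ /(leq_trans m2)/ltnW.
rewrite -(prednK n0) (prob_steps model)// lee_fin.
have mp : 0 < (m%:R : R) `^ (1 - 2 * rho) by rewrite powR_gt0// ltr0n ltnW.
rewrite (_ : - (_ * _) = - (eps ^+ 2 / (4 * Kvar theta * (C * m%:R `^ (1 - 2 * rho))))); last first.
  rewrite (_ : 2 * rho - 1 = - (1 - 2 * rho)); last by ring.
  by rewrite powRN; field; rewrite !gt_eqF.
have mn' : (2 <= m <= n.-1.+1)%N by rewrite prednK.
apply: le_trans (maximal_inequality na1 na2 nx1 nx2 nrho rho1 rho2 mn' e0 _ _); last first.
- by rewrite prednK// hC.
- by rewrite mulr_gt0.
apply/eq_ler/eq_Ex => s; rewrite indicE; congr (_%:R).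
by rewrite (_ : (s \in _) = hits_abs rho theta eps m s)//; apply/idP/idP; [move/set_mem|move=> ?; apply/mem_set].
Qed.

(** Almost sure Cauchyness from the maximal inequality, in place of a general martingale convergence
    theorem. *)
Lemma mart_cvg : {ae P, forall w, exists l : R, mart (steps n w) @[n --> \oo] --> l}.
Proof.
pose A i m n := steps n.+2 @^-1` [set s | hits_abs rho theta i.+1%:R^-1 m s].
have mA i m n : measurable (A i m n) by exact: measurable_steps model _ _.
(* [B i] says that after every time [m] the martingale still moves by at least [1 / i.+1]. For fixed
   [m] the events increase with [n], so continuity from below turns the uniform bound into one on
   the whole future. *)
pose B i := \bigcap_(m in [set m | (2 <= m)%N]) \bigcup_n A i m (m + n)%N.
have mB i : measurable (B i).
  by apply: bigcap_measurable => [|m _]; [exists 2%N|apply: bigcup_measurable].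
have mono i m : nondecreasing_seq (fun n => A i m (m + n)%N).
  apply/nondecreasing_seqP => n; rewrite addnS; apply/subsetPset => w.
  rewrite /A /= /hits_abs !size_steps => /hasP[k]; rewrite mem_index_iota => /andP[mk kn] hk.
  apply/hasP; exists k; first by rewrite mem_index_iota mk (ltn_trans kn).
  by move: hk; rewrite /incr !take_steps//; lia.
have PB i : P (B i) = 0%E.
  have e0 : 0 < (i.+1%:R^-1 : R) by rewrite invr_gt0 ltr0n.
  have [c c0 hc] := prob_hits_after e0.
  have hm m : (2 <= m)%N -> (P (B i) <= (2 * expR (- (c * m%:R `^ (2 * rho - 1))))%:E)%E.
    move=> m2; apply: (@le_trans _ _ (P (\bigcup_n A i m (m + n)%N))).
      apply: le_measure; rewrite ?inE//; first by apply: bigcup_measurable.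
      by move=> w; apply.
    have cv := @nondecreasing_cvg_mu _ _ _ P _ (fun n => mA i m (m + n)%N)
      (bigcup_measurable (fun n _ => mA i m (m + n)%N)) (mono i m).
    rewrite -(cvg_lim _ cv)//; apply: lime_le; first by apply/cvg_ex; eexists; exact: cv.
    apply: nearW => n; by apply: hc; rewrite m2 /= -addn2 -addnA leq_addr.
  apply/eqP; rewrite eq_le measure_ge0 andbT; apply/lee_addgt0Pr => e ee; rewrite add0e.
  have r1 : 0 < 2 * rho - 1 by have := rho_gt; lra.
  have cv : c * (n%:R : R) `^ (2 * rho - 1) @[n --> \oo] --> +oo.
    by apply: (cvgny_pMl c0); exact: powRn_cvgy.
  have /cvgryPge/(_ (- ln (e / 2)))[N _ hN] := cv.
  apply: (le_trans (hm (maxn 2 N) (leq_maxl _ _))); rewrite lee_fin.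
  have h := hN (maxn 2 N) (leq_maxr _ _).
  have : expR (- (c * (maxn 2 N)%:R `^ (2 * rho - 1))) <= e / 2.
    by rewrite -[leRHS]lnK ?posrE ?divr_gt0// ler_expR lerNl.
  lra.
have : {ae P, forall w, forall i, ~ B i w}.
  apply/ae_foralln => i; exists (B i); split; [exact: mB|exact: PB|].
  by move=> w /=; rewrite not_notE.
apply: filterS => w hB.
apply/cvg_ex/cauchy_cvgP; apply: cauchy_exP => e e0.
have [i hi] : exists i, i.+1%:R^-1 < e.
  have /cvgr_lt/(_ e e0)[N _ hN] := @cvg_harmonic R; exists N; exact: (hN N (leqnn N)).
have [m [m2 hm]] : exists m, (2 <= m)%N /\ ~ (\bigcup_n A i m (m + n)%N) w.
  apply: contrapT => h; apply: (hB i) => m m2; apply: contrapT => h'; apply: h; by exists m.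
exists (mart (steps m w)), m => // n /= mn; rewrite /ball /= distrC.
apply: lt_trans hi; rewrite ltNge; apply/negP => hh; apply: hm; exists n => //.
rewrite /A /= /hits_abs size_steps; apply/hasP; exists n.
  by rewrite mem_index_iota mn /=; lia.
by rewrite /incr !take_steps//; lia.
Qed.

(** Convergence to a constant would hold in mean, since the second moments are bounded;
    [mart_L1_cvg_degenerate] then removes all variance, contradicting [Ex_cvar_gt0]. *)
Lemma mart_not_cst : a1 != 0 -> a2 != 0 -> 0 < a1 * a2 ->
  (a1 = 1 -> a2 = 1 -> x1 != x2) -> (a1 = -1 -> a2 = -1 -> x1 = x2) ->
  ~ (exists l : R, {ae P, forall w, mart (steps n w) @[n --> \oo] --> l}).
Proof.
move=> a10 a20 a12 h1 h2 [l hl].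
(* Truncating the distance to [l] makes dominated convergence applicable; the truncation is removed
   afterwards with the second moment. *)
pose phi (y : R) : R := Num.min `|y - l| 1.
have phi0 y : 0 <= phi y by rewrite le_min normr_ge0 ler01.
have phi1 y : phi y <= 1 by rewrite ge_min lexx orbT.
have cphi : Ex n (phi \o mart) @[n --> \oo] --> 0.
  have mf n : measurable_fun setT (EFin \o (fun w => phi (mart (steps n.+1 w)))).
    apply/measurable_EFinP; exact: (measurable_fun_steps x1 x2 model _ (phi \o mart)).
  have [] := @dominated_convergence _ _ _ P setT measurableT
     (fun n => EFin \o (fun w => phi (mart (steps n.+1 w)))) (cst 0%E) (cst 1%E) mf.
  - exact: measurable_cst.
  - move: hl; apply: filterS => w hw _; apply: cvg_EFin; first by apply: nearW.
    apply: (@squeeze_cvgr _ _ _ _ (fun=> 0) (fun n => `|mart (steps n.+1 w) - l|)).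
    + by apply: nearW => n /=; rewrite phi0 ge_min lexx.
    + exact: cvg_cst.
    + have : `|mart (steps n w) - l| @[n --> \oo] --> 0.
        rewrite -[X in _ --> X](normr0 R) -(subrr l); apply: cvg_norm; apply: cvgB => //; exact: cvg_cst.
      by rewrite -(cvg_shiftS (fun n => `|mart (steps n w) - l|)).
  - by apply/integrableP; split => //=; rewrite integral_cst//= normr1 mul1e probability_setT ltry.
  - by apply: nearW => w n _ /=; rewrite lee_fin ger0_norm.
  move=> _ _; rewrite integral0 => h.
  have h' : (Ex n (phi \o mart))%:E @[n --> \oo] --> 0%:E.
    apply: cvg_trans h; apply: near_eq_cvg; apply: nearW => n /=.
    by rewrite (integral_steps model p1_01 p2_01 nx1 nx2 n (G := phi \o mart))// => s; exact: phi0.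
  exact: (fine_cvg h').
have [C C0 hC] := qvar_supercritical nrho rho_gt.
pose M := Ex 1 (fun s => (mart s - l) ^+ 2) + (1 + theta ^+ 2) * (C * 2%:R `^ (1 - 2 * rho)).
have hM n : (1 <= n)%N -> Ex n (fun s => (mart s - l) ^+ 2) <= M.
  move=> n1; apply: (le_trans (Ex_mart_sqr_le na1 na2 nx1 nx2 nrho rho1 rho2 _ n1)).
  rewrite lerD2l ler_wpM2l ?addr_ge0 ?sqr_ge0//.
  have := hC 2 n.+1 n1; rewrite [X in _ - X](_ : _ = 0) ?subr0//.
  by rewrite /qvar big_geq.
have M0 : 0 <= M by apply: le_trans (hM 1%N isT); apply: Ex_ge0 => // s _; exact: sqr_ge0.
have L1 : Ex n (fun s => `|mart s - l|) @[n --> \oo] --> 0.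
  apply/cvgrPdist_le => e e0.
  (* Based on [2 * y <= A + y ^+ 2 / A], applied where the truncation is active; this size of [A]
     makes the second-moment term at most [e / 2]. *)
  pose A := 2 * M / e + 1.
  have MA : 0 <= 2 * M / e by rewrite divr_ge0 ?(ltW e0)// mulr_ge0.
  have A0 : 0 < A by rewrite ltr_wpDl.
  have eA : 0 < e / 2 / A by rewrite !divr_gt0.
  have /cvgrPdist_le/(_ _ eA)[N _ hN] := cphi.
  exists (maxn 1 N) => // n /=; rewrite geq_max => /andP[n1 Nn].
  have h := hN n Nn; rewrite sub0r normrN in h; rewrite sub0r normrN ger0_norm; last first.
    by apply: Ex_ge0 => // s _.
  apply: (@le_trans _ _ (A * Ex n (phi \o mart) + A^-1 * Ex n (fun s => (mart s - l) ^+ 2))).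
    rewrite -!ExZ -ExD; apply: le_Ex => // s _ /=; rewrite /phi.
    have [hA|hA] := leP `|mart s - l| 1.
      apply: ler_wpDr; first by rewrite mulr_ge0 ?invr_ge0 ?sqr_ge0 ?(ltW A0).
      by rewrite ler_peMl// /A lerDr.
    rewrite mulr1; rewrite -(real_normK (num_real (mart s - l))).
    move: (`|_|) hA => y hy.
    have : 0 <= A^-1 * (y - A) ^+ 2 by rewrite mulr_ge0 ?sqr_ge0 ?invr_ge0 ?ltW.
    have -> : A^-1 * (y - A) ^+ 2 = A^-1 * y ^+ 2 + A - 2 * y by field; rewrite gt_eqF.
    lra.
  have k1 : A * Ex n (phi \o mart) <= e / 2.
    rewrite mulrC -ler_pdivlMr//; exact: (le_trans (ler_norm _)).
  have k2 : A^-1 * Ex n (fun s => (mart s - l) ^+ 2) <= e / 2.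
    apply: (@le_trans _ _ (A^-1 * M)); first by rewrite ler_wpM2l ?hM// invr_ge0 ltW.
    rewrite mulrC ler_pdivrMr//.
    have -> : e / 2 * A = M + e / 2 by rewrite /A; field; rewrite gt_eqF.
    by rewrite lerDl divr_ge0// ltW.
  lra.
have z m (m1 : (1 <= m)%N) := mart_L1_cvg_degenerate na1 na2 nx1 nx2 nrho rho1 rho2 m1 L1.
have := Ex_mart_sqrS na1 na2 nx1 nx2 nrho rho1 rho2 l (leqnn 1); rewrite !z// add0r => /esym/eqP.
rewrite mulf_eq0 invr_eq0 expf_eq0 /= (gt_eqF (growth_gt0 _ nrho)) orbF.
by rewrite gt_eqF// (Ex_cvar_gt0 na1 na2 nx1 nx2 rho1).
Qed.

End convergence.

(** * The heat kernel and Lindeberg's argument *)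

Section heat_kernel.
Context {R : realType}.
Implicit Types (f g : R -> R) (x y z tau K : R).

Lemma mean_value_bound f (f' : R -> R) K y z :
  (forall x, Num.min y z <= x <= Num.max y z -> is_derive x 1 f (f' x) /\ `|f' x| <= K) ->
  `|f z - f y| <= K * `|z - y|.
Proof.
move=> h.
have aux a b : a <= b -> (forall x, a <= x <= b -> is_derive x 1 f (f' x) /\ `|f' x| <= K) ->
    `|f b - f a| <= K * `|b - a|.
  move=> ab hab; have [||c] := @MVT_segment R f f' a b ab.
  - by move=> x; rewrite in_itv /= => /andP[ax xb]; have [] := hab x; rewrite ?(ltW ax) ?(ltW xb).
  - apply: derivable_within_continuous => x; rewrite in_itv /= => /hab[D _].
    exact: ex_derive.
  by rewrite in_itv /= => /hab[_ hc] ->; rewrite normrM ler_wpM2r.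
have [yz|zy] := leP y z.
  by apply: aux => // x; move: (h x); rewrite (min_idPl yz) (max_idPr yz).
rewrite distrC [`|z - y|]distrC; apply: aux; first exact: ltW.
by move=> x; move: (h x); rewrite (min_idPr (ltW zy)) (max_idPl (ltW zy)).
Qed.

Let between y z x : Num.min y z <= x <= Num.max y z -> `|x - y| <= `|z - y|.
Proof.
have [yz|zy] := leP y z.
  by move=> /andP[h1 h2]; rewrite !ger0_norm ?subr_ge0// lerD2r.
by move=> /andP[h1 h2]; rewrite ![`|_ - y|]distrC !ger0_norm ?subr_ge0 ?(ltW zy)// lerB.
Qed.

Let is_deriveB1 f g x a b : is_derive x 1 f a -> is_derive x 1 g b ->
  is_derive x 1 (fun y => f y - g y) (a - b).
Proof. by move=> fa gb; exact: is_deriveB. Qed.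

Let is_deriveM1 f g x a b : is_derive x 1 f a -> is_derive x 1 g b ->
  is_derive x 1 (fun y => f y * g y) (a * g x + f x * b).
Proof.
move=> fa gb; apply: (is_derive_eq (is_deriveM fa gb)).
by rewrite /GRing.scale /=; ring.
Qed.

Let is_derive_aff x (a b : R) : is_derive x 1 (fun y => a * y + b) a.
Proof.
apply: (is_derive_eq (is_deriveD (is_deriveM1 (is_derive_cst a x 1) (is_derive_id x 1)) (is_derive_cst b x 1))).
by rewrite /=; ring.
Qed.

Let is_derive_sqr x (a b : R) : is_derive x 1 (fun y => a * y ^+ 2 + b) (2 * a * x).
Proof.
have h := is_deriveM1 (is_derive_aff x a 0) (is_derive_aff x 1 0).
have h' := is_deriveD h (is_derive_cst b x 1).
rewrite (_ : (fun y => a * y ^+ 2 + b) = (fun y => (a * y + 0) * (1 * y + 0)) + cst b); last first.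
  by apply/funext => y; rewrite /cst !fctE; ring.
by apply: (is_derive_eq h'); ring.
Qed.

Let is_derive_exp g x b : is_derive x 1 g b -> is_derive x 1 (expR \o g) (expR (g x) * b).
Proof. by move=> gb; apply: is_derive1_comp. Qed.

(** Iterating the mean value bound three times gives the cubic remainder without the sharp factor
    [1 / 6], which is immaterial here. *)
Lemma taylor2 f (f1 f2 f3 : R -> R) K y z :
  (forall x, is_derive x 1 f (f1 x)) -> (forall x, is_derive x 1 f1 (f2 x)) ->
  (forall x, is_derive x 1 f2 (f3 x)) -> (forall x, `|f3 x| <= K) ->
  `|f z - f y - (z - y) * f1 y - (z - y) ^+ 2 / 2 * f2 y| <= K * `|z - y| ^+ 3.
Proof.
move=> d1 d2 d3 hK.
have K0 : 0 <= K by exact: le_trans (hK 0).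
have s2 x : `|f2 x - f2 y| <= K * `|x - y|.
  by apply: (mean_value_bound (f' := f3)) => t _; split.
pose g1 x := (f1 x - f1 y) - (x - y) * f2 y.
have g1E x : is_derive x 1 g1 (f2 x - f2 y).
  have h := is_deriveB1 (d2 x) (is_derive_aff x (f2 y) (f1 y - y * f2 y)).
  by rewrite (_ : g1 = (fun x => f1 x - (f2 y * x + (f1 y - y * f2 y)))) // /g1; apply/funext => t; ring.
have s1 x : `|g1 x| <= K * `|x - y| ^+ 2.
  have -> : g1 x = g1 x - g1 y by rewrite /g1; ring.
  rewrite expr2 mulrA; apply: (mean_value_bound (f' := fun t => f2 t - f2 y)) => t ht; split => //.
  by rewrite (le_trans (s2 t))// ler_wpM2l// between.
pose g0 x := f x - f y - (x - y) * f1 y - (x - y) ^+ 2 / 2 * f2 y.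
have g0E x : is_derive x 1 g0 (g1 x).
  have h := is_deriveB1 (is_deriveB1 (d1 x) (is_derive_aff x (f1 y - y * f2 y) (f y - y * f1 y)))
    (is_derive_sqr x (f2 y / 2) (y ^+ 2 / 2 * f2 y)).
  rewrite (_ : g0 = (fun x => (f x - ((f1 y - y * f2 y) * x + (f y - y * f1 y))) -
     (f2 y / 2 * x ^+ 2 + y ^+ 2 / 2 * f2 y))).
    by apply: (is_derive_eq h); rewrite /g1; field.
  by rewrite /g0; apply/funext => t; field.
have -> : f z - f y - (z - y) * f1 y - (z - y) ^+ 2 / 2 * f2 y = g0 z - g0 y by rewrite /g0; field.
rewrite exprSr mulrA; apply: (mean_value_bound (f' := g1)) => t ht; split => //.
by rewrite (le_trans (s1 t))// ler_wpM2l// lerXn2r ?nnegrE// between.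
Qed.

(** Derivatives are required only to the right of [y], as this is applied in the time variable of
    the heat kernel, which must stay positive. *)
Lemma taylor1 f (f1 f2 : R -> R) K y z : y <= z ->
  (forall x, y <= x -> is_derive x 1 f (f1 x)) -> (forall x, y <= x -> is_derive x 1 f1 (f2 x)) ->
  (forall x, y <= x -> `|f2 x| <= K) ->
  `|f z - f y - (z - y) * f1 y| <= K * (z - y) ^+ 2.
Proof.
move=> yz d1 d2 hK.
have K0 : 0 <= K by exact: le_trans (hK y (lexx y)).
have inyz u x : y <= u -> Num.min y u <= x <= Num.max y u -> y <= x.
  by move=> yu /andP[h _]; rewrite (le_trans _ h)// le_min lexx yu.
have s1 x : y <= x -> `|f1 x - f1 y| <= K * `|x - y|.
  by move=> yx; apply: (mean_value_bound (f' := f2)) => t /(inyz _ _ yx) ht; split; [exact: d2|exact: hK].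
pose g x := f x - f y - (x - y) * f1 y.
have gE x : y <= x -> is_derive x 1 g (f1 x - f1 y).
  move=> yx; have h := is_deriveB1 (d1 x yx) (is_derive_aff x (f1 y) (f y - y * f1 y)).
  by rewrite (_ : g = (fun x => f x - (f1 y * x + (f y - y * f1 y))))// /g; apply/funext => t; ring.
have -> : f z - f y - (z - y) * f1 y = g z - g y by rewrite /g; ring.
rewrite -[(z - y) ^+ 2]real_normK ?num_real// expr2 mulrA.
apply: (mean_value_bound (f' := fun x => f1 x - f1 y)) => t ht; have yt := inyz _ _ yz ht.
by split; [exact: gE|rewrite (le_trans (s1 _ yt))// ler_wpM2l// between].
Qed.

(* Up to the constant factor [(2 pi)^-1/2], the centered Gaussian density of variance [tau]. *)
Definition heat tau y : R := expR (- (y ^+ 2 / (2 * tau)) - ln tau / 2).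
Definition heat1 tau y : R := heat tau y * (- y / tau).
Definition heat2 tau y : R := heat tau y * (y ^+ 2 / tau ^+ 2 - tau^-1).
Definition heat3 tau y : R := heat tau y * (3 * y / tau ^+ 2 - y ^+ 3 / tau ^+ 3).
(** Unlike [heat1], [heat2] and [heat3], which are derivatives in [y], this is the second derivative
    in [tau]. *)
Definition heat4 tau y : R :=
  heat tau y * ((y ^+ 2 / (2 * tau ^+ 2) - (2 * tau)^-1) ^+ 2 - y ^+ 2 / tau ^+ 3 + (2 * tau ^+ 2)^-1).

Lemma is_derive_heat tau y : tau != 0 -> is_derive y 1 (heat tau) (heat1 tau y).
Proof.
move=> t0.
have h := is_derive_exp (is_derive_sqr y (- (2 * tau)^-1) (- (ln tau / 2))).
rewrite (_ : heat tau = expR \o (fun y => - (2 * tau)^-1 * y ^+ 2 + - (ln tau / 2))); last first.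
  by apply/funext => x; rewrite /heat /=; congr expR; rewrite mulNr [_^-1 * _]mulrC.
apply: (is_derive_eq h); rewrite /heat1 /heat mulNr [_^-1 * y ^+ 2]mulrC.
by congr (_ * _); field.
Qed.

Lemma is_derive_heat1 tau y : tau != 0 -> is_derive y 1 (heat1 tau) (heat2 tau y).
Proof.
move=> t0; have h := is_deriveM1 (is_derive_heat y t0) (is_derive_aff y (- tau^-1) 0).
rewrite (_ : heat1 tau = (fun y => heat tau y * (- tau^-1 * y + 0))); last first.
  by apply/funext => x; rewrite /heat1; congr (_ * _); field.
by apply: (is_derive_eq h); rewrite /heat2 /heat1; field.
Qed.

Lemma is_derive_heat2 tau y : tau != 0 -> is_derive y 1 (heat2 tau) (heat3 tau y).
Proof.
move=> t0; have h := is_deriveM1 (is_derive_heat y t0) (is_derive_sqr y (tau ^- 2) (- tau^-1)).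
rewrite (_ : heat2 tau = (fun y => heat tau y * (tau ^- 2 * y ^+ 2 + - tau^-1))); last first.
  by apply/funext => x; rewrite /heat2; congr (_ * _); field.
by apply: (is_derive_eq h); rewrite /heat3 /heat1; field.
Qed.

(** The heat equation: it lets the second-order Taylor term in space be traded for an increase of
    the time parameter. *)
Lemma is_derive_heat_time tau y : 0 < tau ->
  is_derive tau 1 (heat^~ y) (heat2 tau y / 2).
Proof.
move=> t0; have t1 : tau != 0 by rewrite gt_eqF.
have hV := is_deriveV t1 (is_derive_id tau 1).
have h1 := is_deriveM1 (is_derive_cst (- (y ^+ 2 / 2)) tau 1) hV.
have h2 := is_deriveM1 (is_derive1_ln t0) (is_derive_cst (2^-1 : R) tau 1).
have h3 := is_derive_exp (is_deriveB1 h1 h2).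
rewrite (_ : heat^~ y = expR \o (fun t => (- (y ^+ 2 / 2)) * t^-1 - ln t * 2^-1)); last first.
  by apply/funext => x; rewrite /heat /= mulNr invfM mulrA.
apply: (is_derive_eq h3); rewrite /heat2 -[RHS]mulrA; congr (_ * _).
  by rewrite /heat /=; congr expR; field.
by rewrite /cst /GRing.scale /=; field.
Qed.

Lemma is_derive_heat2_time tau y : 0 < tau ->
  is_derive tau 1 (fun t => heat2 t y / 2) (heat4 tau y).
Proof.
move=> t0; have t1 : tau != 0 by rewrite gt_eqF.
have hV := is_deriveV t1 (is_derive_id tau 1).
have h1 := is_deriveM1 (is_derive_cst (y ^+ 2 / 2) tau 1) (is_deriveM1 hV hV).
have h2 := is_deriveM1 hV (is_derive_cst (2^-1 : R) tau 1).
have h3 := is_deriveM1 (is_derive_heat_time y t0) (is_deriveB1 h1 h2).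
rewrite (_ : (fun t => heat2 t y / 2) = (fun t => heat t y * (y ^+ 2 / 2 * (t^-1 * t^-1) - t^-1 * 2^-1))).
  by apply: (is_derive_eq h3); rewrite /heat4 /heat2 /cst /GRing.scale /=; field.
apply/funext => t; rewrite /heat2 -mulrA; congr (_ * _).
by rewrite mulrBl -exprVn expr2; congr (_ - _); ring.
Qed.

Lemma heat_ge0 tau y : 0 <= heat tau y.
Proof. exact: expR_ge0. Qed.

(** In terms of [u = y ^+ 2 / tau] and [1 / tau], every derivative is the kernel times a polynomial,
    odd powers of [y] being dominated by even ones. The exponential series gives [E * u <= 2] and
    [E * u ^+ 2 <= 8], and the factor [100] is slack. *)
Lemma heat_bounds (m : R) : 0 < m -> exists2 K : R, 0 < K & forall tau y, m <= tau ->
  [/\ `|heat tau y| <= K, `|heat1 tau y| <= K, `|heat2 tau y| <= K, `|heat3 tau y| <= K & `|heat4 tau y| <= K].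
Proof.
move=> m0; pose c := expR (- (ln m / 2)).
have c0 : 0 < c by exact: expR_gt0.
pose i := m^-1; have i0 : 0 < i by rewrite invr_gt0.
exists (c * (100 * (1 + i + i ^+ 2 + i ^+ 3))).
  by rewrite mulr_gt0// mulr_gt0// !addr_gt0// exprn_gt0.
move=> tau y mt; have t0 : 0 < tau by exact: lt_le_trans mt.
pose j := tau^-1; have j0 : 0 < j by rewrite invr_gt0.
have ji : j <= i by rewrite lef_pV2 ?posrE.
pose u := y ^+ 2 * j; have u0 : 0 <= u by rewrite mulr_ge0 ?sqr_ge0 ?ltW.
have hb : heat tau y <= c * expR (- (u / 2)).
  rewrite /heat /c -expRD ler_expR addrC lerD//.
    by rewrite lerN2 ler_pM2r ?invr_gt0// ler_ln.
  by rewrite lerN2 /u /j invfM mulrA mulrAC.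
pose E := expR (- (u / 2)); have E0 : 0 < E by exact: expR_gt0.
have EV : E * expR (u / 2) = 1 by rewrite /E mulrC expRxMexpNx_1.
have u20 : 0 <= u / 2 by rewrite divr_ge0.
have E1 : E <= 1 by rewrite /E -[leRHS]expR0 ler_expR oppr_le0.
have Eu : E * u <= 2.
  have := expR_ge1Dx (u / 2) => h; have : E * (1 + u / 2) <= 1 by rewrite -[leRHS]EV ler_pM2l.
  nra.
have Eu2 : E * u ^+ 2 <= 8.
  have := @expR_ge1Dxn R (u / 2) 1 u20; rewrite (_ : 2`! = 2)%N// => h.
  have : E * (1 + (u / 2) ^+ 2 / 2) <= 1 by rewrite -[leRHS]EV ler_pM2l.
  rewrite (_ : E * (1 + (u / 2) ^+ 2 / 2) = E + E * u ^+ 2 / 8); last by field.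
  lra.
have bnd (q B : R) : `|q| * E <= B -> `|heat tau y * q| <= c * B.
  move=> h; rewrite normrM (ger0_norm (heat_ge0 _ _)); apply: (@le_trans _ _ (c * E * `|q|)).
    by rewrite ler_wpM2r.
  by rewrite -mulrA ler_pM2l// mulrC.
have Ey : forall a, 0 <= a -> E * (u * a) <= 2 * a.
  by move=> a a0; rewrite mulrA ler_wpM2r.
have Ey2 : forall a, 0 <= a -> E * (u ^+ 2 * a) <= 8 * a.
  by move=> a a0; rewrite mulrA ler_wpM2r.
have Ec : forall a, 0 <= a -> E * a <= a.
  by move=> a a0; rewrite ler_piMl.
have j2 : j ^+ 2 <= i ^+ 2 by rewrite lerXn2r ?nnegrE ?(ltW j0) ?(ltW i0).
have j3 : j ^+ 3 <= i ^+ 3 by rewrite lerXn2r ?nnegrE ?(ltW j0) ?(ltW i0).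
have j20 : 0 <= j ^+ 2 by rewrite sqr_ge0.
have j30 : 0 <= j ^+ 3 by rewrite exprn_ge0 ?(ltW j0) ?(ltW i0).
have i20 : 0 <= i ^+ 2 by rewrite sqr_ge0.
have i30 : 0 <= i ^+ 3 by rewrite exprn_ge0 ?(ltW j0) ?(ltW i0).
have ny : `|y| <= 1 + y ^+ 2.
  rewrite -(real_normK (num_real y)); have := sqr_ge0 (`|y| - 1); have := normr_ge0 y; nra.
have ny3 : `|y| ^+ 3 <= y ^+ 2 + y ^+ 4.
  have -> : y ^+ 4 = (y ^+ 2) ^+ 2 by ring.
  rewrite -(real_normK (num_real y)) exprSr; have := ny; rewrite -(real_normK (num_real y)) => h.
  have := ler_wpM2l (sqr_ge0 `|y|) h; lra.
split.
- rewrite -[heat tau y]mulr1; apply: bnd; rewrite normr1 mul1r; lra.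
- apply: bnd; rewrite mulNr normrN normrM (gtr0_norm j0).
  apply: (@le_trans _ _ (E * (j + u))).
    rewrite mulrC ler_pM2l// /u -[X in _ <= X + _]mul1r -mulrDl.
    by rewrite ler_wpM2r// ltW.
  have := Ec j (ltW j0); lra.
- apply: bnd; rewrite mulrC.
  apply: (@le_trans _ _ (E * (u * j + j))).
    rewrite ler_pM2l// (le_trans (ler_normB _ _))// (gtr0_norm j0) lerD2r.
    by rewrite ger0_norm ?divr_ge0 ?sqr_ge0// /u -mulrA -expr2 exprVn.
  have := Ec j (ltW j0); have := Ey j (ltW j0); lra.
- apply: bnd; rewrite mulrC.
  apply: (@le_trans _ _ (E * (3 * (j ^+ 2 + u * j) + (u * j ^+ 2 + u ^+ 2 * j)))).
    rewrite ler_pM2l// (le_trans (ler_normB _ _))// lerD//.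
      rewrite normrM normfV normrM (ger0_norm (sqr_ge0 tau)) ger0_norm// -mulrA ler_pM2l//.
      rewrite -exprVn -/j (_ : _ + _ = (1 + y ^+ 2) * j ^+ 2); last by rewrite /u; ring.
      by rewrite ler_wpM2r.
    rewrite normrM normfV normrX normrX (gtr0_norm t0) -exprVn -/j.
    rewrite (_ : _ + _ = (y ^+ 2 + y ^+ 4) * j ^+ 3); last by rewrite /u; ring.
    by rewrite ler_wpM2r.
  have := Ec _ j20; have := Ey _ j20; have := Ey j (ltW j0); have := Ey2 j (ltW j0); lra.
- apply: bnd; rewrite mulrC.
  have -> : (y ^+ 2 / (2 * tau ^+ 2) - (2 * tau)^-1) ^+ 2 - y ^+ 2 / tau ^+ 3 + (2 * tau ^+ 2)^-1 =
     (u ^+ 2 / 4 - 3 * u / 2 + 3 / 4) * j ^+ 2 by rewrite /u /j; field; rewrite gt_eqF.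
  apply: (@le_trans _ _ (E * (u ^+ 2 * j ^+ 2 + 2 * (u * j ^+ 2) + j ^+ 2))).
    rewrite ler_pM2l// normrM (ger0_norm j20).
    rewrite [leRHS](_ : _ = (u ^+ 2 + 2 * u + 1) * j ^+ 2); last by ring.
    rewrite ler_wpM2r// ler_norml; apply/andP; split; have := sqr_ge0 u; lra.
  have := Ec _ j20; have := Ey _ j20; have := Ey2 _ j20; lra.
Qed.

End heat_kernel.

(** * Lindeberg replacement for martingale arrays *)

Section lindeberg.
Context {R : realType}.
Variables (a1 a2 x1 x2 : R).
Hypotheses (na1 : `|a1| <= 1) (na2 : `|a2| <= 1) (nx1 : `|x1| = 1) (nx2 : `|x2| = 1).
Implicit Types (s : seq (R * R)) (F G X : seq (R * R) -> R).
Local Notation Ex := (Ex a1 a2 x1 x2).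
Local Notation stp := (step a1 a2).

Lemma step_dist n F G c s : path_of n s ->
  (forall e1 e2, `|e1| = 1 -> `|e2| = 1 -> `|F (rcons s (e1, e2)) - G (rcons s (e1, e2))| <= c) ->
  `|stp F s - stp G s| <= c.
Proof.
move=> ps h; have [m1 m2] := mean_bound na1 na2 ps; move: m1 m2; rewrite !ler_norml => /andP[? ?] /andP[? ?].
have n1 : `|1 : R| = 1 by rewrite normr1.
have n1' : `|-1 : R| = 1 by rewrite normrN normr1.
have h' e1 e2 : `|e1| = 1 -> `|e2| = 1 -> - c <= F (rcons s (e1, e2)) - G (rcons s (e1, e2)) <= c.
  by move=> he1 he2; rewrite -ler_norml; exact: h.
have wc (q : R) : 0 <= q -> forall e1 e2, `|e1| = 1 -> `|e2| = 1 ->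
    - (q * c) <= q * F (rcons s (e1, e2)) - q * G (rcons s (e1, e2)) <= q * c.
  move=> q0 e1 e2 he1 he2; have /andP[k1 k2] := h' _ _ he1 he2.
  by rewrite -mulrBr -mulrN !ler_wpM2l.
have w1 := @wc ((1 + mean1 a1 s) / 2 * ((1 + mean2 a2 s) / 2)) ltac:(apply: mulr_ge0; lra) _ _ n1 n1.
have w2 := @wc ((1 + mean1 a1 s) / 2 * ((1 - mean2 a2 s) / 2)) ltac:(apply: mulr_ge0; lra) _ _ n1 n1'.
have w3 := @wc ((1 - mean1 a1 s) / 2 * ((1 + mean2 a2 s) / 2)) ltac:(apply: mulr_ge0; lra) _ _ n1' n1.
have w4 := @wc ((1 - mean1 a1 s) / 2 * ((1 - mean2 a2 s) / 2)) ltac:(apply: mulr_ge0; lra) _ _ n1' n1'.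
move: w1 w2 w3 w4 => /andP[? ?] /andP[? ?] /andP[? ?] /andP[? ?].
by rewrite /step; apply/andP; split; lra.
Qed.

(** Measures how far the conditional variances of the two signs are from [1]; this is the random
    part of the quadratic variation. *)
Definition mean_sqr s : R := mean1 a1 s ^+ 2 + mean2 a2 s ^+ 2.

Lemma mean_sqr_ge0 s : 0 <= mean_sqr s.
Proof. by rewrite addr_ge0 ?sqr_ge0. Qed.

Section one_row.
Variables (n : nat) (X : seq (R * R) -> R) (A B : nat -> R).
Hypothesis X_rcons : forall k s e1 e2, (1 <= k < n)%N -> path_of k s ->
  X (rcons s (e1, e2)) = X s + (A k * (e1 - mean1 a1 s) + B k * (e2 - mean2 a2 s)).
Let w k := A k ^+ 2 + B k ^+ 2.

Let w_ge0 k : 0 <= w k. Proof. by rewrite addr_ge0 ?sqr_ge0. Qed.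

Lemma Ex_sqr_le m : (1 <= m <= n)%N ->
  Ex m (fun s => X s ^+ 2) <= Ex 1 (fun s => X s ^+ 2) + \sum_(1 <= k < m) w k.
Proof.
elim: m => [//|m IH]; rewrite ltnS => /andP[_ mn].
case: m IH mn => [|m] IH mn; first by rewrite big_geq// addr0.
rewrite big_nat_recr//= addrA; apply: (@le_trans _ _ (Ex m.+1 (fun s => X s ^+ 2 + w m.+1))); last first.
  by rewrite ExD Ex_cst lerD2r; apply: IH; rewrite /= ltnW.
rewrite -[leLHS]/(Ex m.+1 (stp (fun s => X s ^+ 2))); apply: le_Ex => // s ps.
have [m1 m2] := mean_bound na1 na2 ps.
rewrite /step !(X_rcons _ _ _ ps)//.
rewrite (_ : _ + _ + _ + _ = X s ^+ 2 + (A m.+1 ^+ 2 * (1 - mean1 a1 s ^+ 2) + B m.+1 ^+ 2 * (1 - mean2 a2 s ^+ 2))); last by field.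
rewrite lerD2l /w lerD// ler_piMr ?sqr_ge0// gerBl sqr_ge0//.
Qed.

Variables (h2 K eps : R).
Hypotheses (h20 : 0 < h2) (K0 : 0 <= K) (eps0 : 0 <= eps).
Hypothesis heatK : forall tau y, h2 <= tau ->
  [/\ `|heat tau y| <= K, `|heat1 tau y| <= K, `|heat2 tau y| <= K, `|heat3 tau y| <= K & `|heat4 tau y| <= K].
Hypothesis AB_eps : forall k, (1 <= k < n)%N -> `|A k| <= eps /\ `|B k| <= eps.

(** Expanding to second order in space and first order in time, the heat equation matches the two
    main terms up to the deficit [mean_sqr]. The increment is at most [4 * eps] with square at most
    [8 * w k], whence [32 * eps]; the time remainder uses [w k <= 2 * eps ^+ 2]. *)
Lemma lindeberg_step k tau s : (1 <= k < n)%N -> path_of k s -> h2 <= tau ->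
  `|stp (heat tau \o X) s - heat (tau + w k) (X s)| <=
  w k * (K * mean_sqr s + (32 * eps + 2 * eps ^+ 2) * K).
Proof.
move=> kn ps ht; have [Ae Be] := AB_eps kn; have t0 : 0 < tau by exact: lt_le_trans ht.
have t1 : tau != 0 by rewrite gt_eqF.
have [m1 m2] := mean_bound na1 na2 ps.
pose y := X s.
pose Q t := heat tau y + (X t - y) * heat1 tau y + (X t - y) ^+ 2 / 2 * heat2 tau y.
have sq (x : R) : `|x| <= eps -> x ^+ 2 <= eps ^+ 2.
  by move=> hx; rewrite -real_normK ?num_real// lerXn2r ?nnegrE.
have w2 : w k <= 2 * eps ^+ 2 by have := sq _ Ae; have := sq _ Be; rewrite /w; lra.
have h1 : `|stp (heat tau \o X) s - stp Q s| <= 32 * eps * K * w k.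
  apply: (step_dist ps) => e1 e2 he1 he2 /=.
  have := @taylor2 _ (heat tau) (heat1 tau) (heat2 tau) (heat3 tau) K y (X (rcons s (e1, e2)))
    (fun x => is_derive_heat x t1) (fun x => is_derive_heat1 x t1) (fun x => is_derive_heat2 x t1).
  move=> /(_ (fun x => let: And5 _ _ _ h _ := heatK x ht in h)) => h.
  rewrite /Q !opprD !addrA; apply: (le_trans h).
  rewrite (X_rcons _ _ kn ps) -/y addrAC subrr add0r.
  have b1 : `|e1 - mean1 a1 s| <= 2 by rewrite (le_trans (ler_normB _ _))// he1; lra.
  have b2 : `|e2 - mean2 a2 s| <= 2 by rewrite (le_trans (ler_normB _ _))// he2; lra.
  have sq2 (x : R) : `|x| <= 2 -> x ^+ 2 <= 4.
    by move=> hx; rewrite -real_normK ?num_real// (_ : 4 = 2 ^+ 2 :> R) ?lerXn2r ?nnegrE//; ring.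
  have := sq2 _ b1; have := sq2 _ b2.
  move: (e1 - _) (e2 - _) b1 b2 => u v b1 b2 v4 u4.
  have d1 : `|A k * u + B k * v| <= 4 * eps.
    rewrite (le_trans (ler_normD _ _))// !normrM.
    have := ler_pM (normr_ge0 _) (normr_ge0 _) Ae b1; have := ler_pM (normr_ge0 _) (normr_ge0 _) Be b2; lra.
  have d2 : `|A k * u + B k * v| ^+ 2 <= 8 * w k.
    rewrite real_normK ?num_real// /w.
    have := sqr_ge0 (A k * u - B k * v).
    have := ler_wpM2l (sqr_ge0 (A k)) u4; have := ler_wpM2l (sqr_ge0 (B k)) v4.
    rewrite -!exprMn; nra.
  rewrite exprS (_ : 32 * eps * K * w k = K * (4 * eps * (8 * w k))); last by ring.
  by rewrite ler_wpM2l// ler_pM// exprn_ge0.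
have h1' : stp Q s = heat tau y + (w k - (A k ^+ 2 * mean1 a1 s ^+ 2 + B k ^+ 2 * mean2 a2 s ^+ 2)) * (heat2 tau y / 2).
  by rewrite /step /Q !(X_rcons _ _ kn ps) -/y /w; field.
have h3 : `|heat (tau + w k) y - heat tau y - w k * (heat2 tau y / 2)| <= K * w k ^+ 2.
  have tw : tau <= tau + w k by rewrite lerDl.
  have := @taylor1 _ (heat^~ y) (fun t => heat2 t y / 2) (fun t => heat4 t y) K _ _ tw.
  rewrite (addrAC tau) subrr add0r; apply.
  - by move=> x tx; apply: is_derive_heat_time; exact: lt_le_trans tx.
  - by move=> x tx; apply: is_derive_heat2_time; exact: lt_le_trans tx.
  - by move=> x tx; have [] := heatK y (le_trans ht tx).
have h4 : `|(A k ^+ 2 * mean1 a1 s ^+ 2 + B k ^+ 2 * mean2 a2 s ^+ 2) * (heat2 tau y / 2)| <= w k * mean_sqr s * K.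
  have q0 : 0 <= A k ^+ 2 * mean1 a1 s ^+ 2 + B k ^+ 2 * mean2 a2 s ^+ 2.
    by apply: addr_ge0; apply: mulr_ge0; exact: sqr_ge0.
  rewrite normrM (ger0_norm q0).
  have [_ _ hh _ _] := heatK y ht.
  have hh' : `|heat2 tau y / 2| <= K.
    by apply: le_trans hh; rewrite normrM ler_piMr// ger0_norm ?invr_ge0// invf_le1// ler1n.
  apply: ler_pM => //.
  rewrite /w /mean_sqr mulrDl !mulrDr.
  have := mulr_ge0 (sqr_ge0 (A k)) (sqr_ge0 (mean2 a2 s)); have := mulr_ge0 (sqr_ge0 (B k)) (sqr_ge0 (mean1 a1 s)); lra.
rewrite -/y.
have -> : stp (heat tau \o X) s - heat (tau + w k) y =
  (stp (heat tau \o X) s - stp Q s) - (heat (tau + w k) y - heat tau y - w k * (heat2 tau y / 2))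
  - (A k ^+ 2 * mean1 a1 s ^+ 2 + B k ^+ 2 * mean2 a2 s ^+ 2) * (heat2 tau y / 2).
  by rewrite h1'; field.
apply: (le_trans (ler_normB _ _)); apply: (@le_trans _ _ (32 * eps * K * w k + K * w k ^+ 2 + w k * mean_sqr s * K)).
  by apply: lerD => //; apply: (le_trans (ler_normB _ _)); exact: lerD.
have := ler_wpM2l (mulr_ge0 K0 (w_ge0 k)) w2; rewrite expr2; lra.
Qed.

(** The variance of the steps not yet taken is stored in the time parameter of the kernel, and each
    step moves its share from there to the martingale. *)
Lemma lindeberg : (1 <= n)%N ->
  `|Ex n (heat h2 \o X) - Ex 1 (heat (h2 + \sum_(1 <= k < n) w k) \o X)| <=
  \sum_(1 <= k < n) w k * (K * Ex k mean_sqr + (32 * eps + 2 * eps ^+ 2) * K).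
Proof.
move=> n1.
(* Induction on the number of steps counted back from [n], since the kernel at the end has the fixed
   parameter [h2]. *)
suff h m : (1 <= m <= n)%N -> 
   `|Ex n (heat h2 \o X) - Ex (n - m).+1 (heat (h2 + \sum_((n - m).+1 <= k < n) w k) \o X)| <=
   \sum_((n - m).+1 <= k < n) w k * (K * Ex k mean_sqr + (32 * eps + 2 * eps ^+ 2) * K).
  by have := h n; rewrite subnn; apply; rewrite n1 leqnn.
elim: m => [//|m IH] /andP[_ mn].
case: m IH mn => [|m] IH mn.
  by rewrite subn1 prednK// !big_geq// addr0 subrr normr0.
have := IH (ltnW mn); set p := (n - m.+2).+1.
have pE : ((n - m.+1).+1 = p.+1)%N by rewrite /p; lia.
have pn : (1 <= p < n)%N by rewrite /p; lia.
rewrite pE => {}IH; rewrite ![\sum_(p <= k < n) _]big_ltn; [|by case/andP: pn|by case/andP: pn].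
set S1 := \sum_(p.+1 <= k < n) w k in IH *; set S2 := \sum_(p.+1 <= k < n) _ in IH *.
have hS : 0 <= S1 by apply: sumr_ge0 => k _; exact: w_ge0.
have -> : Ex n (heat h2 \o X) - Ex p (heat (h2 + (w p + S1)) \o X) =
  (Ex n (heat h2 \o X) - Ex p.+1 (heat (h2 + S1) \o X)) +
  (Ex p.+1 (heat (h2 + S1) \o X) - Ex p (heat (h2 + (w p + S1)) \o X)) by ring.
apply: (le_trans (ler_normD _ _)); rewrite addrC lerD//.
rewrite -[Ex p.+1 _]/(Ex p (stp (heat (h2 + S1) \o X))) -ExB.
apply: (le_trans (ler_norm_Ex na1 na2 nx1 nx2 _ _)).
rewrite -[_ * K](Ex_cst a1 a2 x1 x2 p) -!ExZ -ExD -ExZ; apply: le_Ex => // s ps.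
rewrite (addrC (w p)) addrA /=; apply: lindeberg_step => //.
by rewrite lerDl.
Qed.

End one_row.

(** Besides the Lindeberg error, [err] accounts for the initial value of [X n] and for replacing the
    total variance by its limit [v]. The second-moment bound is the tightness used to pass to
    continuous test functions. *)
Theorem martingale_heat_limit (X : nat -> seq (R * R) -> R) (A B : nat -> nat -> R) (eps : nat -> R) (v : R) :
  (forall n k s e1 e2, (1 <= k < n)%N -> path_of k s ->
    X n (rcons s (e1, e2)) = X n s + (A n k * (e1 - mean1 a1 s) + B n k * (e2 - mean2 a2 s))) ->
  (forall n k, (1 <= k < n)%N -> `|A n k| <= eps n /\ `|B n k| <= eps n) ->
  (forall n s, (1 <= n)%N -> path_of 1 s -> `|X n s| <= eps n) ->
  eps n @[n --> \oo] --> 0 ->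
  \sum_(1 <= k < n) (A n k ^+ 2 + B n k ^+ 2) @[n --> \oo] --> v ->
  \sum_(1 <= k < n) (A n k ^+ 2 + B n k ^+ 2) * Ex k mean_sqr @[n --> \oo] --> 0 ->
  0 <= v ->
  (forall (h2 a : R), 0 < h2 -> Ex n (fun s => heat h2 (X n s - a)) @[n --> \oo] --> heat (h2 + v) (- a)) /\
  exists2 M : R, 0 < M & \forall n \near \oo, Ex n (fun s => X n s ^+ 2) <= M.
Proof.
move=> X_rcons AB X1 e0 wv wm v0.
pose W n := \sum_(1 <= k < n) (A n k ^+ 2 + B n k ^+ 2).
have W0 n : 0 <= W n by apply: sumr_ge0 => k _; rewrite addr_ge0 ?sqr_ge0.
have path1 : path_of 1 [:: (x1, x2); (x1, x2)] by rewrite /path_of /signs /= nx1 nx2 eqxx.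
have eps0 n : (1 <= n)%N -> 0 <= eps n by move=> n1; apply: le_trans (X1 n _ n1 path1).
split; last first.
  exists (v + 2); first by rewrite ltr_wpDl.
  have n1 : \forall n \near \oo, (1 <= n)%N by exists 1%N.
  have near1 : \forall n \near \oo, W n <= v + 1 by apply: (cvgr_le v wv); rewrite ltrDl.
  have near2 : \forall n \near \oo, eps n <= 1 by apply: (cvgr_le 0 e0).
  near=> n; have hn : (1 <= n)%N by near: n.
  apply: (le_trans (Ex_sqr_le (X_rcons n) (m := n) _)); first by rewrite hn leqnn.
  rewrite (_ : v + 2 = 1 + (v + 1)); last by ring.
  apply: lerD; last by near: n.
  rewrite -[leRHS](Ex_cst a1 a2 x1 x2 1); apply: le_Ex => // s ps.
  rewrite -real_normK ?num_real// expr_le1// (le_trans (X1 n s hn ps))//; by near: n.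
move=> h2 a h20; have [K K0 hK] := heat_bounds h20.
pose err n := W n * ((32 * eps n + 2 * eps n ^+ 2) * K) + K * \sum_(1 <= k < n) (A n k ^+ 2 + B n k ^+ 2) * Ex k mean_sqr
   + K * eps n + K * `|W n - v|.
have errc : err n @[n --> \oo] --> 0.
  have c1 : W n * ((32 * eps n + 2 * eps n ^+ 2) * K) @[n --> \oo] --> v * ((32 * 0 + 2 * 0 ^+ 2) * K).
    apply: cvgM => //; apply: cvgM; last exact: cvg_cst.
    by apply: cvgD; apply: cvgMr => //; rewrite expr2; apply: cvgM.
  have c2 : K * \sum_(1 <= k < n) (A n k ^+ 2 + B n k ^+ 2) * Ex k mean_sqr @[n --> \oo] --> K * 0.
    exact: cvgMr.
  have c3 : K * eps n @[n --> \oo] --> K * 0 by exact: cvgMr.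
  have c4 : K * `|W n - v| @[n --> \oo] --> K * `|v - v|.
    by apply: cvgMr; apply: cvg_norm; apply: cvgB => //; exact: cvg_cst.
  have := cvgD (cvgD (cvgD c1 c2) c3) c4.
  by rewrite subrr normr0 !(mulr0, expr0n, addr0, mul0r) /=; apply.
apply/cvgrPdist_le => e ee; have /cvgrPdist_le/(_ e ee)[N _ hN] := errc.
exists (maxn 1 N) => // n /=; rewrite geq_max => /andP[n1 Nn]; have := hN n Nn.
rewrite sub0r normrN => hn; apply: le_trans hn; apply: le_trans (ler_norm _).
have Xa k s e1 e2 : (1 <= k < n)%N -> path_of k s ->
    X n (rcons s (e1, e2)) - a = X n s - a + (A n k * (e1 - mean1 a1 s) + B n k * (e2 - mean2 a2 s)).
  by move=> kn ps; rewrite (X_rcons _ _ _ _ _ kn ps) addrAC.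
have := @lindeberg n (fun s => X n s - a) (A n) (B n) Xa h2 K (eps n) h20 (ltW K0) (eps0 n n1) hK (AB n) n1.
rewrite -/(W n) => L.
have D : `|Ex 1 (heat (h2 + W n) \o (fun s => X n s - a)) - heat (h2 + v) (- a)| <= K * eps n + K * `|W n - v|.
  rewrite -[heat (h2 + v) (- a)](Ex_cst a1 a2 x1 x2 1) -ExB.
  apply: (le_trans (ler_norm_Ex na1 na2 nx1 nx2 _ _)).
  rewrite -[leRHS](Ex_cst a1 a2 x1 x2 1); apply: le_Ex => // s ps /=.
  have -> : heat (h2 + W n) (X n s - a) - heat (h2 + v) (- a) =
    (heat (h2 + W n) (X n s - a) - heat (h2 + W n) (- a)) + (heat (h2 + W n) (- a) - heat (h2 + v) (- a)) by ring.
  apply: (le_trans (ler_normD _ _)); apply: lerD.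
    apply: (@le_trans _ _ (K * `|(X n s - a) - (- a)|)).
      apply: (mean_value_bound (f' := heat1 (h2 + W n))) => x _; split.
        by apply: is_derive_heat; rewrite gt_eqF// ltr_pwDl.
      by have [] := hK (h2 + W n) x; rewrite ?lerDl.
    by rewrite opprK subrK ler_wpM2l ?(ltW K0)// X1.
  have -> : W n - v = (h2 + W n) - (h2 + v) by ring.
  apply: (mean_value_bound (f := heat^~ (- a)) (f' := fun t => heat2 t (- a) / 2)) => x /andP[hx _].
  have hx' : h2 <= x by rewrite (le_trans _ hx)// le_min !lerDl v0 W0.
  split; first by apply: is_derive_heat_time; exact: lt_le_trans hx'.
  have [_ _ hh _ _] := hK x (- a) hx'; apply: le_trans hh.
  by rewrite normrM ler_piMr// ger0_norm ?invr_ge0// invf_le1// ler1n.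
rewrite distrC.
have -> : Ex n (fun s => heat h2 (X n s - a)) - heat (h2 + v) (- a) =
  (Ex n (heat h2 \o (fun s => X n s - a)) - Ex 1 (heat (h2 + W n) \o (fun s => X n s - a))) +
  (Ex 1 (heat (h2 + W n) \o (fun s => X n s - a)) - heat (h2 + v) (- a)).
  by rewrite [X in X - _ = _](_ : _ = Ex n (heat h2 \o (fun s => X n s - a)))//; ring.
apply: (le_trans (ler_normD _ _)); rewrite /err -[leRHS]addrA; apply: lerD => //.
apply: (le_trans L); apply/eq_ler.
rewrite /W mulr_suml mulr_sumr -big_split /=; apply: eq_bigr => k _; ring.
Unshelve. all: by end_near. Qed.

End lindeberg.

(** * From heat averages to convergence in distribution *)

Section real_integrals.
Context {d : measure_display} {T : measurableType d} {R : realType}.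
Variable mu : {measure set T -> \bar R}.
Implicit Types (f g p q : T -> R).

Let intg f := mu.-integrable setT (EFin \o f).

Lemma integrableD_fun f g : intg f -> intg g -> intg (fun x => f x + g x).
Proof. by move=> fi gi; apply: eq_integrable (integrableD measurableT fi gi). Qed.

Lemma integrableB_fun f g : intg f -> intg g -> intg (fun x => f x - g x).
Proof. by move=> fi gi; apply: eq_integrable (integrableB measurableT fi gi). Qed.

Lemma integrableZ_fun k f : intg f -> intg (fun x => k * f x).
Proof. by move=> fi; apply: eq_integrable (integrableZl measurableT k fi). Qed.

Lemma integrable_bounded_mul f p (M : R) : measurable_fun setT f -> (forall x, `|f x| <= M) ->
  intg p -> intg (fun x => f x * p x).
Proof.
move=> mf fM pi; have mp : measurable_fun setT p by apply/measurable_EFinP; exact: measurable_int pi.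
apply: (le_integrable measurableT _ _ (integrableZ_fun M pi)).
  by apply/measurable_EFinP; exact: measurable_funM.
move=> x _; rewrite /= lee_fin !normrM ler_wpM2r// (le_trans (fM x))//.
exact: ler_norm.
Qed.

(* Scheffe's lemma: [`|p n - q|] is twice the positive part of [q - p n], which [q]
   dominates, minus a function of integral zero. *)
Lemma scheffe (p : nat -> T -> R) q f (M : R) :
  (forall n, intg (p n)) -> (forall n x, 0 <= p n x) -> (forall n, \int[mu]_x p n x = 1) ->
  intg q -> (forall x, 0 <= q x) -> \int[mu]_x q x = 1 ->
  (forall x, p n x @[n --> \oo] --> q x) ->
  measurable_fun setT f -> (forall x, `|f x| <= M) ->
  (\int[mu]_x (f x * p n x)) @[n --> \oo] --> \int[mu]_x (f x * q x).
Proof.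
move=> ip p0 p1 iq q0 q1 pq mf fM.
pose g n x := Num.max (q x - p n x) 0.
have mm h : intg h -> measurable_fun setT h.
  by move=> ih; apply/measurable_EFinP; exact: measurable_int ih.
have mg n : measurable_fun setT (g n).
  apply: measurable_maxr; last exact: measurable_cst.
  by apply: measurable_funB; exact: mm.
have g0 n x : 0 <= g n x by rewrite le_max lexx orbT.
have gq n x : g n x <= q x by rewrite ge_max q0 gerBl p0.
have ig n : intg (g n).
  apply: (le_integrable measurableT _ _ iq); first by apply/measurable_EFinP; exact: mg.
  by move=> x _; rewrite /= lee_fin !ger0_norm.
have g_cvg : (\int[mu]_x g n x) @[n --> \oo] --> 0.
  have [||||_ _] := @dominated_convergence _ _ _ mu setT measurableT (fun n => EFin \o g n)
     (cst 0%E) (EFin \o q) (fun n => measurable_int _ (ig n)).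
  - exact: measurable_cst.
  - apply: nearW => x _; apply: cvg_EFin; first by apply: nearW.
    apply: (@squeeze_cvgr _ _ _ _ (fun=> 0) (fun n => `|q x - p n x|)).
    + by apply: nearW => n /=; rewrite g0 ge_max ler_norm normr_ge0.
    + exact: cvg_cst.
    + rewrite -[X in _ --> X](normr0 R) -(subrr (q x)); apply: cvg_norm; apply: cvgB => //; exact: cvg_cst.
  - exact: iq.
  - by apply: nearW => x n _ /=; rewrite lee_fin ger0_norm.
  by rewrite integral0 => /fine_cvg.
have M0 : 0 <= M by apply: le_trans (fM point).
have key n : `|\int[mu]_x (f x * p n x) - \int[mu]_x (f x * q x)| <= M * (2 * \int[mu]_x g n x).
  have ifp := integrable_bounded_mul mf fM (ip n); have ifq := integrable_bounded_mul mf fM iq.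
  rewrite -RintegralB//; apply: (le_trans (le_normr_Rintegral measurableT (integrableB_fun ifp ifq))).
  have i1 := integrableB_fun iq (ip n); have i2 := integrableZ_fun 2 (ig n).
  apply: (@le_trans _ _ (\int[mu]_x (M * (2 * g n x - (q x - p n x))))).
    apply: le_Rintegral => //; first exact: (integrable_norm (integrableB_fun ifp ifq)).
      by apply: integrableZ_fun; exact: integrableB_fun.
    move=> x _; rewrite -mulrBr normrM ler_pM// /g.
    have [h|h] := leP (q x - p n x) 0; first by rewrite mulr0 sub0r ger0_norm ?opprB// subr_ge0 -subr_le0.
    by rewrite ltr0_norm; lra.
  rewrite (RintegralZl _ measurableT (integrableB_fun i2 i1)) (RintegralB measurableT i2 i1).
  rewrite (RintegralZl _ measurableT (ig n)).
  by rewrite (RintegralB measurableT iq (ip n)) q1 p1 subrr subr0.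
apply/cvgrPdist_le => e e0.
have : M * (2 * (\int[mu]_x g n x)) @[n --> \oo] --> 0.
  rewrite -(mulr0 M) -[X in M * X](mulr0 2); apply: cvgMr; exact: cvgMr.
move=> /cvgrPdist_le/(_ e e0)[N _ hN]; exists N => // n /hN; rewrite sub0r normrN => h.
by rewrite distrC (le_trans (key n))// (le_trans (ler_norm _)).
Qed.

End real_integrals.

(** * Gaussian densities and integrals against the normal law *)

Section gaussian_smoothing.
Context {R : realType}.
Local Notation mu := (@lebesgue_measure R).
Implicit Types (f : R -> R) (s t m x y a h M e : R).

Lemma normal_pdf_heat t m a : 0 < t ->
  normal_pdf m (Num.sqrt t) a = (Num.sqrt (pi *+ 2))^-1 * heat t (m - a).
Proof.
move=> t0; have st : 0 < Num.sqrt t by rewrite sqrtr_gt0.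
rewrite normal_pdfE ?gt_eqF// /normal_peak /normal_fun sqr_sqrtr ?(ltW t0)//.
have -> : heat t (m - a) = (Num.sqrt t)^-1 * expR (- (a - m) ^+ 2 / (t *+ 2)).
  rewrite /heat expRD mulrC; congr (_ * _).
    rewrite expRN; congr (_^-1).
    by rewrite -powR12_sqrt ?(ltW t0)// /powR gt_eqF// mulrC.
  by congr expR; rewrite mulNr -sqrrN opprB mulr_natl.
by rewrite -mulrnAr sqrtrM ?(ltW t0)// invfM mulrA [_^-1 * _^-1]mulrC.
Qed.

Lemma integrable_pdf m s : mu.-integrable setT (EFin \o normal_pdf m s).
Proof. exact: integrable_normal_pdf. Qed.

Lemma Rintegral_pdf m s : \int[mu]_x normal_pdf m s x = 1.
Proof. by rewrite /Rintegral integral_normal_pdf. Qed.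

(** The Radon-Nikodym derivative of the normal law agrees almost everywhere with [normal_pdf],
    because both have the same integral on every measurable set. *)
Lemma integral_normal_prob_bounded (s : R) (f : measurableTypeR R -> R) M :
  measurable_fun [set: measurableTypeR R] f -> (forall x, `|f x| <= M) ->
  (\int[normal_prob 0 s]_x (f x)%:E = (\int[mu]_x (f x * normal_pdf 0 s x))%:E)%E.
Proof.
move=> mf fM; pose nu : probability (measurableTypeR R) R := normal_prob 0 s.
have dom : nu `<< mu by exact: normal_prob_dominates.
have fi : nu.-integrable setT (EFin \o f).
  apply: (le_integrable measurableT (g := cst M%:E)).
  - exact/measurable_EFinP.
  - by move=> x _; rewrite /= lee_fin (le_trans (fM x))// ler_norm.
  - apply/integrableP; split; first exact: measurable_cst.
    by rewrite integral_cst// [X in (_ * X)%E]probability_setT mule1 ltry.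
have ifp := integrable_bounded_mul mf fM (integrable_pdf 0 s).
rewrite -[LHS](Radon_Nikodym_change_of_variables dom measurableT fi).
rewrite /Rintegral fineK; last first.
  exact: integrable_fin_num.
apply: ae_eq_integral => //.
- apply: emeasurable_funM; first exact/measurable_EFinP.
  by apply: (measurable_int mu); exact: Radon_Nikodym_integrable.
- exact: measurable_int ifp.
rewrite (_ : (fun x => (f x * normal_pdf 0 s x)%:E) = (fun x => (f x)%:E * (normal_pdf 0 s x)%:E)%E)//.
apply: ae_eqe_mul2l; apply: integral_ae_eq => //.
- exact: Radon_Nikodym_integrable.
- by apply/measurable_EFinP; exact: measurable_normal_pdf.
- by move=> A _ mA; rewrite -Radon_Nikodym_integral.
Qed.

End gaussian_smoothing.

(** * Removing the Gaussian smoothing *)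

Section weak_limit.
Context {R : realType}.
Local Notation mu := (@lebesgue_measure R).
Implicit Types (s : seq (R * R)) (x y a h M e : R).

Let intg (f : measurableTypeR R -> R) := mu.-integrable [set: measurableTypeR R] (EFin \o f).

(** [Ex] is a finite linear combination, so this exchange is plain linearity of the integral rather
    than Fubini's theorem. *)
Lemma Rintegral_Ex (a1 a2 x1 x2 : R) n (phi : seq (R * R) -> measurableTypeR R -> R) :
  (forall s, intg (phi s)) -> intg (fun a => Ex a1 a2 x1 x2 n (phi^~ a)) /\
  \int[mu]_a Ex a1 a2 x1 x2 n (phi^~ a) = Ex a1 a2 x1 x2 n (fun s => \int[mu]_a phi s a).
Proof.
elim: n phi => [|n IH] phi hphi //=.
have i2 (c : R) (f : measurableTypeR R -> R) : intg f -> intg (fun a => c * f a) by exact: integrableZ_fun.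
have iD (f g : measurableTypeR R -> R) : intg f -> intg g -> intg (fun a => f a + g a) by exact: integrableD_fun.
have istep s : intg (fun a => step a1 a2 (phi^~ a) s).
  have z c u := i2 c _ (hphi u).
  exact: (iD _ _ (iD _ _ (iD _ _ (z _ _) (z _ _)) (z _ _)) (z _ _)).
have [h1 h2] := IH (fun s a => step a1 a2 (phi^~ a) s) istep; split => //.
rewrite h2; apply: eq_Ex => s; rewrite /step.
have z c u := i2 c _ (hphi u).
rewrite (RintegralD measurableT (iD _ _ (iD _ _ (z _ _) (z _ _)) (z _ _)) (z _ _)).
rewrite (RintegralD measurableT (iD _ _ (z _ _) (z _ _)) (z _ _)).
rewrite (RintegralD measurableT (z _ _) (z _ _)).
by rewrite !(RintegralZl _ measurableT (hphi _)).
Qed.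

(** Only [x] is confined to the compact interval while [y] may leave it, which is the form required
    when smoothing at a point near the boundary. *)
Lemma uniformly_continuous_on (f : R -> R) A e : continuous f -> 0 < e ->
  exists2 dl : R, 0 < dl & forall x y, `|x| <= A -> `|y - x| <= dl -> `|f y - f x| <= e.
Proof.
move=> cf e0.
have := @segment_compact R (- A) A => /compact_near_coveringP.
move=> /(_ R (0^'+) (fun dl x => forall y, `|y - x| <= dl -> `|f y - f x| <= e) _)[].
  move=> x _; have e2 : 0 < e / 2 by rewrite divr_gt0.
  have /cvgrPdist_le/(_ _ e2) := cf x; rewrite near_nbhs => /nbhs_ballP[r /= r0 hr].
  exists (ball x (r / 2), [set dl | dl < r / 2]).
    split; first by apply: nbhsx_ballx; rewrite divr_gt0.
    by apply: nbhs_right_lt; rewrite divr_gt0.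
  move=> [x' dl] /= [hx' hdl] y hy.
  have k1 : `|f x - f x'| <= e / 2.
    by apply: hr; move: hx'; rewrite /ball /= => hx'; rewrite (lt_trans hx')// ltr_pdivrMr// ltr_pMr// ltr1n.
  have k2 : `|f x - f y| <= e / 2.
    apply: hr; rewrite /ball /= (_ : x - y = (x - x') - (y - x')); last by ring.
    rewrite (le_lt_trans (ler_normB _ _))// [ltRHS](splitr r) ltrD// (le_lt_trans hy)//.
  rewrite (_ : f y - f x' = (f x - f x') - (f x - f y)); last by ring.
  by rewrite (le_trans (ler_normB _ _))// [leRHS](splitr e) lerD.
move=> dl /= dl0 hdl; have dl2 : 0 < dl / 2 by rewrite divr_gt0.
exists (dl / 2) => // x y xA hy; apply: (hdl (dl / 2)) => //=.
- by rewrite sub0r normrN gtr0_norm// ltr_pdivrMr// ltr_pMr// ltr1n.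
- by rewrite in_itv /= -ler_norml.
Qed.

(** At distance at least [dl] from [x], moving the center by [dl] towards [a] lowers the squared
    distance by at least [dl ^+ 2]. The tail is thus dominated by densities of total mass one, with
    no estimate of the error function. *)
Lemma normal_pdf_tail h x a dl : 0 < h -> 0 < dl -> dl <= `|a - x| ->
  normal_pdf x h a <= expR (- (dl ^+ 2 / (h ^+ 2 *+ 2))) * (normal_pdf (x + dl) h a + normal_pdf (x - dl) h a).
Proof.
move=> h0 dl0; have h1 : h != 0 by rewrite gt_eqF.
have p0 := normal_peak_ge0 h.
have hh : 0 < h ^+ 2 *+ 2 by rewrite mulrn_wgt0// exprn_gt0.
have key y : y ^+ 2 + dl ^+ 2 <= (a - x) ^+ 2 ->
    normal_fun x h a <= expR (- (dl ^+ 2 / (h ^+ 2 *+ 2))) * expR (- y ^+ 2 / (h ^+ 2 *+ 2)).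
  move=> hy; rewrite /normal_fun -expRD ler_expR mulNr mulNr -opprD lerN2 -mulrDl.
  by rewrite ler_pM2r ?invr_gt0// addrC.
have n0 y := normal_pdf_ge0 y h a.
rewrite ler_normr => /orP[hd|hd]; rewrite mulrDr.
  apply: ler_wpDr; first by rewrite mulr_ge0// expR_ge0.
  rewrite !normal_pdfE// mulrCA ler_wpM2l//; apply: key.
  have : 0 <= dl * (a - x - dl) by (rewrite mulr_ge0 ?(ltW dl0)// subr_ge0).
  by nra.
apply: ler_wpDl; first by rewrite mulr_ge0// expR_ge0.
rewrite !normal_pdfE// mulrCA ler_wpM2l//; apply: key.
have : 0 <= dl * (- (a - x) - dl) by (rewrite mulr_ge0 ?(ltW dl0)// subr_ge0).
by nra.
Qed.

(** Away from [x] the oscillation of [f] is at most [2 * M], and the two shifted Gaussians of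
    [normal_pdf_tail] have total mass [2]; hence [4 * M]. *)
Lemma smoothing_close (f : R -> R) M e x h dl : measurable_fun [set: measurableTypeR R] f ->
  (forall x, `|f x| <= M) -> 0 < h -> 0 < dl -> 0 <= e ->
  (forall y, `|y - x| <= dl -> `|f y - f x| <= e) ->
  `|\int[mu]_a (f a * normal_pdf x h a) - f x| <=
    e + 4 * M * expR (- (dl ^+ 2 / (h ^+ 2 *+ 2))).
Proof.
move=> mf fM h0 dl0 e0 hf; set c := expR _.
have M0 : 0 <= M by exact: le_trans (fM 0).
have ip y := integrable_pdf y h.
have iff := integrable_bounded_mul mf fM (ip x).
have ifx : intg (fun a => f x * normal_pdf x h a) by exact: integrableZ_fun.
have -> : f x = \int[mu]_a (f x * normal_pdf x h a) by rewrite RintegralZl// Rintegral_pdf mulr1.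
rewrite -RintegralB//; have iB : intg (fun a => f a * normal_pdf x h a - f x * normal_pdf x h a).
  exact: integrableB_fun.
apply: (le_trans (le_normr_Rintegral measurableT iB)).
have iT : intg (fun a => normal_pdf (x + dl) h a + normal_pdf (x - dl) h a) by exact: integrableD_fun.
have i1 : intg (fun a => e * normal_pdf x h a) by exact: integrableZ_fun.
have i2 : intg (fun a => (2 * M * c) * (normal_pdf (x + dl) h a + normal_pdf (x - dl) h a)) by exact: integrableZ_fun.
apply: (@le_trans _ _ (\int[mu]_a (e * normal_pdf x h a + (2 * M * c) * (normal_pdf (x + dl) h a + normal_pdf (x - dl) h a)))).
  apply: le_Rintegral => //; [exact: integrable_norm|exact: integrableD_fun|].
  move=> a _; rewrite -mulrBl normrM (ger0_norm (normal_pdf_ge0 _ _ _)).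
  have s0 : 0 <= normal_pdf (x + dl) h a + normal_pdf (x - dl) h a by rewrite addr_ge0 ?normal_pdf_ge0.
  have c0 : 0 <= 2 * M * c by rewrite !mulr_ge0// expR_ge0.
  have [ha|ha] := leP `|a - x| dl.
    by apply: ler_wpDr; [exact: mulr_ge0|rewrite ler_wpM2r ?normal_pdf_ge0 ?hf].
  apply: ler_wpDl; first by rewrite mulr_ge0 ?normal_pdf_ge0.
  rewrite -[leRHS]mulrA; apply: ler_pM => //; first exact: normal_pdf_ge0.
    by rewrite (le_trans (ler_normB _ _))// mulr_natl mulr2n lerD.
  exact: normal_pdf_tail (ltW ha).
rewrite (RintegralD measurableT i1 i2) (RintegralZl _ measurableT (ip x)) (RintegralZl _ measurableT iT).
rewrite (RintegralD measurableT (ip _) (ip _)) !Rintegral_pdf mulr1 lerD2l.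
by apply/eq_ler; ring.
Qed.

(** Read as a function of [a], the hypothesis is pointwise convergence of the densities of [X n]
    plus an independent Gaussian, so Scheffe's lemma applies for each width [h]. The width is then
    fixed small, uniformly in [n]. *)
Theorem weak_limit_of_heat (a1 a2 x1 x2 v : R) (X : nat -> seq (R * R) -> R) (f : R -> R) M :
  `|a1| <= 1 -> `|a2| <= 1 -> `|x1| = 1 -> `|x2| = 1 -> 0 < v ->
  (forall (h2 a : R), 0 < h2 ->
     Ex a1 a2 x1 x2 n (fun s => heat h2 (X n s - a)) @[n --> \oo] --> heat (h2 + v) (- a)) ->
  (exists2 M2 : R, 0 < M2 & \forall n \near \oo, Ex a1 a2 x1 x2 n (fun s => X n s ^+ 2) <= M2) ->
  continuous f -> (forall x, `|f x| <= M) ->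
  (Ex a1 a2 x1 x2 n (fun s => f (X n s))) @[n --> \oo] -->
    \int[mu]_a (f a * normal_pdf 0 (Num.sqrt v) a).
Proof.
move=> na1 na2 nx1 nx2 v0 hheat [M2 M20 hM2] cf fM.
have M0 : 0 <= M by exact: le_trans (fM 0).
have mf : measurable_fun [set: measurableTypeR R] f by exact: continuous_measurable_fun.
pose q h := \int[mu]_a (f a * normal_pdf 0 (Num.sqrt (h ^+ 2 + v)) a).
pose sm h x := \int[mu]_a (f a * normal_pdf x h a).
set L := \int[mu]_a _.
have c00 : 0 <= (Num.sqrt (pi *+ 2))^-1 :> R by rewrite invr_ge0 sqrtr_ge0.
have smooth_cvg h : 0 < h -> (Ex a1 a2 x1 x2 n (fun s => sm h (X n s))) @[n --> \oo] --> q h.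
  move=> h0; pose p n (a : measurableTypeR R) := Ex a1 a2 x1 x2 n (fun s => normal_pdf (X n s) h a).
  have sh : Num.sqrt (h ^+ 2) = h by rewrite sqrtr_sqr gtr0_norm.
  have h20 : 0 < h ^+ 2 by rewrite exprn_gt0.
  have hp n := @Rintegral_Ex a1 a2 x1 x2 n (fun s a => normal_pdf (X n s) h a) (fun s => integrable_pdf _ _).
  have p1 n : \int[mu]_a p n a = 1.
    have [_ ->] := hp n; rewrite -[RHS](Ex_cst a1 a2 x1 x2 n); apply: eq_Ex => s.
    exact: Rintegral_pdf.
  have p0 n a : 0 <= p n a by apply: Ex_ge0 => // s _; exact: normal_pdf_ge0.
  have pcvg a : p n a @[n --> \oo] --> normal_pdf 0 (Num.sqrt (h ^+ 2 + v)) a.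
    rewrite normal_pdf_heat ?addr_gt0// sub0r.
    have -> : (fun n => p n a) = (fun n => (Num.sqrt (pi *+ 2))^-1 * Ex a1 a2 x1 x2 n (fun s => heat (h ^+ 2) (X n s - a))).
      apply/funext => n; rewrite /p -ExZ; apply: eq_Ex => s.
      by rewrite -[in LHS]sh normal_pdf_heat.
    by apply: cvgMr; exact: hheat.
  have := @scheffe _ _ _ mu p (normal_pdf 0 (Num.sqrt (h ^+ 2 + v))) f M (fun n => (hp n).1) p0 p1
    (integrable_pdf _ _) (normal_pdf_ge0 _ _) (Rintegral_pdf _ _) pcvg mf fM.
  have -> // : (fun n => \int[mu]_a (f a * p n a)) = (fun n => Ex a1 a2 x1 x2 n (fun s => sm h (X n s))).
  apply/funext => n.
  have [_ <-] := @Rintegral_Ex a1 a2 x1 x2 n (fun s a => f a * normal_pdf (X n s) h a)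
    (fun s => integrable_bounded_mul mf fM (integrable_pdf _ _)).
  by apply: eq_Rintegral => a _; rewrite /p -ExZ.
(* Scheffe's lemma again, now for the Gaussian densities of variance [h ^+ 2 + v] as [h] tends to
   zero. *)
have q_cvg : q j.+1%:R^-1 @[j --> \oo] --> L.
  have [K K0 hK] := heat_bounds v0.
  apply: (scheffe (mu := mu) (M := M)) => //.
  - by move=> j; exact: integrable_pdf.
  - by move=> j a; exact: normal_pdf_ge0.
  - by move=> j; exact: Rintegral_pdf.
  - exact: integrable_pdf.
  - by move=> a; exact: normal_pdf_ge0.
  - exact: Rintegral_pdf.
  move=> a; rewrite normal_pdf_heat// sub0r.
  have -> : (fun j => normal_pdf 0 (Num.sqrt (j.+1%:R^-1 ^+ 2 + v)) a) =
      (fun j => (Num.sqrt (pi *+ 2))^-1 * heat (j.+1%:R^-1 ^+ 2 + v) (- a)).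
    by apply/funext => j; rewrite normal_pdf_heat ?sub0r// ltr_wpDl// sqr_ge0.
  apply: cvgMr; apply/cvgrPdist_le => e e0.
  have : K * (j.+1%:R^-1 * j.+1%:R^-1) @[j --> \oo] --> (0 : R).
    by rewrite -(mulr0 K) -[X in K * X](mulr0 0); apply: cvgMr; apply: cvgM; exact: cvg_harmonic.
  move=> /cvgrPdist_le/(_ e e0)[N _ hN]; exists N => // j /hN; rewrite sub0r normrN => hj.
  rewrite distrC; apply: le_trans (le_trans (ler_norm _) hj).
  rewrite -expr2 [_ ^+ 2 in leRHS](_ : _ = `|(j.+1%:R^-1 ^+ 2 + v) - v|); last by rewrite addrK ger0_norm// sqr_ge0.
  apply: (mean_value_bound (f := heat^~ (- a)) (f' := fun t => heat2 t (- a) / 2)) => x /andP[hx _].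
  have hx' : v <= x by rewrite (le_trans _ hx)// le_min lexx lerDr sqr_ge0.
  split; first by apply: is_derive_heat_time; exact: lt_le_trans hx'.
  have [_ _ hh _ _] := hK x (- a) hx'; apply: le_trans hh.
  by rewrite normrM ler_piMr// ger0_norm ?invr_ge0// invf_le1// ler1n.
apply/cvgrPdist_le => e e0.
pose e5 := e / 5; have e50 : 0 < e5 by rewrite divr_gt0.
(* Chebyshev truncation level: beyond [A], the crude bound [2 * M] is absorbed by
   [2 * M / A ^+ 2 * x ^+ 2], whose mean is at most [e5]. *)
pose A := 1 + 2 * M * M2 / e5.
have A1 : 1 <= A by rewrite lerDl divr_ge0 ?(ltW e50)// mulr_ge0 ?(ltW M20)// mulr_ge0.
have A0 : 0 < A by exact: lt_le_trans A1.
have AM : 2 * M * M2 / A ^+ 2 <= e5.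
  rewrite ler_pdivrMr ?exprn_gt0// [leRHS]mulrC -ler_pdivrMr//.
  apply: (@le_trans _ _ A); first by rewrite /A lerDr.
  by rewrite expr2 ler_peMl// ltW.
have [dl dl0 hdl] := uniformly_continuous_on A cf e50.
(* By [expR (- y) <= y^-1], the Gaussian tail factor is at most [2 * h ^+ 2 / dl ^+ 2]. *)
have tail_cvg : 4 * M * (2 / dl ^+ 2 * (j.+1%:R^-1 * j.+1%:R^-1)) @[j --> \oo] --> (0 : R).
  rewrite [X in _ --> X](_ : _ = 4 * M * (2 / dl ^+ 2 * (0 * 0))); last by rewrite !mulr0.
  by apply: cvgMr; apply: cvgMr; apply: cvgM; exact: cvg_harmonic.
have /cvgrPdist_le/(_ _ e50)[J1 _ hJ1] := tail_cvg.
have /cvgrPdist_le/(_ _ e50)[J2 _ hJ2] := q_cvg.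
pose j := maxn J1 J2; pose h : R := j.+1%:R^-1.
have h0 : 0 < h by rewrite invr_gt0.
have tl : 4 * M * expR (- (dl ^+ 2 / (h ^+ 2 *+ 2))) <= e5.
  have := hJ1 j (leq_maxl _ _); rewrite /= sub0r normrN => hj.
  apply: le_trans (le_trans (ler_norm _) hj); apply: ler_wpM2l; first by rewrite mulr_ge0.
  have y0 : 0 < dl ^+ 2 / (h ^+ 2 *+ 2) by rewrite divr_gt0 ?exprn_gt0// mulrn_wgt0// exprn_gt0.
  rewrite expRN (_ : 2 / dl ^+ 2 * _ = (dl ^+ 2 / (h ^+ 2 *+ 2))^-1); last first.
    by rewrite -/h invf_div -mulr_natl expr2; ring.
  by rewrite lef_pV2 ?posrE ?expR_gt0// (le_trans _ (expR_ge1Dx _))// lerDr.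
have ql : `|q h - L| <= e5 by rewrite distrC; exact: (hJ2 j (leq_maxr _ _)).
have /cvgrPdist_le/(_ _ e50)[N1 _ hN1] := smooth_cvg h h0.
case: hM2 => N2 _ hN2; exists (maxn N1 N2) => // n /=; rewrite geq_max => /andP[/hN1 k1 /hN2 k2].
have close x : `|sm h x - f x| <= 2 * e5 + 2 * M / A ^+ 2 * x ^+ 2.
  have r0 : 0 <= 2 * M / A ^+ 2 * x ^+ 2 by rewrite mulr_ge0 ?sqr_ge0// divr_ge0 ?sqr_ge0// mulr_ge0.
  have [xA|xA] := leP `|x| A.
    apply: (le_trans (smoothing_close mf fM h0 dl0 (ltW e50) (fun y => hdl x y xA))); lra.
  have M20' : 0 <= 2 * M by rewrite mulr_ge0.
  have fd y : `|y - x| <= dl -> `|f y - f x| <= 2 * M.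
    by move=> _; rewrite (le_trans (ler_normB _ _))// mulr_natl mulr2n lerD.
  apply: (le_trans (smoothing_close mf fM h0 dl0 M20' fd)).
  have : 2 * M <= 2 * M / A ^+ 2 * x ^+ 2.
    rewrite -mulrA ler_peMr// mulrC ler_pdivlMr ?exprn_gt0// mul1r -(real_normK (num_real x)).
    by rewrite lerXn2r ?nnegrE// ltW.
  lra.
have k3 : `|Ex a1 a2 x1 x2 n (fun s => sm h (X n s)) - Ex a1 a2 x1 x2 n (fun s => f (X n s))| <= 3 * e5.
  rewrite -ExB; apply: (le_trans (ler_norm_Ex na1 na2 nx1 nx2 _ _)).
  apply: (@le_trans _ _ (Ex a1 a2 x1 x2 n (fun s => 2 * e5 + 2 * M / A ^+ 2 * X n s ^+ 2))).
    by apply: le_Ex => // s _; exact: close.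
  rewrite ExD Ex_cst ExZ.
  have : 2 * M / A ^+ 2 * Ex a1 a2 x1 x2 n (fun s => X n s ^+ 2) <= 2 * M / A ^+ 2 * M2.
    by apply: ler_wpM2l k2; rewrite divr_ge0 ?sqr_ge0// mulr_ge0.
  have -> : 2 * M / A ^+ 2 * M2 = 2 * M * M2 / A ^+ 2 by rewrite mulrAC.
  lra.
have -> : L - Ex a1 a2 x1 x2 n (fun s => f (X n s)) =
  (q h - Ex a1 a2 x1 x2 n (fun s => sm h (X n s))) +
  (Ex a1 a2 x1 x2 n (fun s => sm h (X n s)) - Ex a1 a2 x1 x2 n (fun s => f (X n s))) - (q h - L) by ring.
apply: (le_trans (ler_normB _ _)); apply: (le_trans (lerD (ler_normD _ _) (lexx _))).
have : e = e5 + 3 * e5 + e5 by rewrite /e5; field.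
lra.
Qed.

End weak_limit.

(** * The two elephants *)

Section elephant_scheme.
Context {R : realType}.
Variables (a1 a2 x1 x2 r theta : R).
Hypotheses (na1 : `|a1| <= 1) (na2 : `|a2| <= 1) (nx1 : `|x1| = 1) (nx2 : `|x2| = 1).
Hypotheses (r_gt0 : 0 < r) (r_half : r <= 2^-1) (a1E : a1 = r * theta) (a2E : theta * a2 = r).
Implicit Types (s : seq (R * R)) (eta : nat -> R).
Local Notation Ex := (Ex a1 a2 x1 x2).

Let nr : `|r| <= 1. Proof. by rewrite gtr0_norm//; have := r_half; lra. Qed.
Let nNr : `|- r| <= 1. Proof. by rewrite normrN. Qed.
Let a1N : a1 = - r * - theta. Proof. by rewrite mulrNN. Qed.
Let a2N : - theta * a2 = - r. Proof. by rewrite mulNr a2E. Qed.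

Let theta_neq0 : theta != 0.
Proof. by apply: contraTneq r_gt0 => t0; rewrite -a2E t0 mul0r ltxx. Qed.

(** Uniform in the starting time [k]: this is what makes all coefficients of the array small at once
    after division by the scale. *)
Lemma growth_ratio (rho : R) : `|rho| = r -> exists2 D : R, 0 < D &
  forall k N, (1 <= k <= N)%N -> growth rho N / growth rho k <= D * N%:R `^ r.
Proof.
move=> rhor; have nrho : `|rho| <= 1 by rewrite rhor -(gtr0_norm r_gt0).
have [c [C [c0 C0 h]]] := growth_bounds nrho.
exists (C / c); first by rewrite divr_gt0.
move=> k N /andP[k1 kN]; have N1 := leq_trans k1 kN.
have /andP[_ h1] := h N N1; have /andP[h2 _] := h k k1.
have k0 : (0 : R) < k%:R by rewrite ltr0n.
have N0 : (0 : R) < N%:R by rewrite ltr0n.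
have kp : (0 : R) < k%:R `^ rho by rewrite powR_gt0.
rewrite ler_pdivrMr ?growth_gt0//; apply: (le_trans h1).
apply: (@le_trans _ _ (C / c * N%:R `^ r * (c * k%:R `^ rho))); last first.
  by rewrite ler_wpM2l// mulr_ge0 ?powR_ge0// divr_ge0 ?ltW.
rewrite (_ : C / c * N%:R `^ r * (c * k%:R `^ rho) = C * (N%:R `^ r * k%:R `^ rho)); last first.
  by field; rewrite gt_eqF.
rewrite ler_pM2l//; have [p0|p0] := leP 0 rho.
  rewrite -rhor ger0_norm// ler_peMr ?powR_ge0//.
  by rewrite -[leLHS](powRr0 k%:R) ler_powR// ler1n.
have e (x : R) : x `^ rho = (x `^ (- rho))^-1 by rewrite -powRN opprK.
have k_le : k%:R `^ (- rho) <= N%:R `^ (- rho) :> R.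
  by rewrite ge0_ler_powR ?nnegrE ?oppr_ge0 ?(ltW p0)// ler_nat.
rewrite !e -rhor ltr0_norm//; apply: (@le_trans _ _ 1).
  rewrite invf_le1 ?powR_gt0// -[leLHS](powRr0 N%:R) ler_powR ?ler1n// oppr_ge0 ltW//.
by rewrite ler_pdivlMr ?powR_gt0// mul1r.
Qed.

(** The factor [1 + ln] covers the subcritical and critical regimes together; the loss is harmless
    after division by the square of the length. *)
Lemma Ex_lin_sqr (rho th : R) : `|rho| <= 1 -> rho <= 2^-1 -> a1 = rho * th -> th * a2 = rho ->
  exists2 C : R, 0 < C & forall n, (1 <= n)%N ->
    Ex n (fun s => lin th s ^+ 2) <= C * (n.+1%:R * (1 + ln n.+1%:R)).
Proof.
move=> nrho rho2 h1 h2.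
have [C2 C20 hg] := growth_le_sqrt nrho rho2.
have [C1 C10 hq] : exists2 C : R, 0 < C &
    forall N, (2 <= N)%N -> growth rho N ^+ 2 * qvar rho N <= C * (N%:R * (1 + ln N%:R)).
  move: rho2; rewrite le_eqVlt => /predU1P[rE|rlt].
    have [C C0 h] := qvar_critical nrho rE; exists C => // N N2; apply: (le_trans (h N N2)).
    by rewrite ler_pM2l// ler_wpM2l// lerDr.
  have [C C0 h] := qvar_subcritical nrho rlt; exists C => // N N2; apply: (le_trans (h N (ltnW N2))).
  by rewrite ler_pM2l// ler_peMr// lerDl ln_ge0// ler1n ltnW.
pose c := (2 * (1 + `|th|)) ^+ 2.
have c0 : 0 <= c by exact: sqr_ge0.
exists (c * C2 ^+ 2 + (1 + th ^+ 2) * C1).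
  apply: ltr_wpDl; first by rewrite mulr_ge0 ?sqr_ge0.
  by rewrite mulr_gt0// ltr_pwDl// sqr_ge0.
move=> n n1; have L0 : 0 <= ln (n.+1%:R : R) by rewrite ln_ge0// ler1n.
have g0 := growth_gt0 n.+1 nrho.
have -> : Ex n (fun s => lin th s ^+ 2) = growth rho n.+1 ^+ 2 * Ex n (fun s => (mart rho th s - 0) ^+ 2).
  rewrite -ExZ; apply: eq_Ex_path => // s /path_size sn.
  by rewrite subr0 -exprMn /mart sn mulrCA mulfV ?mulr1// gt_eqF.
have E1 : Ex 1 (fun s => (mart rho th s - 0) ^+ 2) <= c.
  rewrite -[leRHS](Ex_cst a1 a2 x1 x2 1); apply: le_Ex => // s ps.
  have := mart_bound th nrho ps; rewrite [growth _ _]/growth big_geq// divr1 => h.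
  by rewrite subr0 /c -(real_normK (num_real (mart _ _ _))) lerXn2r ?nnegrE// mulr_ge0// addr_ge0.
have := Ex_mart_sqr_le na1 na2 nx1 nx2 nrho h1 h2 0 n1 => hE.
apply: (le_trans (ler_wpM2l (sqr_ge0 _) hE)); rewrite [leLHS]mulrDr [leRHS]mulrDl; apply: lerD.
  apply: (@le_trans _ _ (growth rho n.+1 ^+ 2 * c)); first by rewrite ler_wpM2l ?sqr_ge0.
  rewrite mulrC -[leRHS]mulrA ler_wpM2l//.
  have := hg n.+1 isT => hgn; apply: (@le_trans _ _ ((C2 * Num.sqrt n.+1%:R) ^+ 2)).
    by rewrite lerXn2r ?nnegrE ?(ltW g0)// mulr_ge0 ?sqrtr_ge0// ltW.
  by rewrite exprMn sqr_sqrtr// ler_wpM2l ?sqr_ge0// ler_peMr// lerDl.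
rewrite mulrCA -[leRHS]mulrA ler_wpM2l ?addr_ge0 ?sqr_ge0//; exact: hq.
Qed.

Lemma sum1_lin s : sum1 s = (lin theta s + lin (- theta) s) / 2.
Proof. by rewrite /lin; field. Qed.

Lemma sum2_lin s : sum2 s = (lin theta s - lin (- theta) s) / (2 * theta).
Proof. by rewrite /lin; field. Qed.

(** A law of large numbers in mean square: both sums are combinations of the two eigen-directions,
    whose second moments are of order at most [n * (1 + ln n)]. *)
Lemma Ex_mean_sqr_cvg0 : Ex n (mean_sqr a1 a2) @[n --> \oo] --> 0.
Proof.
have [C C0 hC] := Ex_lin_sqr nr r_half a1E a2E.
have Nr2 : - r <= 2^-1 by have := r_gt0; lra.
have [D D0 hD] := Ex_lin_sqr nNr Nr2 a1N a2N.
pose K := (1 / 2 + 1 / (2 * theta ^+ 2)) * (C + D).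
have t2 : 0 < theta ^+ 2 by rewrite exprn_even_gt0.
apply: (@squeeze_cvgr _ _ _ _ (fun=> 0) (fun n => K * ((n.+1%:R)^-1 + ln n.+1%:R / n.+1%:R `^ 1))); first last.
- rewrite -(mulr0 K) -[X in K * X]addr0; apply: cvgMr; apply: cvgD; first exact: cvg_harmonic.
  by have := @ln_powR_cvg0 R 1 ltr01; rewrite -(cvg_shiftS (fun n => ln n%:R / n%:R `^ 1)).
- exact: cvg_cst.
near=> n; have n1 : (1 <= n)%N by near: n; exists 1%N.
apply/andP; split; first by apply: Ex_ge0 => // s _; exact: mean_sqr_ge0.
have N0 : (0 : R) < n.+1%:R by rewrite ltr0n.
pose c := (1 / 2 + 1 / (2 * theta ^+ 2)) / n.+1%:R ^+ 2.
have c0 : 0 <= c by rewrite divr_ge0 ?sqr_ge0// addr_ge0// divr_ge0// mulr_ge0// ltW.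
apply: (@le_trans _ _ (Ex n (fun s => c * (lin theta s ^+ 2 + lin (- theta) s ^+ 2)))).
  apply: le_Ex => // s ps; have sn := path_size ps.
  have sq1 (a : R) : `|a| <= 1 -> a ^+ 2 <= 1.
    by move=> h; rewrite -real_normK ?num_real// expr_le1.
  have e1 : mean1 a1 s ^+ 2 <= sum2 s ^+ 2 / n.+1%:R ^+ 2.
    by rewrite /mean1 sn -mulrA exprMn expr_div_n ler_piMl ?sq1// divr_ge0 ?sqr_ge0.
  have e2 : mean2 a2 s ^+ 2 <= sum1 s ^+ 2 / n.+1%:R ^+ 2.
    by rewrite /mean2 sn -mulrA exprMn expr_div_n ler_piMl ?sq1// divr_ge0 ?sqr_ge0.
  apply: (le_trans (lerD e1 e2)); rewrite -mulrDl /c mulrAC ler_wpM2r ?invr_ge0 ?sqr_ge0//.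
  rewrite sum2_lin sum1_lin; move: (lin theta s) (lin (- theta) s) => u v.
  rewrite -subr_ge0.
  have -> : (1 / 2 + 1 / (2 * theta ^+ 2)) * (u ^+ 2 + v ^+ 2) - (((u - v) / (2 * theta)) ^+ 2 + ((u + v) / 2) ^+ 2) =
     ((u - v) / 2) ^+ 2 + ((u + v) / (2 * theta)) ^+ 2 by field.
  by rewrite addr_ge0 ?sqr_ge0.
rewrite ExZ ExD; apply: (le_trans (ler_wpM2l c0 (lerD (hC n n1) (hD n n1)))).
by apply/eq_ler; rewrite /c /K powRr1 ?(ltW N0)//; field; rewrite theta_neq0 nat1r (gt_eqF N0).
Unshelve. all: by end_near. Qed.

Variable g : nat -> R.
Hypothesis g_gt0 : forall N, (2 <= N)%N -> 0 < g N.

(** The horizon [n] is frozen in the weights, so for fixed [n] this is a martingale along the path;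
    at time [n] the weights cancel the normalisations and leave [sum1 / g]. *)
Definition scheme n s : R :=
  (growth r n.+1 * mart r theta s + growth (- r) n.+1 * mart (- r) (- theta) s) / (2 * g n.+1).
Definition coefA n k : R :=
  (growth r n.+1 / growth r k.+2 + growth (- r) n.+1 / growth (- r) k.+2) / (2 * g n.+1).
Definition coefB n k : R :=
  theta * (growth r n.+1 / growth r k.+2 - growth (- r) n.+1 / growth (- r) k.+2) / (2 * g n.+1).

Lemma scheme_end n s : path_of n s -> scheme n s = sum1 s / g n.+1.
Proof.
move=> /path_size sn; rewrite /scheme /mart sn sum1_lin.
have E rho (x : R) : `|rho| <= 1 -> growth rho n.+1 * (x / growth rho n.+1) = x.
  by move=> h; rewrite mulrCA mulfV ?mulr1// gt_eqF// growth_gt0.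
by rewrite !E// invfM mulrA.
Qed.

Lemma scheme_rcons n k s e1 e2 : (1 <= k < n)%N -> path_of k s ->
  scheme n (rcons s (e1, e2)) =
  scheme n s + (coefA n k * (e1 - mean1 a1 s) + coefB n k * (e2 - mean2 a2 s)).
Proof.
move=> /andP[k1 kn] ps; rewrite /scheme /coefA /coefB.
rewrite (mart_rcons nr a1E a2E _ _ k1 ps) (mart_rcons nNr a1N a2N _ _ k1 ps) /drift.
have gn : g n.+1 != 0 by rewrite gt_eqF// g_gt0// ltnS (leq_trans k1 (ltnW kn)).
by field; rewrite gn !gt_eqF// growth_gt0.
Qed.

(** Expands [(u + v) ^+ 2 + theta ^+ 2 * (u - v) ^+ 2] for the growth ratios [u], [v]. The shift
    [j.-1] converts the index of [Ex] into the length of the list. *)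
Lemma coef_sqr_sum eta n : 
  \sum_(1 <= k < n) (coefA n k ^+ 2 + coefB n k ^+ 2) * eta k =
  ((1 + theta ^+ 2) * (wsum r r (fun j => eta j.-1) n.+1 + wsum (- r) (- r) (fun j => eta j.-1) n.+1) +
   2 * (1 - theta ^+ 2) * wsum r (- r) (fun j => eta j.-1) n.+1) / (4 * g n.+1 ^+ 2).
Proof.
rewrite /wsum !(big_add1 _ _ 1) /= -big_split /= !mulr_sumr -big_split /= mulr_suml.
apply: eq_bigr => k _; rewrite /coefA /coefB.
move: (_ / growth r _) (_ / growth (- r) _) => u v.
by rewrite !expr_div_n !exprMn (_ : 2 ^+ 2 = 4 :> R); [rewrite invfM; ring|ring].
Qed.

(** The weighted limit is assumed for every convergent [eta] because it is used twice: with the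
    constant [1] for the limiting variance, and with the mean of [mean_sqr] to kill the Lindeberg
    error. *)
Theorem scheme_limit (f : R -> R) (M v : R) :
  (forall eta (e : R), eta n @[n --> \oo] --> e ->
     ((1 + theta ^+ 2) * (wsum r r eta N + wsum (- r) (- r) eta N) +
      2 * (1 - theta ^+ 2) * wsum r (- r) eta N) / (4 * g N ^+ 2) @[N --> \oo] --> v * e) ->
  N%:R `^ r / g N @[N --> \oo] --> 0 -> 0 < v -> continuous f -> (forall x, `|f x| <= M) ->
  (Ex n (fun s => f (sum1 s / g n.+1))) @[n --> \oo] -->
    \int[lebesgue_measure]_a (f a * normal_pdf 0 (Num.sqrt v) a).
Proof.
move=> hw hg v0 cf fM.
have lim eta e : eta n @[n --> \oo] --> e ->
    \sum_(1 <= k < n) (coefA n k ^+ 2 + coefB n k ^+ 2) * eta k @[n --> \oo] --> v * e.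
  move=> he; have he' : eta n.-1 @[n --> \oo] --> e.
    by rewrite -(cvg_shiftS (fun n => eta n.-1)).
  have := hw _ _ he'; rewrite -[in X in X -> _](cvg_shiftS (fun N => _ / (4 * g N ^+ 2))).
  by apply: cvg_trans; apply: near_eq_cvg; apply: nearW => n; rewrite coef_sqr_sum.
have [D D0 hD] := growth_ratio (gtr0_norm r_gt0).
have [D' D0' hD'] := @growth_ratio (- r) (etrans (normrN _) (gtr0_norm r_gt0)).
pose K := 2 * (1 + `|theta|) * (D + D').
pose eps n := K * (n.+1%:R `^ r / g n.+1).
have K0 : 0 <= K by rewrite mulr_ge0// ?addr_ge0 ?(ltW D0) ?(ltW D0')// mulr_ge0// addr_ge0.
have epsc : eps n @[n --> \oo] --> 0.
  rewrite -(mulr0 K); apply: cvgMr.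
  by have := hg; rewrite -(cvg_shiftS (fun N => N%:R `^ r / g N)).
have ratio n k : (1 <= k <= n.+1)%N -> 
   0 <= growth r n.+1 / growth r k /\ 0 <= growth (- r) n.+1 / growth (- r) k /\
   growth r n.+1 / growth r k + growth (- r) n.+1 / growth (- r) k <= (D + D') * n.+1%:R `^ r.
  move=> kn; rewrite !divr_ge0 ?(ltW (growth_gt0 _ nr)) ?(ltW (growth_gt0 _ nNr))//.
  by rewrite mulrDl; do 2!split => //; apply: lerD; [exact: hD|exact: hD'].
have gb n (x : R) : (1 <= n)%N -> `|x| <= (D + D') * n.+1%:R `^ r * (2 * (2 * (1 + `|theta|))) ->
    `|x / (2 * g n.+1)| <= eps n.
  move=> n1 hx; have gn := g_gt0 (n1 : (2 <= n.+1)%N).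
  rewrite normrM normfV (gtr0_norm (_ : 0 < 2 * g n.+1)) ?mulr_gt0// ler_pdivrMr ?mulr_gt0//.
  by apply: (le_trans hx); rewrite /eps /K; apply/eq_ler; field; rewrite gt_eqF.
have th1 : 1 <= 2 * (2 * (1 + `|theta|)) by have := normr_ge0 theta; lra.
have DD0 : 0 <= D + D' by rewrite addr_ge0 ?ltW.
have Dn n : 0 <= (D + D') * n.+1%:R `^ r by rewrite mulr_ge0 ?powR_ge0.
have AB n k : (1 <= k < n)%N -> `|coefA n k| <= eps n /\ `|coefB n k| <= eps n.
  move=> /andP[k1 kn]; have n1 : (1 <= n)%N := leq_trans k1 (ltnW kn).
  have [u0 [v0' uv]] := @ratio n k.+2 kn.
  rewrite /coefA /coefB; move: (_ / growth r _) (_ / growth (- r) _) u0 v0' uv => u w u0 w0 uv.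
  split; apply: gb => //.
    rewrite ger0_norm ?addr_ge0//; apply: (le_trans uv).
    by apply: ler_peMr => //; exact: Dn.
  rewrite normrM mulrC; apply: ler_pM => //; last by have := normr_ge0 theta; lra.
  by rewrite (le_trans (ler_normB _ _))// !ger0_norm.
have X1 n s : (1 <= n)%N -> path_of 1 s -> `|scheme n s| <= eps n.
  move=> n1 ps; apply: gb => //.
  have [u0 [v0' uv]] := @ratio n 2 n1.
  have g2 rho : growth rho 2 = 1 :> R by rewrite /growth big_geq.
  have m1 := mart_bound theta nr ps; have m2 := mart_bound (- theta) nNr ps.
  rewrite !g2 !divr1 ?normrN in m1 m2 u0 v0' uv.
  apply: (le_trans (ler_normD _ _)).
  rewrite [`|growth r _ * _|]normrM [`|growth (- r) _ * _|]normrM (ger0_norm u0) (ger0_norm v0').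
  have T0 : 0 <= 2 * (1 + `|theta|) by rewrite mulr_ge0// addr_ge0.
  apply: (@le_trans _ _ ((D + D') * n.+1%:R `^ r * (2 * (1 + `|theta|)))).
    by apply: le_trans (ler_wpM2r T0 uv); rewrite [leRHS]mulrDl; apply: lerD; exact: ler_wpM2l.
  by rewrite ler_wpM2l//; lra.
have wv : \sum_(1 <= k < n) (coefA n k ^+ 2 + coefB n k ^+ 2) @[n --> \oo] --> v.
  have c1 : (fun=> 1 : R) n @[n --> \oo] --> (1 : R) by exact: cvg_cst.
  have := lim (fun=> 1) 1 c1; rewrite mulr1.
  rewrite (_ : (fun n => \sum_(1 <= k < n) _) = (fun n => \sum_(1 <= k < n) (coefA n k ^+ 2 + coefB n k ^+ 2)))//.
  by apply/funext => n; apply: eq_bigr => k _; rewrite mulr1.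
have wm : \sum_(1 <= k < n) (coefA n k ^+ 2 + coefB n k ^+ 2) * Ex k (mean_sqr a1 a2) @[n --> \oo] --> 0.
  by have := lim _ _ Ex_mean_sqr_cvg0; rewrite mulr0.
have [h1 h2] := martingale_heat_limit na1 na2 nx1 nx2 scheme_rcons AB X1 epsc wv wm (ltW v0).
have h := weak_limit_of_heat na1 na2 nx1 nx2 v0 h1 h2 cf fM.
apply: cvg_trans h; apply: near_eq_cvg; apply: nearW => n.
by apply: eq_Ex_path => // s ps; rewrite scheme_end.
Qed.

End elephant_scheme.

(** * The limiting variances and the scales *)

Section variances.
Context {R : realType}.
Variables (r theta : R).
Hypotheses (r_gt0 : 0 < r) (r_le1 : r <= 1).
Implicit Types (eta : nat -> R) (e : R).

Let nr : `|r| <= 1. Proof. by rewrite gtr0_norm. Qed.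
Let nNr : `|- r| <= 1. Proof. by rewrite normrN. Qed.

(** All three weighted sums are of order [N], with denominators [1 - 2 * r], [1 + 2 * r] and [1]. *)
Lemma subcritical_variance eta e : r < 2^-1 -> eta n @[n --> \oo] --> e ->
  ((1 + theta ^+ 2) * (wsum r r eta N + wsum (- r) (- r) eta N) +
   2 * (1 - theta ^+ 2) * wsum r (- r) eta N) / (4 * Num.sqrt N%:R ^+ 2) @[N --> \oo] -->
  (1 + 2 * (r * theta) ^+ 2 - 2 * r ^+ 2) / (1 - 4 * r ^+ 2) * e.
Proof.
move=> r2 he; have r0 := r_gt0.
have h1 : wsum r r eta N / N%:R @[N --> \oo] --> e / (1 - (r + r)).
  by apply: wsum_sub => //; lra.
have h2 : wsum (- r) (- r) eta N / N%:R @[N --> \oo] --> e / (1 - (- r + - r)).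
  by apply: wsum_sub => //; lra.
have h3 : wsum r (- r) eta N / N%:R @[N --> \oo] --> e / (1 - (r + - r)).
  by apply: wsum_sub => //; lra.
have -> : (1 + 2 * (r * theta) ^+ 2 - 2 * r ^+ 2) / (1 - 4 * r ^+ 2) * e =
  ((1 + theta ^+ 2) * (e / (1 - (r + r)) + e / (1 - (- r + - r))) +
   2 * (1 - theta ^+ 2) * (e / (1 - (r + - r)))) * 4^-1.
  have k1 : 1 - 2 * r != 0 by rewrite gt_eqF//; lra.
  have k2 : 1 + 2 * r != 0 by rewrite gt_eqF//; lra.
  have -> : 1 - 4 * r ^+ 2 = (1 - 2 * r) * (1 + 2 * r) by ring.
  have -> : 1 - (r + r) = 1 - 2 * r by ring.
  have -> : 1 - (- r + - r) = 1 + 2 * r by ring.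
  by rewrite subrr subr0; field; rewrite k1 k2.
rewrite (_ : (fun N => _) = (fun N => ((1 + theta ^+ 2) * (wsum r r eta N / N%:R + wsum (- r) (- r) eta N / N%:R) +
   2 * (1 - theta ^+ 2) * (wsum r (- r) eta N / N%:R)) * 4^-1)); last first.
  by apply/funext => N; rewrite sqr_sqrtr// invfM; ring.
by apply: cvgMl; apply: cvgD; apply: cvgMr => //; apply: cvgD.
Qed.

(** Only the [(r, r)] sum is of order [N * ln N]; the other two are of order [N] and vanish after
    division by [ln N]. *)
Lemma critical_variance eta e : r = 2^-1 -> eta n @[n --> \oo] --> e ->
  ((1 + theta ^+ 2) * (wsum r r eta N + wsum (- r) (- r) eta N) +
   2 * (1 - theta ^+ 2) * wsum r (- r) eta N) / (4 * Num.sqrt (N%:R * ln N%:R) ^+ 2) @[N --> \oo] -->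
  (1 + theta ^+ 2) / 4 * e.
Proof.
move=> r2 he; have r0 := r_gt0.
have iln : (ln (N%:R : R))^-1 @[N --> \oo] --> 0.
  apply/gtr0_cvgV0; last exact: lnn_cvgy.
  by near=> N; rewrite ln_gt0// ltr1n; near: N; exists 2%N.
have h1 : wsum r r eta N / (N%:R * ln N%:R) @[N --> \oo] --> e.
  by apply: wsum_crit => //; lra.
have h2 : wsum (- r) (- r) eta N / N%:R / ln N%:R @[N --> \oo] --> e / (1 - (- r + - r)) * 0.
  by apply: cvgM => //; apply: wsum_sub => //; lra.
have h3 : wsum r (- r) eta N / N%:R / ln N%:R @[N --> \oo] --> e / (1 - (r + - r)) * 0.
  by apply: cvgM => //; apply: wsum_sub => //; lra.
rewrite mulr0 in h2; rewrite mulr0 in h3.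
have -> : (1 + theta ^+ 2) / 4 * e = ((1 + theta ^+ 2) * (e + 0) + 2 * (1 - theta ^+ 2) * 0) * 4^-1.
  by rewrite mulr0; ring.
rewrite (_ : (fun N => _) = (fun N => ((1 + theta ^+ 2) * (wsum r r eta N / (N%:R * ln N%:R) + wsum (- r) (- r) eta N / N%:R / ln N%:R) +
   2 * (1 - theta ^+ 2) * (wsum r (- r) eta N / N%:R / ln N%:R)) * 4^-1)); last first.
  apply/funext => N; rewrite sqr_sqrtr; first by rewrite !invfM; ring.
  by case: N => [|N]; rewrite ?mul0r// mulr_ge0// ln_ge0// ler1n.
by apply: cvgMl; apply: cvgD; apply: cvgMr => //; apply: cvgD.
Unshelve. all: by end_near. Qed.

Lemma subcritical_scale : r < 2^-1 -> N%:R `^ r / Num.sqrt (N%:R : R) @[N --> \oo] --> 0.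
Proof.
move=> r2; have h : 0 < 2^-1 - r by rewrite subr_gt0.
have := powRn_cvg0 h; apply: cvg_trans; apply: near_eq_cvg; near=> N.
have N0 : (0 : R) < N%:R by rewrite ltr0n; near: N; exists 1%N.
by rewrite -powR12_sqrt// -powRN -powRD ?(gt_eqF N0) ?implybT// opprB.
Unshelve. all: by end_near. Qed.

Lemma critical_scale : r = 2^-1 -> N%:R `^ r / Num.sqrt (N%:R * ln (N%:R : R)) @[N --> \oo] --> 0.
Proof.
move=> r2; have : (Num.sqrt (ln (N%:R : R)))^-1 @[N --> \oo] --> 0.
  apply/gtr0_cvgV0.
    by near=> N; rewrite sqrtr_gt0 ln_gt0// ltr1n; near: N; exists 2%N.
  apply/cvgryPge => A; have /cvgryPge/(_ (A ^+ 2)) := @lnn_cvgy R; apply: filterS => N hN.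
  by apply: (le_trans (ler_norm A)); rewrite -sqrtr_sqr ler_wsqrtr.
apply: cvg_trans; apply: near_eq_cvg; near=> N.
have N0 : (0 : R) < N%:R by rewrite ltr0n; near: N; exists 1%N.
have s0 : 0 < Num.sqrt (N%:R : R) by rewrite sqrtr_gt0.
by rewrite r2 powR12_sqrt ?(ltW N0)// sqrtrM ?(ltW N0)// invfM mulrA mulfV ?mul1r// gt_eqF.
Unshelve. all: by end_near. Qed.

End variances.

(** * Limsup bounds and convergence in distribution for the first elephant *)

Section elephants.
Context {R : realType} {d : measure_display} {T : measurableType d}.
Variables (P : probability T R) (p1 p2 : R).
Variables (xi1 xi2 : nat -> T -> bool) (u1 u2 : nat -> T -> nat) (x1 x2 : R).
Hypothesis (model : two_elephant_model P p1 p2 xi1 xi2 u1 u2).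
Hypotheses (p1_01 : 0 <= p1 <= 1) (p2_01 : 0 <= p2 <= 1).
Hypotheses (nx1 : `|x1| = 1) (nx2 : `|x2| = 1).
Variables (r theta : R).
Local Notation a1 := (2 * p1 - 1).
Local Notation a2 := (2 * p2 - 1).
Local Notation Ex := (Ex a1 a2 x1 x2).
Local Notation steps := (steps xi1 xi2 u1 u2 x1 x2).
Local Notation S1n := (S1 xi1 xi2 u1 u2 x1 x2).
Hypotheses (r_gt0 : 0 < r) (r_le1 : r <= 1) (a1E : a1 = r * theta) (a2E : theta * a2 = r).

Let nr : `|r| <= 1. Proof. by rewrite gtr0_norm. Qed.
Let nNr : `|- r| <= 1. Proof. by rewrite normrN. Qed.
Let a1N : a1 = - r * - theta. Proof. by rewrite mulrNN. Qed.
Let a2N : - theta * a2 = - r. Proof. by rewrite mulNr a2E. Qed.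

Lemma limn_esup_le_near (u : nat -> R) (C : R) : (exists N, forall n, (N <= n)%N -> u n <= C) ->
  (limn_esup (fun n => (u n)%:E) <= C%:E)%E.
Proof.
move=> [N hN]; rewrite /limn_esup /limf_esup.
apply: (@le_trans _ _ (ereal_sup ((fun n => (u n)%:E) @` [set n | (N <= n)%N]))).
  by apply: ereal_inf_lbound; exists [set n | (N <= n)%N] => //; exists N.
by apply: ge_ereal_sup => _ [n Nn <-]; rewrite lee_fin hN.
Qed.

Lemma ae_limsup (f1 f2 : nat -> R) (C1 C2 : R) : 0 < C1 -> 0 < C2 ->
  envelope r theta f1 C1 -> envelope (- r) (- theta) f2 C2 ->
  (exists N, forall n, (N <= n)%N -> f2 n <= f1 n) -> (forall n, 0 <= f1 n) ->
  {ae P, forall w, (limn_esup (fun n => (`|S1n n w| / f1 n)%:E) <= (C1 + C2)%:E)%E}.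
Proof.
move=> C10 C20 e1 e2 [N0 hN0] f10.
have h1 := ae_envelope model p1_01 p2_01 nx1 nx2 nr a1E a2E e1.
have h2 := ae_envelope model p1_01 p2_01 nx1 nx2 nNr a1N a2N e2.
move: h1 h2; apply: filterS2 => w [N1 hN1] [N2 hN2].
apply: limn_esup_le_near; exists (maxn N0 (maxn N1 N2)) => n; rewrite !geq_max => /andP[n0 /andP[n1 n2]].
have := f10 n; rewrite le_eqVlt => /predU1P[<-|f1n]; first by rewrite invr0 mulr0 addr_ge0 ?ltW.
rewrite ler_pdivrMr//.
have -> : S1n n w = sum1 (steps n w) by [].
rewrite (sum1_lin theta) normrM (ger0_norm (_ : 0 <= 2^-1)) ?invr_ge0//.
apply: (@le_trans _ _ (`|lin theta (steps n w)| + `|lin (- theta) (steps n w)|)).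
  by apply: le_trans (ler_normD _ _); rewrite ler_piMr// invf_le1// ler1n.
rewrite [leRHS]mulrDl; apply: lerD; first exact: hN1.
by apply: (le_trans (hN2 n n2)); apply: ler_wpM2l; [exact: ltW|exact: hN0].
Qed.

Lemma distribution_limit (g : nat -> R) (v : R) :
  (forall (f : R -> R) (M : R), continuous f -> (forall x, `|f x| <= M) ->
    (Ex n (fun s => f (sum1 s / g n.+1))) @[n --> \oo] -->
      \int[lebesgue_measure]_a (f a * normal_pdf 0 (Num.sqrt v) a)) ->
  conv_in_distribution P (fun n w => S1n n w / g n) (normal_prob 0 (Num.sqrt v)).
Proof.
move=> h f cf [M fM].
have mf : measurable_fun [set: measurableTypeR R] f by exact: continuous_measurable_fun.
rewrite (integral_normal_prob_bounded _ mf fM).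
rewrite -(cvg_shiftS (fun n => (\int[P]_w (f (S1n n w / g n))%:E)%E)).
have E n : (\int[P]_w (f (S1n n.+1 w / g n.+1))%:E)%E = (Ex n (fun s => f (sum1 s / g n.+1)))%:E.
  (* The transfer [integral_steps] is for nonnegative functions, so the bounded [f] is shifted by
     its bound and the constant subtracted again. *)
  pose G s := f (sum1 s / g n.+1) + M.
  have G0 s : 0 <= G s by have := fM (sum1 s / g n.+1); rewrite ler_norml => /andP[+ _]; rewrite -subr_ge0 opprK.
  have := integral_steps model p1_01 p2_01 nx1 nx2 n G0.
  rewrite /G ExD Ex_cst.
  have mfs : measurable_fun setT (fun w => f (sum1 (steps n.+1 w) / g n.+1)).
    exact: (measurable_fun_steps x1 x2 model n (fun s => f (sum1 s / g n.+1))).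
  have ifs : P.-integrable setT (EFin \o (fun w => f (sum1 (steps n.+1 w) / g n.+1))).
    apply: (le_integrable measurableT (g := cst M%:E)).
    - exact/measurable_EFinP.
    - by move=> x _; rewrite /= lee_fin (le_trans (fM _))// ler_norm.
    - exact: (finite_measure_integrable_cst P M).
  have icst : P.-integrable setT (EFin \o (fun=> M)) by exact: finite_measure_integrable_cst.
  have ic : (\int[P]_x (EFin \o (fun=> M)) x)%E = M%:E.
    by apply: (etrans (integral_cst P measurableT M%:E)); rewrite [X in (_ * X)%E]probability_setT mule1.
  have iD := integralD measurableT ifs icst; rewrite ic in iD.
  rewrite [X in X = _ -> _](_ : _ = (\int[P]_w (f (S1n n.+1 w / g n.+1))%:E + M%:E)%E); last exact: iD.
  by move=> /(congr1 (fun z => (z - M%:E)%E)); rewrite EFinD !addeK.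
by rewrite (eq_cvg _ _ E); apply: cvg_EFin; [exact: nearW|exact: h].
Qed.

End elephants.

(** * The supercritical regime *)

Section supercritical.
Context {R : realType} {d : measure_display} {T : measurableType d}.
Variables (P : probability T R) (p1 p2 : R).
Variables (xi1 xi2 : nat -> T -> bool) (u1 u2 : nat -> T -> nat) (x1 x2 : R).
Hypothesis (model : two_elephant_model P p1 p2 xi1 xi2 u1 u2).
Hypotheses (p1_01 : 0 <= p1 <= 1) (p2_01 : 0 <= p2 <= 1).
Hypotheses (nx1 : `|x1| = 1) (nx2 : `|x2| = 1).
Variables (r theta : R).
Local Notation a1 := (2 * p1 - 1).
Local Notation a2 := (2 * p2 - 1).
Local Notation steps := (steps xi1 xi2 u1 u2 x1 x2).
Local Notation S1n := (S1 xi1 xi2 u1 u2 x1 x2).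
Local Notation S2n := (S2 xi1 xi2 u1 u2 x1 x2).
Hypotheses (r_gt : 2^-1 < r) (r_le1 : r <= 1) (a1E : a1 = r * theta) (a2E : theta * a2 = r).

Let r_gt0 : 0 < r. Proof. by apply: lt_trans r_gt; rewrite invr_gt0. Qed.
Let nr : `|r| <= 1. Proof. by rewrite gtr0_norm. Qed.
Let nNr : `|- r| <= 1. Proof. by rewrite normrN. Qed.
Let a1N : a1 = - r * - theta. Proof. by rewrite mulrNN. Qed.
Let a2N : - theta * a2 = - r. Proof. by rewrite mulNr a2E. Qed.
Let theta_neq0 : theta != 0.
Proof. by apply: contraTneq r_gt0 => t0; rewrite -a2E t0 mul0r ltxx. Qed.

Lemma sqrt_nlogn_powR : Num.sqrt (n%:R * ln (n%:R : R)) / n%:R `^ r @[n --> \oo] --> 0.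
Proof.
have h : 0 < 2 * r - 1 by have := r_gt; lra.
have c0 : Num.sqrt (ln (n%:R : R) / n%:R `^ (2 * r - 1)) @[n --> \oo] --> 0.
  have c := ln_powR_cvg0 h; rewrite -(sqrtr0 R).
  by apply: continuous_cvg c; exact: sqrt_continuous.
apply: cvg_trans c0; apply: near_eq_cvg; near=> n.
have n1 : (1 <= n)%N by near: n; exists 1%N.
have N0 : (0 : R) < n%:R by rewrite ltr0n.
have e : n%:R `^ (2 * r - 1) = (n%:R `^ r) ^+ 2 / n%:R :> R.
  rewrite powRD ?(gt_eqF N0) ?implybT// [2 * r]mulrC powRrM powR_mulrn ?powR_ge0//.
  by rewrite powRN powRr1// ltW.
have p0 : 0 < (n%:R : R) `^ r by rewrite powR_gt0.
rewrite e invf_div mulrA [ln _ * _]mulrC sqrtrM ?mulr_ge0 ?ln_ge0 ?ler1n//.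
by rewrite sqrtrV ?sqr_ge0// sqrtr_sqr gtr0_norm.
Unshelve. all: by end_near. Qed.

(** The combination with eigenvalue [- r] is at most of order [sqrt (n * ln n)], which is negligible
    against [n ^ r] for [r > 1/2]; both walks therefore follow the first martingale. *)
Lemma ae_supercritical (kappa : R) : growth r n / n%:R `^ r @[n --> \oo] --> kappa ->
  {ae P, forall w, exists l : R, [/\ mart r theta (steps n w) @[n --> \oo] --> l,
    S1n n w / n%:R `^ r @[n --> \oo] --> kappa * l / 2 &
    S2n n w / n%:R `^ r @[n --> \oo] --> kappa * l / (2 * theta)]}.
Proof.
move=> hk; have Nr2 : - r < 2^-1 by have := r_gt; lra.
have [C C0 /(ae_envelope model p1_01 p2_01 nx1 nx2 nNr a1N a2N) h2] := @envelope_log R (- r) (- theta) nNr Nr2.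
have h1 := mart_cvg model p1_01 p2_01 nx1 nx2 nr a1E a2E r_gt.
move: h1 h2; apply: filterS2 => w [l hl] [N hN]; exists l.
have linE rho th n : `|rho| <= 1 -> lin th (steps n w) = growth rho n * mart rho th (steps n w).
  by move=> h; rewrite /mart size_steps mulrCA mulfV ?mulr1// gt_eqF// growth_gt0.
have c1 : lin theta (steps n w) / n%:R `^ r @[n --> \oo] --> kappa * l.
  rewrite (_ : (fun n => lin theta (steps n w) / n%:R `^ r) =
    (fun n => growth r n / n%:R `^ r * mart r theta (steps n w))); first exact: cvgM.
  by apply/funext => n; rewrite (linE r)// mulrAC.
have c2 : lin (- theta) (steps n w) / n%:R `^ r @[n --> \oo] --> 0.
  apply/cvgr0Pnorm_le => e e0.
  have : C * (Num.sqrt (n%:R * ln (n%:R : R)) / n%:R `^ r) @[n --> \oo] --> 0.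
    by rewrite -(mulr0 C); apply: cvgMr; exact: sqrt_nlogn_powR.
  move=> /cvgr0Pnorm_le/(_ e e0)[M _ hM]; exists (maxn N M) => // n /=.
  rewrite geq_max => /andP[Nn Mn]; apply: le_trans (hM n Mn).
  rewrite mulrA !normrM ler_wpM2r// -normrM; apply: (le_trans (hN n Nn)); exact: ler_norm.
split=> //.
- rewrite (_ : (fun n => S1n n w / n%:R `^ r) = (fun n =>
      (lin theta (steps n w) / n%:R `^ r + lin (- theta) (steps n w) / n%:R `^ r) * 2^-1)).
    by rewrite -[kappa * l]addr0; apply: cvgMl; exact: cvgD.
  apply/funext => n; rewrite (_ : S1n n w = sum1 (steps n w))// (sum1_lin theta).
  by rewrite mulrAC mulrDl.
- rewrite (_ : (fun n => S2n n w / n%:R `^ r) = (fun n =>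
      (lin theta (steps n w) / n%:R `^ r - lin (- theta) (steps n w) / n%:R `^ r) * (2 * theta)^-1)).
    by rewrite -[kappa * l]subr0; apply: cvgMl; exact: cvgB.
  apply/funext => n; rewrite (_ : S2n n w = sum2 (steps n w))// (sum2_lin r_gt0 a2E).
  by rewrite mulrAC mulrBl.
Qed.

(** Defining the limit as the finite part of a limsup makes it measurable on the whole space,
    including where the limit fails to exist. *)
Lemma measurable_limsup (F : seq (R * R) -> R) (g : nat -> R) :
  measurable_fun setT (fun w => fine (limn_esup (fun n => (F (steps n w) / g n)%:E))).
Proof.
apply: measurableT_comp => //; apply: (measurable_fun_limn_esup (f := fun n w => (F (steps n w) / g n)%:E)) => n.
apply/measurable_EFinP; case: n => [|n].
  by rewrite (_ : (fun _ => _) = cst (F [::] / g 0%N))//; exact: measurable_cst.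
exact: (measurable_fun_steps x1 x2 model n (fun s => F s / g n.+1)).
Qed.

Theorem supercritical_limits : a1 != 0 -> a2 != 0 -> 0 < a1 * a2 ->
  (a1 = 1 -> a2 = 1 -> x1 != x2) -> (a1 = -1 -> a2 = -1 -> x1 = x2) ->
  exists W W2 : T -> R, [/\ measurable_fun setT W, measurable_fun setT W2,
    {ae P, forall w,
       (fun n : nat => S1n n w / n%:R `^ r) @ \oo --> W w /\
       (fun n : nat => S2n n w / n%:R `^ r) @ \oo --> W2 w /\
       W w = theta * W2 w} &
    ~ (exists c : R, {ae P, forall w, W w = c})].
Proof.
move=> a10 a20 a12 h1 h2; have [kappa k0 hk] := growth_cvg nr.
have h := ae_supercritical hk.
pose W w := fine (limn_esup (fun n => (sum1 (steps n w) / n%:R `^ r)%:E)).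
pose W2 w := fine (limn_esup (fun n => (sum2 (steps n w) / n%:R `^ r)%:E)).
have limE (u : nat -> R) (l : R) : u n @[n --> \oo] --> l -> fine (limn_esup (fun n => (u n)%:E)) = l.
  move=> ul; have : (u n)%:E @[n --> \oo] --> l%:E by apply: cvg_EFin => //; exact: nearW.
  by move=> /cvg_limn_einf_sup[_ ->].
exists W, W2; split; try exact: measurable_limsup.
- move: h; apply: filterS => w [l [_ l1 l2]].
  have e1 : W w = kappa * l / 2 by exact: limE.
  have e2 : W2 w = kappa * l / (2 * theta) by exact: limE.
  by rewrite e1 e2; split => //; split => //; field.
move=> [c hc]; apply: (mart_not_cst model p1_01 p2_01 nx1 nx2 nr a1E a2E r_gt a10 a20 a12 h1 h2).
exists (c * 2 / kappa); move: h hc; apply: filterS2 => w [l [hl l1 _]] Wc.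
have e1 : W w = kappa * l / 2 by exact: limE.
rewrite (_ : c * 2 / kappa = l)//; rewrite -Wc e1; field; by rewrite gt_eqF.
Qed.

End supercritical.

(** * Assembly of the three regimes *)

Theorem theorem1p2 (R : realType) (p1 p2 : R) :
  0 <= p1 <= 1 -> 0 <= p2 <= 1 ->
  let a1 := 2 * p1 - 1 in let a2 := 2 * p2 - 1 in
  0 < a1 * a2 ->
  let lam := Num.sg a2 * Num.sqrt (a1 * a2) in
  exists C : R, 0 < C /\
  forall (d : measure_display) (T : measurableType d) (P : probability T R)
    (xi1 xi2 : nat -> T -> bool) (u1 u2 : nat -> T -> nat) (x1 x2 : R),
    two_elephant_model P p1 p2 xi1 xi2 u1 u2 ->
    (x1 = 1 \/ x1 = -1) -> (x2 = 1 \/ x2 = -1) ->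
    (a1 = 1 -> a2 = 1 -> x1 != x2) ->
    (a1 = -1 -> a2 = -1 -> x1 = x2) ->
    let S1n := S1 xi1 xi2 u1 u2 x1 x2 in
    let S2n := S2 xi1 xi2 u1 u2 x1 x2 in
    [/\
     (* (i) *)
     `|lam| < 2^-1 ->
       {ae P, forall w, (limn_esup (fun n : nat =>
           (`|S1n n w| / Num.sqrt (n%:R * ln (ln n%:R)))%:E) <= C%:E)%E}
       /\ conv_in_distribution P (fun n w => S1n n w / Num.sqrt n%:R)
            (normal_prob 0 (Num.sqrt ((1 + 2 * a1 ^+ 2 - 2 * a1 * a2)
                                       / (1 - 4 * a1 * a2)))
              : probability (measurableTypeR R) R),
     (* (ii) *)
     `|lam| = 2^-1 ->
       {ae P, forall w, (limn_esup (fun n : nat =>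
           (`|S1n n w| / Num.sqrt (n%:R * ln n%:R * ln (ln (ln n%:R))))%:E)
             <= C%:E)%E}
       /\ conv_in_distribution P
            (fun n w => S1n n w / Num.sqrt (n%:R * ln n%:R))
            (normal_prob 0 (Num.sqrt ((a1 + a2) / (4 * a2)))
              : probability (measurableTypeR R) R) &
     (* (iii) *)
     2^-1 < `|lam| ->
       exists W W2 : T -> R,
         [/\ measurable_fun setT W, measurable_fun setT W2,
          {ae P, forall w,
             (fun n : nat => S1n n w / n%:R `^ `|lam|) @ \oo --> W w /\
             (fun n : nat => S2n n w / n%:R `^ `|lam|) @ \oo --> W2 w /\
             W w = Num.sg a2 * Num.sqrt (a1 / a2) * W2 w} &
          ~ (exists c : R, {ae P, forall w, W w = c})]].
Proof.
move=> p1_01 p2_01 a1 a2 a12 lam.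
have na1 : `|a1| <= 1.
  by case/andP: p1_01 => ? ?; rewrite ler_norml /a1; apply/andP; split; lra.
have na2 : `|a2| <= 1.
  by case/andP: p2_01 => ? ?; rewrite ler_norml /a2; apply/andP; split; lra.
have a10 : a1 != 0 by apply: contraTneq a12 => ->; rewrite mul0r ltxx.
have a20 : a2 != 0 by apply: contraTneq a12 => ->; rewrite mulr0 ltxx.
(* [r] is the absolute value of [lam], and [theta] equals [Num.sg a2 * Num.sqrt (a1 / a2)], the
   factor relating the two limits in (iii). *)
pose r := Num.sqrt (a1 * a2); pose theta := r / a2.
have r0 : 0 < r by rewrite sqrtr_gt0.
have rr : r ^+ 2 = a1 * a2 by rewrite sqr_sqrtr// ltW.
have r1 : r <= 1.
  rewrite -(@ler_pXn2r _ 2)// ?nnegrE ?(ltW r0)// rr expr1n -(gtr0_norm a12) normrM.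
  by rewrite mulr_ile1.
have a2E : theta * a2 = r by rewrite /theta divfK.
have a1E : a1 = r * theta by rewrite /theta mulrA -expr2 rr mulfK.
have nr : `|r| <= 1 by rewrite gtr0_norm.
have nNr : `|- r| <= 1 by rewrite normrN.
have lamE : `|lam| = r by rewrite /lam normrM normr_sg a20 mul1r gtr0_norm.
have sgE : Num.sg a2 * Num.sqrt (a1 / a2) = theta.
  have -> : a1 / a2 = a1 * a2 * (a2^-1) ^+ 2 by field.
  rewrite sqrtrM ?(ltW a12)// sqrtr_sqr -/r /theta normfV mulrCA; congr (_ * _).
  have s0 : Num.sg a2 != 0 by rewrite sgr_eq0.
  rewrite {3}(numEsg a2) invfM; congr (_ * _).
  by rewrite invr_sg.
have ltN : - r < 2^-1 by rewrite (@lt_trans _ _ 0) ?invr_gt0// oppr_lt0.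
have sgn_norm (x : R) : x = 1 \/ x = -1 -> `|x| = 1.
  by case=> ->; rewrite ?normrN normr1.
have ddz : 0 < 1 + theta ^+ 2 by rewrite ltr_pwDl// sqr_ge0.
(* The regime is decided from [r] before [C] is given, so the constant may differ between regimes
   while still depending only on the parameters. *)
have [hr|hr|hr] := ltgtP r 2^-1.
- have [C1 C10 e1] := envelope_sub theta nr hr.
  have [C2 C20 e2] := envelope_sub (- theta) nNr ltN.
  exists (C1 + C2); split; first exact: addr_gt0.
  move=> d T P xi1 xi2 u1 u2 x1 x2 model /sgn_norm nx1 /sgn_norm nx2 _ _ S1n S2n.
  split; rewrite lamE => hr'; [|by move: hr; rewrite hr' ltxx|by move: (lt_trans hr hr'); rewrite ltxx].
  split.
    apply: (ae_limsup model p1_01 p2_01 nx1 nx2 r0 r1 a1E a2E C10 C20 e1 e2); first by exists 0%N.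
    by move=> n; exact: sqrtr_ge0.
  have v0 : 0 < (1 + 2 * a1 ^+ 2 - 2 * a1 * a2) / (1 - 4 * a1 * a2).
    have r22 : r ^+ 2 < 4^-1.
      rewrite (_ : 4^-1 = 2^-1 ^+ 2); last by field.
      by rewrite ltrXn2r// ?nnegrE ?(ltW r0)// invr_ge0.
    have a1s := sqr_ge0 a1; rewrite rr in r22.
    by rewrite divr_gt0//; lra.
  apply: (distribution_limit model p1_01 p2_01 nx1 nx2) => f M cf fM.
  apply: (scheme_limit (g := fun N => Num.sqrt N%:R) na1 na2 nx1 nx2 r0 (ltW hr) a1E a2E _ _ _ v0 cf fM).
  + by move=> N N2; rewrite sqrtr_gt0 ltr0n ltnW.
  + move=> eta e he; have := subcritical_variance (theta := theta) r0 r1 hr he.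
    by rewrite -a1E rr !mulrA.
  + exact: subcritical_scale.
- have r2 : 2^-1 < r by [].
  (* The bounds in (i) and (ii) are vacuous for this [r], so any positive constant is a witness. *)
  exists 1; split => // d T P xi1 xi2 u1 u2 x1 x2 model /sgn_norm nx1 /sgn_norm nx2 d1 d2 S1n S2n.
  split; rewrite lamE => hr'; [by move: (lt_trans hr hr'); rewrite ltxx|by move: hr; rewrite hr' ltxx|].
  rewrite sgE; exact: (supercritical_limits model p1_01 p2_01 nx1 nx2 r2 r1 a1E a2E a10 a20 a12 d1 d2).
- have [C1 C10 e1] := envelope_crit theta nr hr.
  have [C2 C20 e2] := envelope_log (- theta) nNr ltN.
  exists (C1 + C2); split; first exact: addr_gt0.
  move=> d T P xi1 xi2 u1 u2 x1 x2 model /sgn_norm nx1 /sgn_norm nx2 _ _ S1n S2n.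
  split; rewrite lamE => hr'; [by move: hr'; rewrite hr ltxx| |by move: hr'; rewrite hr ltxx].
  split.
    apply: (ae_limsup model p1_01 p2_01 nx1 nx2 r0 r1 a1E a2E C10 C20 e1 e2); last first.
      by move=> n; exact: sqrtr_ge0.
    (* The envelope [sqrt (n * ln n)] of the second combination is below the critical one as soon as
       [ln (ln (ln n))] reaches [1]. *)
    have [N hN] := @near_ln_ge R (expR (expR 1)); exists N => n /hN hn.
    have l1 : expR 1 <= ln (ln (n%:R : R)).
      by rewrite -[leLHS]expRK ler_ln ?posrE ?expR_gt0// (lt_le_trans _ hn)// expR_gt0.
    have l2 : 1 <= ln (ln (ln (n%:R : R))).
      by rewrite -[leLHS]expRK ler_ln ?posrE ?expR_gt0// (lt_le_trans _ l1)// expR_gt0.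
    apply: ler_wsqrtr; rewrite ler_peMr// mulr_ge0// (le_trans _ hn)// expR_ge0.
  have v0 : 0 < (a1 + a2) / (4 * a2).
    have -> : (a1 + a2) / (4 * a2) = (1 + theta ^+ 2) / 4.
      rewrite {1}a1E -{1}a2E; field; exact/a20.
    by rewrite divr_gt0.
  apply: (distribution_limit model p1_01 p2_01 nx1 nx2) => f M cf fM.
  have r_le : r <= 2^-1 by rewrite hr.
  apply: (scheme_limit (g := fun N => Num.sqrt (N%:R * ln N%:R)) na1 na2 nx1 nx2 r0 r_le a1E a2E _ _ _ v0 cf fM).
  + by move=> N N2; rewrite sqrtr_gt0 mulr_gt0 ?ltr0n ?(ltnW N2)// ln_gt0// ltr1n.
  + move=> eta e he; have := critical_variance (theta := theta) r0 r1 hr he.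
    rewrite (_ : (1 + theta ^+ 2) / 4 = (a1 + a2) / (4 * a2))//.
    rewrite {1}a1E -{1}a2E; field; exact/a20.
  + exact: critical_scale.
Qed.
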